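(* Let $N\ge 1$ be an integer. Let $z_k=r_ke^{i\theta_k}$ ($k=1,2,3,\dots$, with $r_k>0$ and $0<\theta_k<\pi$) be the zeros of $e^z-T_{N-1}(z)$ lying in the open upper half-plane, listed in order of increasing modulus. Then for every $s\in\mathbb{C}$ with $\Re(s)<0$, $$\zeta_N(s)=2(-1)^{N-1}(N-1)!\,\Gamma\big(1-(s+N-1)\big)\sum_{k=1}^{\infty} r_k^{\,s-1}\cos\big[(s-1)(\pi-\theta_k)\big],$$ where $r_k^{s-1}=e^{(s-1)\log r_k}$ with the real logarithm.
   Context: For an integer $M\ge 0$, $T_M(x)=\sum_{k=0}^{M}\frac{x^k}{k!}$ is the degree-$M$ Taylor polynomial of $e^x$ at $0$. For an integer $N\ge1$, the hypergeometric zeta function is defined for $\Re(s)>1$ by $$\zeta_N(s)=\frac{1}{\Gamma(s+N-1)}\int_0^\infty \frac{x^{s+N-2}}{e^x-T_{N-1}(x)}\,dx,$$ and $\zeta_N$ also denotes its meromorphic continuation to the whole complex plane (its only possible poles are at the integers $2-N,\dots,1$). Note $\zeta_1$ is the Riemann zeta function.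
   Formalization: For N ≥ 3 the points s = 2−N, …, −1 are excluded from the displayed equation, because Γ(1−(s+N−1)) has a pole there and the right-hand side is undefined; convergence of the series is still proved for every s with Re(s) < 0. *)

(* Defs.v *)
From Stdlib Require Import Reals ZArith.
From Coquelicot Require Import Coquelicot.
Open Scope C_scope.

Definition Cexp (z : C) : C :=
  RtoC (exp (Re z)) * (cos (Im z), sin (Im z)).

Definition Ccos (z : C) : C := (Cexp (Ci * z) + Cexp (- (Ci * z))) / RtoC 2.

(* [x ^ w] for real [x > 0]; the values at [x <= 0] are irrelevant. *)
Definition Rpow_C (x : R) (w : C) : C := Cexp (w * RtoC (ln x)).

(* Improper at both ends, with independent limits. *)
Definition Cint_0_infty (f : R -> C) : C :=
  RInt_gen (V := C_R_CompleteNormedModule) f (at_right 0) (Rbar_locally p_infty).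

Fixpoint rising (z : C) (n : nat) : C :=
  match n with
  | O => RtoC 1
  | S m => rising z m * (z + RtoC (INR m))
  end.

Definition Gamma_integral (z : C) : C :=
  Cint_0_infty (fun t => RtoC (exp (- t)) * Rpow_C t (z - RtoC 1)).

(* Euler's integral for [Re z > 0] (where [n = 0]), continued to the other
   half-plane by [Gamma z = Gamma (z + n) / (z (z + 1) ... (z + n - 1))] with the
   least [n] such that [Re z + n > 0].  The values at 0, -1, -2, ... are junk. *)
Definition CGamma (z : C) : C :=
  let n := Z.to_nat (up (- Re z)) in
  Gamma_integral (z + RtoC (INR n)) / rising z n.

Definition exp_taylor (M : nat) (z : C) : C :=
  sum_n (G := C_AbelianMonoid) (fun k => z ^ k / RtoC (INR (fact k))) M.

Definition exp_remainder (N : nat) (z : C) : C := Cexp z - exp_taylor (N - 1) z.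

Definition hzeta_integral (N : nat) (s : C) : C :=
  / CGamma (s + RtoC (INR N) - RtoC 1) *
  Cint_0_infty (fun x =>
    Rpow_C x (s + RtoC (INR N) - RtoC 2) / exp_remainder N (RtoC x)).

Definition holomorphic_at (f : C -> C) (z : C) : Prop :=
  locally z (fun w => ex_derive (K := C_AbsRing) (V := C_NormedModule) f w).

Definition meromorphic_at (f : C -> C) (p : C) : Prop :=
  exists (m : nat) (g : C -> C), holomorphic_at g p /\
    locally' p (fun w => g w = (w - p) ^ m * f w).

(* [zeta] is the meromorphic continuation of [hzeta_integral N] to the plane, with
   no poles outside {2-N, ..., 1}.  It is determined off this finite set by the
   identity theorem; its values on the set are left unspecified. *)
Definition is_hzeta (N : nat) (zeta : C -> C) : Prop :=
  (forall s : C, (1 < Re s)%R -> zeta s = hzeta_integral N s) /\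
  (forall s : C,
     (forall k : Z, (2 - Z.of_nat N <= k <= 1)%Z -> s <> RtoC (IZR k)) ->
     holomorphic_at zeta s) /\
  (forall k : Z, (2 - Z.of_nat N <= k <= 1)%Z -> meromorphic_at zeta (RtoC (IZR k))).

(* Listing without repetition loses no multiplicity: if [f = exp_remainder N] then
   [f - f' = - z^(N-1) / (N-1)!], so every zero of [f] other than 0 is simple. *)
Definition lists_upper_zeros (N : nat) (z : nat -> C) : Prop :=
  (forall k, exp_remainder N (z k) = RtoC 0 /\ (0 < Im (z k))%R) /\
  (forall w : C, exp_remainder N w = RtoC 0 -> (0 < Im w)%R -> exists k, z k = w) /\
  (forall j k, z j = z k -> j = k) /\
  (forall k, (Cmod (z k) <= Cmod (z (S k)))%R).

(* Main.v *)
(* Put [f z = e^z - T_{N-1}(z)] and [g z = z^(N-1) / ((N-1)! f z) = f' z / f z - 1].  All residues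
   of [g] at the nonzero zeros of [f] are 1, and for [Re s > 1]
   [Gamma (s + N - 1) zeta_N s = (N-1)! * int_0^oo x^(s-1) g x dx].
   A keyhole contour around the positive axis, with an inner circle of radius [1/e], shows that
   [1 - e^(2 PI i s)] times this integral extends to an entire function [K].  For [Re s < 0] the
   outer circle of the keyhole can be sent to infinity along radii on which [g] stays bounded, and
   the residues give [K s = - 2 PI i e^(PI i s) * sum_k 2 r_k^(s-1) cos ((s-1) (PI - theta_k))].
   The identity theorem and [Gamma s Gamma (1-s) (1 - e^(2 PI i s)) = - 2 PI i e^(PI i s)], which is
   itself a keyhole integral of [1 / (1 + z)], connect the two half-planes. *)

Require Import Defs.
From Stdlib Require Import Reals ZArith Lra Lia List IndefiniteDescription FinFun.
From Coquelicot Require Import Coquelicot.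
Open Scope C_scope.

(** * Continuity and complex derivatives *)

(** All closed contours are borders of rectangles. In the coordinate [w = ln z] a circle about the
    origin is a vertical segment of length [2 PI], so annuli and keyholes become rectangles, and
    powers become exponentials: the improper integrals are Laplace transforms, holomorphic by an
    explicit quadratic error bound. The mean value over circles obtained this way, combined with
    disc automorphisms, replaces power series in the identity theorem. The keyhole identity has the
    factor [1 - e^(2 PI i s)], which vanishes at the integers, so it says nothing about [zeta s] at
    negative integers. It is therefore first continued into [0 < Re s < 1]; there the reflection
    formula trades the factor for [e^(PI i s)], which has no zeros, and only then does the
    continuation go further left. Its paths stay off the real axis, where the possible poles are,
    except perhaps at the end point. Two facts about the zeros are needed: there are large circles
    on which [e^z] and the Taylor polynomial cannot nearly cancel, and [r_k] grows at least
    linearly, which makes the series converge. *)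

Lemma Cmod_minus_sym (a b : C) : Cmod (a - b) = Cmod (b - a).
Proof. rewrite <- Cmod_opp. f_equal. ring. Qed.

Lemma Cmod_sub_triangle (a b : C) : (Cmod a - Cmod b <= Cmod (a - b))%R.
Proof.
  assert (H := Cmod_triangle (a - b) b).
  replace (a - b + b) with a in H by ring. lra.
Qed.

Lemma Cmod_minus_triangle (a b : C) : (Cmod (a - b) <= Cmod a + Cmod b)%R.
Proof.
  unfold Cminus. eapply Rle_trans; [apply Cmod_triangle|]. rewrite Cmod_opp. lra.
Qed.

Lemma Cmod_RtoC (x : R) : Cmod (RtoC x) = Rabs x.
Proof. apply Cmod_R. Qed.

Lemma RtoC_neq_0 x : x <> 0%R -> RtoC x <> 0.
Proof. intros H E. apply H. now apply RtoC_inj in E. Qed.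

Lemma upper_bound4 (a b c d : R) : exists m, (a <= m /\ b <= m /\ c <= m /\ d <= m)%R.
Proof.
  exists (Rmax (Rmax a b) (Rmax c d)).
  assert (M1 := Rmax_l (Rmax a b) (Rmax c d)). assert (M2 := Rmax_r (Rmax a b) (Rmax c d)).
  assert (M3 := Rmax_l a b). assert (M4 := Rmax_r a b).
  assert (M5 := Rmax_l c d). assert (M6 := Rmax_r c d). lra.
Qed.

Lemma lower_bound4_pos (a b c d : R) : (0 < a)%R -> (0 < b)%R -> (0 < c)%R -> (0 < d)%R ->
  exists m, (0 < m /\ m <= a /\ m <= b /\ m <= c /\ m <= d)%R.
Proof.
  intros Ha Hb Hc Hd. exists (Rmin (Rmin a b) (Rmin c d)).
  assert (M1 := Rmin_l (Rmin a b) (Rmin c d)). assert (M2 := Rmin_r (Rmin a b) (Rmin c d)).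
  assert (M3 := Rmin_l a b). assert (M4 := Rmin_r a b).
  assert (M5 := Rmin_l c d). assert (M6 := Rmin_r c d).
  assert (0 < Rmin (Rmin a b) (Rmin c d))%R by (repeat apply Rmin_pos; auto). lra.
Qed.

Lemma div_succ_pos (c e : R) : (0 <= c)%R -> (0 < e)%R -> (0 < e / (c + 1))%R.
Proof. intros. apply Rdiv_lt_0_compat; lra. Qed.

(** Serves to allot an error [e] to a product whose factor [c] may be [0]; the [+ 1] keeps the
    quotient defined. *)
Lemma mult_lt_div_succ (c x e : R) : (0 <= c)%R -> (0 <= x)%R -> (x < e / (c + 1))%R ->
  (c * x <= e)%R.
Proof.
  intros Hc Hx H. apply Rle_trans with ((c + 1) * (e / (c + 1)))%R.
  - apply Rmult_le_compat; lra.
  - right. field. lra.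
Qed.

(* [iota : T -> C] is either the inclusion of the real line or the identity of [C];
   it lets real and complex variables share one calculus. *)
Definition cont {T : Type} (iota : T -> C) (f : T -> C) (x : T) : Prop :=
  forall eps : R, (0 < eps)%R -> exists delta : R, (0 < delta)%R /\
    forall y, (Cmod (iota y - iota x) < delta)%R -> (Cmod (f y - f x) < eps)%R.

(* Caratheodory's form of differentiability. *)
Definition der {T : Type} (iota : T -> C) (f : T -> C) (x : T) (l : C) : Prop :=
  exists q : T -> C, (forall y, f y = f x + q y * (iota y - iota x)) /\
    q x = l /\ cont iota q x.

Definition cid (z : C) : C := z.

Section Calculus.
Context {T : Type} (iota : T -> C).

Lemma cont_const (c : C) x : cont iota (fun _ => c) x.
Proof.
  intros eps He. exists 1%R. split; [lra|]. intros y _.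
  replace (c - c) with (RtoC 0) by ring. rewrite Cmod_0. exact He.
Qed.

Lemma cont_iota x : cont iota iota x.
Proof. intros eps He. exists eps. split; auto. Qed.

Lemma cont_plus f g x : cont iota f x -> cont iota g x ->
  cont iota (fun y => f y + g y) x.
Proof.
  intros Hf Hg eps He.
  destruct (Hf (eps / 2)%R) as [d1 [Hd1 H1]]; [lra|].
  destruct (Hg (eps / 2)%R) as [d2 [Hd2 H2]]; [lra|].
  exists (Rmin d1 d2). split; [apply Rmin_pos; auto|]. intros y Hy.
  replace (f y + g y - (f x + g x)) with ((f y - f x) + (g y - g x)) by ring.
  eapply Rle_lt_trans; [apply Cmod_triangle|].
  specialize (H1 y (Rlt_le_trans _ _ _ Hy (Rmin_l _ _))).
  specialize (H2 y (Rlt_le_trans _ _ _ Hy (Rmin_r _ _))). lra.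
Qed.

Lemma cont_mult f g x : cont iota f x -> cont iota g x ->
  cont iota (fun y => f y * g y) x.
Proof.
  intros Hf Hg eps He.
  pose (a := Cmod (f x)). pose (b := Cmod (g x)).
  assert (Ha : (0 <= a)%R) by apply Cmod_ge_0.
  assert (Hb : (0 <= b)%R) by apply Cmod_ge_0.
  pose (e1 := Rmin 1 (eps / (a + b + 1))%R).
  assert (He1 : (0 < e1)%R).
  { apply Rmin_pos; [lra|]. apply Rdiv_lt_0_compat; lra. }
  destruct (Hf e1 He1) as [d1 [Hd1 H1]].
  destruct (Hg e1 He1) as [d2 [Hd2 H2]].
  exists (Rmin d1 d2). split; [apply Rmin_pos; auto|]. intros y Hy.
  specialize (H1 y (Rlt_le_trans _ _ _ Hy (Rmin_l _ _))).
  specialize (H2 y (Rlt_le_trans _ _ _ Hy (Rmin_r _ _))).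
  replace (f y * g y - f x * g x) with
    ((f y - f x) * (g y - g x) + (f y - f x) * g x + f x * (g y - g x)) by ring.
  eapply Rle_lt_trans; [apply Cmod_triangle|].
  eapply Rle_lt_trans; [apply Rplus_le_compat_r, Cmod_triangle|].
  rewrite !Cmod_mult. fold a b.
  assert (K : (e1 * (a + b + 1) <= eps)%R).
  { apply Rle_trans with (eps / (a + b + 1) * (a + b + 1))%R.
    - apply Rmult_le_compat_r; [lra|apply Rmin_r].
    - right. field. lra. }
  assert (He1' : (e1 <= 1)%R) by apply Rmin_l.
  assert (P1 := Cmod_ge_0 (f y - f x)). assert (P2 := Cmod_ge_0 (g y - g x)).
  set (u := Cmod (f y - f x)) in *. set (v := Cmod (g y - g x)) in *.
  assert (u * v <= u * 1)%R by (apply Rmult_le_compat_l; lra).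
  assert (u * b <= e1 * b)%R by (apply Rmult_le_compat_r; lra).
  assert (a * v <= a * e1)%R by (apply Rmult_le_compat_l; lra).
  nra.
Qed.

Lemma cont_opp f x : cont iota f x -> cont iota (fun y => - f y) x.
Proof.
  intros Hf eps He. destruct (Hf eps He) as [d [Hd H]].
  exists d. split; auto. intros y Hy.
  replace (- f y - - f x) with (- (f y - f x)) by ring. rewrite Cmod_opp. auto.
Qed.

Lemma cont_minus f g x : cont iota f x -> cont iota g x ->
  cont iota (fun y => f y - g y) x.
Proof. intros. unfold Cminus. apply cont_plus; auto. now apply cont_opp. Qed.

Lemma cont_inv f x : f x <> RtoC 0 -> cont iota f x -> cont iota (fun y => / f y) x.
Proof.
  intros H0 Hf eps He.
  pose (a := Cmod (f x)).
  assert (Ha : (0 < a)%R) by (apply Cmod_gt_0; auto).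
  pose (e1 := Rmin (a / 2) (eps * (a * a) / 2)%R).
  assert (He1 : (0 < e1)%R).
  { apply Rmin_pos; [lra|]. apply Rdiv_lt_0_compat; [|lra].
    apply Rmult_lt_0_compat; auto. now apply Rmult_lt_0_compat. }
  destruct (Hf e1 He1) as [d [Hd H]].
  exists d. split; auto. intros y Hy. specialize (H y Hy).
  assert (K1 : (e1 <= a / 2)%R) by apply Rmin_l.
  assert (K2 : (e1 <= eps * (a * a) / 2)%R) by apply Rmin_r.
  assert (Hy0 : (a / 2 < Cmod (f y))%R).
  { assert (Q := Cmod_sub_triangle (f x) (f y)).
    rewrite Cmod_minus_sym in Q. fold a in Q. lra. }
  assert (Hny : f y <> RtoC 0).
  { intros E. rewrite E, Cmod_0 in Hy0. lra. }
  replace (/ f y - / f x) with ((f x - f y) / (f x * f y)) by (field; auto).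
  rewrite Cmod_div, Cmod_mult; [|now apply Cmult_neq_0].
  rewrite Cmod_minus_sym. fold a.
  apply Rmult_lt_reg_r with (a * Cmod (f y))%R.
  { apply Rmult_lt_0_compat; lra. }
  unfold Rdiv. rewrite Rmult_assoc, Rinv_l, Rmult_1_r.
  2:{ apply Rgt_not_eq. apply Rmult_lt_0_compat; lra. }
  eapply Rlt_le_trans; [exact H|]. eapply Rle_trans; [exact K2|].
  replace (eps * (a * a) / 2)%R with (eps * (a * (a / 2)))%R by field.
  apply Rmult_le_compat_l; [lra|]. apply Rmult_le_compat_l; lra.
Qed.

Lemma cont_div f g x : g x <> RtoC 0 -> cont iota f x -> cont iota g x ->
  cont iota (fun y => f y / g y) x.
Proof. intros. unfold Cdiv. apply cont_mult; auto. now apply cont_inv. Qed.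

Lemma cont_comp (g : C -> C) (f : T -> C) x :
  cont iota f x -> cont cid g (f x) -> cont iota (fun y => g (f y)) x.
Proof.
  intros Hf Hg eps He. destruct (Hg eps He) as [d1 [Hd1 H1]].
  destruct (Hf d1 Hd1) as [d [Hd H]]. exists d. split; auto.
  intros y Hy. apply H1. apply H; auto.
Qed.

Lemma cont_ext f g x : (forall y, f y = g y) -> cont iota f x -> cont iota g x.
Proof.
  intros E Hf eps He. destruct (Hf eps He) as [d [Hd H]].
  exists d. split; auto. intros y Hy. rewrite <- !E. auto.
Qed.

Lemma cont_ext_near f g x d : (0 < d)%R ->
  (forall y, (Cmod (iota y - iota x) < d)%R -> f y = g y) ->
  cont iota f x -> cont iota g x.
Proof.
  intros Hd0 E Hf eps He. destruct (Hf eps He) as [d1 [Hd H]].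
  exists (Rmin d d1). split; [now apply Rmin_pos|]. intros y Hy.
  rewrite <- !E.
  - apply H. eapply Rlt_le_trans; [exact Hy|apply Rmin_r].
  - replace (iota x - iota x) with (RtoC 0) by ring. rewrite Cmod_0. exact Hd0.
  - eapply Rlt_le_trans; [exact Hy|apply Rmin_l].
Qed.

Lemma der_cont f x l : der iota f x l -> cont iota f x.
Proof.
  intros [q [Hq [_ Hc]]].
  apply cont_ext with (fun y => f x + q y * (iota y - iota x)).
  { intros y. now rewrite <- Hq. }
  apply cont_plus; [apply cont_const|]. apply cont_mult; auto.
  apply cont_minus; [apply cont_iota|apply cont_const].
Qed.

Lemma der_const c x : der iota (fun _ => c) x 0.
Proof.
  exists (fun _ => RtoC 0). repeat split; [intros; ring|apply cont_const].
Qed.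

Lemma der_iota x : der iota iota x 1.
Proof.
  exists (fun _ => RtoC 1). repeat split; [intros; ring|apply cont_const].
Qed.

Lemma der_plus f g x a b : der iota f x a -> der iota g x b ->
  der iota (fun y => f y + g y) x (a + b).
Proof.
  intros [p [Hp [Ep Cp]]] [q [Hq [Eq Cq]]].
  exists (fun y => p y + q y). repeat split.
  - intros y. rewrite (Hp y), (Hq y). ring.
  - now rewrite Ep, Eq.
  - now apply cont_plus.
Qed.

Lemma der_mult f g x a b : der iota f x a -> der iota g x b ->
  der iota (fun y => f y * g y) x (a * g x + f x * b).
Proof.
  intros Df Dg. assert (Cg := der_cont _ _ _ Dg).
  destruct Df as [p [Hp [Ep Cp]]]. destruct Dg as [q [Hq [Eq Cq]]].
  exists (fun y => p y * g y + f x * q y). repeat split.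
  - intros y. rewrite (Hp y), (Hq y). ring.
  - now rewrite Ep, Eq.
  - apply cont_plus; apply cont_mult; auto. apply cont_const.
Qed.

Lemma der_eq f x a b : der iota f x a -> a = b -> der iota f x b.
Proof. now intros H <-. Qed.

Lemma der_scal c f x a : der iota f x a -> der iota (fun y => c * f y) x (c * a).
Proof.
  intros H. eapply der_eq; [apply der_mult; [apply der_const|exact H]|]. simpl. ring.
Qed.

Lemma der_opp f x a : der iota f x a -> der iota (fun y => - f y) x (- a).
Proof.
  intros [p [Hp [Ep Cp]]]. exists (fun y => - p y). repeat split.
  - intros y. rewrite (Hp y). ring.
  - now rewrite Ep.
  - now apply cont_opp.
Qed.

Lemma der_minus f g x a b : der iota f x a -> der iota g x b ->
  der iota (fun y => f y - g y) x (a - b).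
Proof. intros. unfold Cminus. apply der_plus; auto. now apply der_opp. Qed.

Lemma der_comp (g : C -> C) (f : T -> C) x a b :
  der iota f x a -> der cid g (f x) b -> der iota (fun y => g (f y)) x (b * a).
Proof.
  intros Df [q [Hq [Eq Cq]]]. assert (Cf := der_cont _ _ _ Df).
  destruct Df as [p [Hp [Ep Cp]]].
  exists (fun y => q (f y) * p y). repeat split.
  - intros y. rewrite (Hq (f y)). unfold cid. rewrite (Hp y) at 2. ring.
  - now rewrite Ep, Eq.
  - apply cont_mult; auto. now apply cont_comp.
Qed.

Lemma der_ext f g x l : (forall y, f y = g y) -> der iota f x l -> der iota g x l.
Proof.
  intros E [p [Hp [Ep Cp]]]. exists p. repeat split; auto.
  intros y. rewrite <- !E. auto.
Qed.

(** Caratheodory's factorization is required at every point, so the quotient of [f] cannot be reused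
    far from [x]. The difference quotient of [g] replaces it; injectivity of [iota] at [x] makes the
    factorization hold where the denominator is [0]. *)
Lemma der_ext_near f g x l d : (0 < d)%R ->
  (forall y, (Cmod (iota y - iota x) < d)%R -> f y = g y) ->
  (forall y, iota y = iota x -> y = x) ->
  der iota f x l -> der iota g x l.
Proof.
  intros Hd E I [p [Hp [Ep Cp]]].
  exists (fun y => match Ceq_dec (iota y) (iota x) with
            left _ => l | right _ => (g y - g x) / (iota y - iota x) end).
  repeat split.
  - intros y. destruct (Ceq_dec (iota y) (iota x)) as [e|n].
    + rewrite (I _ e). ring.
    + field. now apply Cminus_eq_contra.
  - destruct (Ceq_dec (iota x) (iota x)) as [e|n]; [reflexivity|now elim n].
  - eapply cont_ext_near; [exact Hd| |exact Cp]. intros y Hy. simpl.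
    destruct (Ceq_dec (iota y) (iota x)) as [e|n].
    + rewrite (I _ e). exact Ep.
    + rewrite <- (E y Hy), <- (E x), (Hp y).
      * field. now apply Cminus_eq_contra.
      * replace (iota x - iota x) with (RtoC 0) by ring. now rewrite Cmod_0.
Qed.

Lemma der_limit f x l : der iota f x l -> forall eps, (0 < eps)%R ->
  exists d, (0 < d)%R /\ forall y, (Cmod (iota y - iota x) < d)%R ->
    (Cmod (f y - f x - l * (iota y - iota x)) <= eps * Cmod (iota y - iota x))%R.
Proof.
  intros [p [Hp [Ep Cp]]] eps He. destruct (Cp eps He) as [d [Hd H]].
  exists d. split; auto. intros y Hy. rewrite (Hp y), <- Ep.
  replace (f x + p y * (iota y - iota x) - f x - p x * (iota y - iota x))
    with ((p y - p x) * (iota y - iota x)) by ring.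
  rewrite Cmod_mult. apply Rmult_le_compat_r; [apply Cmod_ge_0|].
  left. auto.
Qed.

Lemma der_of_limit f x l :
  (forall y, iota y = iota x -> y = x) ->
  (forall eps, (0 < eps)%R ->
  exists d, (0 < d)%R /\ forall y, (Cmod (iota y - iota x) < d)%R ->
    (Cmod (f y - f x - l * (iota y - iota x)) <= eps * Cmod (iota y - iota x))%R) ->
  der iota f x l.
Proof.
  intros I H.
  exists (fun y => match Ceq_dec (iota y) (iota x) with
            left _ => l | right _ => (f y - f x) / (iota y - iota x) end).
  assert (E0 : match Ceq_dec (iota x) (iota x) with
            left _ => l | right _ => (f x - f x) / (iota x - iota x) end = l).
  { destruct (Ceq_dec (iota x) (iota x)) as [e|n]; [reflexivity|now elim n]. }
  repeat split.
  - intros y. destruct (Ceq_dec (iota y) (iota x)) as [e|n].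
    + rewrite (I _ e). ring.
    + field. now apply Cminus_eq_contra.
  - exact E0.
  - intros eps He. destruct (H (eps / 2)%R) as [d [Hd Hy]]; [lra|].
    exists d. split; auto. intros y Hyd. rewrite E0.
    destruct (Ceq_dec (iota y) (iota x)) as [e|n].
    + replace (l - l) with (RtoC 0) by ring. now rewrite Cmod_0.
    + assert (n' : iota y - iota x <> 0) by now apply Cminus_eq_contra.
      replace ((f y - f x) / (iota y - iota x) - l) with
        ((f y - f x - l * (iota y - iota x)) / (iota y - iota x)) by now field.
      rewrite Cmod_div; auto.
      assert (P : (0 < Cmod (iota y - iota x))%R) by now apply Cmod_gt_0.
      apply Rle_lt_trans with (eps / 2)%R; [|lra].
      apply Rmult_le_reg_r with (Cmod (iota y - iota x)); auto.
      unfold Rdiv at 1. rewrite Rmult_assoc, Rinv_l, Rmult_1_r; [|lra].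
      apply Hy; auto.
Qed.

End Calculus.

Lemma der_inv_C (z : C) : z <> RtoC 0 -> der cid (fun w => / w) z (- / (z * z)).
Proof.
  intros Hz.
  assert (Dz : (0 < Cmod z)%R) by now apply Cmod_gt_0.
  (* At [w = 0] the value [/ w] is a default that need not fit the factorization, so the function is
     first redefined there by its tangent at [z]. *)
  apply (der_ext_near cid (fun w => match Ceq_dec w 0 with
     left _ => / z + (- / (z * z)) * (w - z) | right _ => / w end) _ z _ (Cmod z)); auto.
  - intros y Hy. destruct (Ceq_dec y 0) as [e|n]; auto.
    unfold cid in Hy. rewrite e in Hy. replace (0 - z) with (- z) in Hy by ring.
    rewrite Cmod_opp in Hy. lra.
  - exists (fun w => match Ceq_dec w 0 with
       left _ => - / (z * z) | right _ => - / (w * z) end). repeat split.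
    + intros y. unfold cid. destruct (Ceq_dec z 0) as [e|n]; [easy|].
      destruct (Ceq_dec y 0) as [e|n']; [reflexivity|]. field. auto.
    + destruct (Ceq_dec z 0); easy.
    + apply (cont_ext_near cid (fun w => - / (w * z)) _ z (Cmod z)); auto.
      * intros y Hy. destruct (Ceq_dec y 0) as [e|n]; auto.
        unfold cid in Hy. rewrite e in Hy. replace (0 - z) with (- z) in Hy by ring.
        rewrite Cmod_opp in Hy. lra.
      * apply cont_opp. apply cont_inv; [now apply Cmult_neq_0|].
        apply cont_mult; [apply cont_iota|apply cont_const].
Qed.

Lemma der_inv {T} (iota : T -> C) f x a : f x <> RtoC 0 -> der iota f x a ->
  der iota (fun y => / f y) x (- a / (f x * f x)).
Proof.
  intros H0 Df. eapply der_eq.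
  - apply (der_comp iota (fun w => / w) f); [exact Df|apply der_inv_C; auto].
  - field. auto.
Qed.

Lemma der_div {T} (iota : T -> C) f g x a b : g x <> RtoC 0 ->
  der iota f x a -> der iota g x b ->
  der iota (fun y => f y / g y) x ((a * g x - f x * b) / (g x * g x)).
Proof.
  intros H0 Df Dg. eapply der_eq.
  - apply der_mult; [exact Df|apply der_inv; eauto].
  - simpl. field. auto.
Qed.

(** Differentiability at the single point [z]; [holomorphic_at] demands it in a neighbourhood. *)
Definition holo (f : C -> C) (z : C) : Prop := exists l, der cid f z l.

Lemma holo_cont f z : holo f z -> cont cid f z.
Proof. intros [l H]. eapply der_cont; eauto. Qed.

Lemma cid_inj (z y : C) : cid y = cid z -> y = z.
Proof. auto. Qed.

Lemma holo_plus f g z : holo f z -> holo g z -> holo (fun w => f w + g w) z.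
Proof. intros [a Ha] [b Hb]. eexists. apply der_plus; eauto. Qed.
Lemma holo_minus f g z : holo f z -> holo g z -> holo (fun w => f w - g w) z.
Proof. intros [a Ha] [b Hb]. eexists. apply der_minus; eauto. Qed.
Lemma holo_mult f g z : holo f z -> holo g z -> holo (fun w => f w * g w) z.
Proof. intros [a Ha] [b Hb]. eexists. apply der_mult; eauto. Qed.
Lemma holo_div f g z : g z <> RtoC 0 -> holo f z -> holo g z ->
  holo (fun w => f w / g w) z.
Proof. intros H0 [a Ha] [b Hb]. eexists. apply der_div; eauto. Qed.
Lemma holo_const c z : holo (fun _ => c) z.
Proof. eexists. apply der_const. Qed.
Lemma holo_id z : holo (fun w => w) z.
Proof. eexists. apply (der_iota cid). Qed.
Lemma holo_comp f g z : holo g z -> holo f (g z) -> holo (fun w => f (g w)) z.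
Proof. intros [a Ha] [b Hb]. eexists. apply der_comp; eauto. Qed.
Lemma holo_ext f g z : (forall w, f w = g w) -> holo f z -> holo g z.
Proof. intros E [a Ha]. exists a. eapply der_ext; eauto. Qed.
Lemma holo_ext_near f g z d : (0 < d)%R ->
  (forall w, (Cmod (w - z) < d)%R -> f w = g w) -> holo f z -> holo g z.
Proof. intros Hd E [a Ha]. exists a. eapply der_ext_near; eauto. Qed.

Lemma holo_pow n z : holo (fun w => w ^ n) z.
Proof.
  induction n as [|n IH]; [exact (holo_const 1 z)|].
  apply (holo_mult (fun w => w) (fun w => w ^ n)); auto. apply holo_id.
Qed.

Lemma cont_pow {T} (iota : T -> C) f n x : cont iota f x ->
  cont iota (fun y => f y ^ n) x.
Proof.
  intros Hf. induction n as [|n IH]; [exact (cont_const iota 1 x)|].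
  now apply (cont_mult iota f (fun y => f y ^ n)).
Qed.

(** * Comparison with the filter-based notions *)

Lemma ball_C_Cmod (x y : C) (e : R) : (Cmod (y - x) < e)%R ->
  ball (M := C_UniformSpace) x e y.
Proof. intros H. apply C_NormedModule_mixin_compat1. exact H. Qed.

(** The balls of the product structure on [C] are squares, which costs a factor [sqrt 2], rounded up
    to [2]. *)
Lemma Cmod_ball_C (x y : C) (e : posreal) : ball (M := C_UniformSpace) x e y ->
  (Cmod (y - x) < 2 * e)%R.
Proof.
  intros H. assert (K := C_NormedModule_mixin_compat2 x y e H).
  eapply Rlt_trans; [exact K|]. apply Rmult_lt_compat_r; [apply cond_pos|].
  rewrite <- (sqrt_square 2) at 2; [|lra]. apply sqrt_lt_1; lra.
Qed.

Lemma cont_continuous_R (f : R -> C) t :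
  cont RtoC f t <-> continuous (T := R_UniformSpace) (U := C_UniformSpace) f t.
Proof.
  split.
  - intros H. apply filterlim_locally. intros eps.
    destruct (H eps (cond_pos eps)) as [d [Hd K]].
    exists (mkposreal d Hd). intros y Hy. apply ball_C_Cmod. apply K.
    rewrite <- RtoC_minus, Cmod_RtoC. exact Hy.
  - intros H eps He.
    assert (He2 : (0 < eps / 2)%R) by lra.
    assert (K := proj1 (filterlim_locally _ _) H (mkposreal _ He2)).
    destruct K as [d Hd]. exists d. split; [apply cond_pos|].
    intros y Hy. rewrite <- RtoC_minus, Cmod_RtoC in Hy.
    assert (Q := Cmod_ball_C _ _ _ (Hd y Hy)). simpl in Q. lra.
Qed.

Lemma norm_C_R (z : C) : norm (V := C_R_NormedModule) z = Cmod z.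
Proof.
  unfold norm; simpl. unfold prod_norm, Cmod; simpl. unfold norm; simpl.
  unfold abs; simpl. rewrite !Rmult_1_r, <- !Rabs_mult.
  rewrite !Rabs_pos_eq; auto; apply Rle_0_sqr.
Qed.

Lemma der_is_derive_R (f : R -> C) t l : der RtoC f t l ->
  is_derive (K := R_AbsRing) (V := C_R_NormedModule) f t l.
Proof.
  intros H. split; [apply is_linear_scal_l|].
  intros x Hx. assert (E : t = x).
  { apply (is_filter_lim_locally_unique (V := R_NormedModule) t x Hx). }
  subst x. intros eps.
  destruct (der_limit _ _ _ _ H eps (cond_pos eps)) as [d [Hd K]].
  exists (mkposreal d Hd). intros y Hy.
  rewrite norm_C_R. change (minus (minus (f y) (f t)) (scal (minus y t) l))
    with (f y - f t - scal (V := C_R_ModuleSpace) (y - t)%R l).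
  rewrite scal_R_Cmult.
  specialize (K y). rewrite <- RtoC_minus, Cmod_RtoC in K.
  rewrite (Cmult_comm _ l). apply K. exact Hy.
Qed.

Lemma der_is_derive_C (f : C -> C) z l : der cid f z l <->
  is_derive (K := C_AbsRing) (V := C_NormedModule) f z l.
Proof.
  split.
  - intros H. split; [apply is_linear_scal_l|].
    intros x Hx. assert (E : z = x).
    { apply (is_filter_lim_locally_unique (V := AbsRing_NormedModule C_AbsRing) z x Hx). }
    subst x. intros eps.
    destruct (der_limit _ _ _ _ H eps (cond_pos eps)) as [d [Hd K]].
    exists (mkposreal d Hd). intros y Hy.
    change (Cmod (f y - f z - (y - z) * l) <= eps * Cmod (y - z))%R.
    rewrite (Cmult_comm (y - z) l). apply K. exact Hy.
  - intros [_ H]. apply der_of_limit; [apply cid_inj|].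
    intros eps He. specialize (H z (fun P HP => HP) (mkposreal eps He)).
    destruct H as [d Hd]. exists d. split; [apply cond_pos|].
    intros y Hy. specialize (Hd y Hy).
    change (Cmod (f y - f z - (y - z) * l) <= eps * Cmod (y - z))%R in Hd.
    unfold cid. rewrite (Cmult_comm l). exact Hd.
Qed.

Lemma locally_C_Cmod (P : C -> Prop) (z : C) :
  locally (T := C_UniformSpace) z P <->
  exists d, (0 < d)%R /\ forall w, (Cmod (w - z) < d)%R -> P w.
Proof.
  split.
  - intros [d Hd]. exists d. split; [apply cond_pos|].
    intros w Hw. apply Hd. now apply ball_C_Cmod.
  - intros [d [Hd H]]. assert (Hd2 : (0 < d / 2)%R) by lra.
    exists (mkposreal _ Hd2). intros w Hw. apply H.
    assert (Q := Cmod_ball_C _ _ _ Hw). simpl in Q. lra.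
Qed.

Lemma holomorphic_at_holo (f : C -> C) z : holomorphic_at f z ->
  exists d, (0 < d)%R /\ forall w, (Cmod (w - z) < d)%R -> holo f w.
Proof.
  intros H. apply locally_C_Cmod in H. destruct H as [d [Hd H]].
  exists d. split; auto. intros w Hw. destruct (H w Hw) as [l Hl].
  exists l. now apply der_is_derive_C.
Qed.

(** * Integrals over real intervals and the complex exponential *)

Definition CI (f : R -> C) (a b : R) : C :=
  RInt (V := C_R_CompleteNormedModule) f a b.

Definition cont_on (f : R -> C) (a b : R) : Prop :=
  forall t, (a <= t <= b)%R -> cont RtoC f t.

Lemma cont_on_sub f a b c d : (a <= c)%R -> (d <= b)%R -> cont_on f a b -> cont_on f c d.
Proof. intros H1 H2 H t Ht. apply H. lra. Qed.

Lemma CI_is f a b : (a <= b)%R -> cont_on f a b ->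
  is_RInt (V := C_R_NormedModule) f a b (CI f a b).
Proof.
  intros Hab Hf. apply (RInt_correct (V := C_R_CompleteNormedModule)).
  apply (ex_RInt_continuous (V := C_R_CompleteNormedModule)).
  intros t Ht. rewrite Rmin_left, Rmax_right in Ht; auto.
  apply cont_continuous_R. auto.
Qed.

Lemma CI_unique f a b l : is_RInt (V := C_R_NormedModule) f a b l -> CI f a b = l.
Proof. apply (is_RInt_unique (V := C_R_CompleteNormedModule)). Qed.

Lemma CI_ext f g a b : (a <= b)%R -> (forall t, (a <= t <= b)%R -> f t = g t) ->
  CI f a b = CI g a b.
Proof.
  intros Hab H. apply (RInt_ext (V := C_R_CompleteNormedModule)).
  intros t Ht. rewrite Rmin_left, Rmax_right in Ht; auto. apply H. lra.
Qed.

Lemma CI_plus f g a b : (a <= b)%R -> cont_on f a b -> cont_on g a b ->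
  CI (fun t => f t + g t) a b = CI f a b + CI g a b.
Proof.
  intros Hab Hf Hg. apply CI_unique.
  apply (is_RInt_plus (V := C_R_NormedModule)); now apply CI_is.
Qed.

Lemma CI_minus f g a b : (a <= b)%R -> cont_on f a b -> cont_on g a b ->
  CI (fun t => f t - g t) a b = CI f a b - CI g a b.
Proof.
  intros Hab Hf Hg. apply CI_unique.
  apply (is_RInt_minus (V := C_R_NormedModule)); now apply CI_is.
Qed.

(** [C] is integrated as a normed module over the reals, so a complex scalar has to be handled
    through real and imaginary parts. *)
Lemma CI_scal c f a b : (a <= b)%R -> cont_on f a b ->
  CI (fun t => c * f t) a b = c * CI f a b.
Proof.
  intros Hab Hf. apply CI_unique.
  assert (H := CI_is _ _ _ Hab Hf).
  assert (H1 := is_RInt_fct_extend_fst (U := R_NormedModule) (V := R_NormedModule)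
    _ _ _ _ H).
  assert (H2 := is_RInt_fct_extend_snd (U := R_NormedModule) (V := R_NormedModule)
    _ _ _ _ H).
  apply (is_RInt_fct_extend_pair (U := R_NormedModule) (V := R_NormedModule)).
  - apply (is_RInt_minus (V := R_NormedModule));
      apply (is_RInt_scal (V := R_NormedModule)); assumption.
  - apply (is_RInt_plus (V := R_NormedModule));
      apply (is_RInt_scal (V := R_NormedModule)); assumption.
Qed.

Lemma CI_const c a b : CI (fun _ => c) a b = RtoC (b - a) * c.
Proof.
  apply CI_unique. rewrite <- scal_R_Cmult. apply (is_RInt_const (V := C_R_NormedModule)).
Qed.

Lemma CI_Chasles f a b c : (a <= b)%R -> (b <= c)%R -> cont_on f a c ->
  CI f a c = CI f a b + CI f b c.
Proof.
  intros Hab Hbc Hf. apply CI_unique.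
  apply (is_RInt_Chasles (V := C_R_NormedModule)) with b; apply CI_is; auto;
    eapply cont_on_sub; try exact Hf; lra.
Qed.

Lemma CI_bound f a b M : (a <= b)%R -> cont_on f a b ->
  (forall t, (a <= t <= b)%R -> (Cmod (f t) <= M)%R) ->
  (Cmod (CI f a b) <= (b - a) * M)%R.
Proof.
  intros Hab Hf HM. rewrite <- norm_C_R.
  apply (norm_RInt_le_const (V := C_R_NormedModule) f); auto.
  - intros t Ht. rewrite norm_C_R. auto.
  - now apply CI_is.
Qed.

Lemma CI_bound_prim f (g G : R -> R) a b : (a <= b)%R -> cont_on f a b ->
  (forall t, (a <= t <= b)%R -> (Cmod (f t) <= g t)%R) ->
  (forall t, (a <= t <= b)%R -> is_derive G t (g t)) ->
  (forall t, (a <= t <= b)%R -> continuous g t) ->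
  (Cmod (CI f a b) <= G b - G a)%R.
Proof.
  intros Hab Hf HM HG Hg. rewrite <- norm_C_R.
  apply (norm_RInt_le (V := C_R_NormedModule) f g a b); auto.
  - intros t Ht. rewrite norm_C_R. auto.
  - now apply CI_is.
  - apply (is_RInt_derive (V := R_CompleteNormedModule));
      rewrite Rmin_left, Rmax_right; auto.
Qed.

Lemma CI_FTC F f a b : (a <= b)%R ->
  (forall t, (a <= t <= b)%R -> der RtoC F t (f t)) -> cont_on f a b ->
  CI f a b = F b - F a.
Proof.
  intros Hab HF Hf. apply CI_unique.
  apply (is_RInt_derive (V := C_R_CompleteNormedModule));
    rewrite Rmin_left, Rmax_right; auto; intros t Ht.
  - apply der_is_derive_R. auto.
  - apply cont_continuous_R. auto.
Qed.

Lemma CI_shift f a b c : (a <= b)%R -> cont_on f (a + c) (b + c) ->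
  CI (fun t => f (t + c)%R) a b = CI f (a + c) (b + c).
Proof.
  intros Hab Hf. apply CI_unique.
  assert (H : is_RInt (V := C_R_NormedModule) f (1 * a + c) (1 * b + c) (CI f (a + c) (b + c))).
  { rewrite !Rmult_1_l. apply CI_is; auto. lra. }
  apply is_RInt_comp_lin in H. revert H. apply is_RInt_ext.
  intros t _. rewrite Rmult_1_l. apply (scal_one (f (t + c)%R : C_R_ModuleSpace)).
Qed.

Lemma cont_pair (u v : R -> R) t : continuous u t -> continuous v t ->
  cont RtoC (fun x => (u x, v x)) t.
Proof.
  intros Hu Hv. apply cont_continuous_R.
  apply filterlim_locally. intros eps.
  assert (K1 := proj1 (filterlim_locally _ _) Hu eps).
  assert (K2 := proj1 (filterlim_locally _ _) Hv eps).
  apply filter_imp with (2 := filter_and _ _ K1 K2). intros x [A B]. now split.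
Qed.

Lemma Cmod_Ci : Cmod Ci = 1%R.
Proof.
  unfold Cmod, Ci; simpl.
  replace (0 * (0 * 1) + 1 * (1 * 1))%R with 1%R by ring. apply sqrt_1.
Qed.

Lemma der_pair (u v : R -> R) t a b : is_derive u t a -> is_derive v t b ->
  der RtoC (fun x => (u x, v x)) t (a, b).
Proof.
  intros Hu Hv. apply der_of_limit.
  { intros y E. now apply RtoC_inj. }
  intros eps He. assert (He2 : (0 < eps / 2)%R) by lra.
  destruct Hu as [_ Hu]. destruct Hv as [_ Hv].
  specialize (Hu t (fun P HP => HP) (mkposreal _ He2)).
  specialize (Hv t (fun P HP => HP) (mkposreal _ He2)).
  destruct (filter_and _ _ Hu Hv) as [d Hd].
  exists d. split; [apply cond_pos|]. intros y Hy.
  rewrite <- RtoC_minus, Cmod_RtoC in *.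
  specialize (Hd y Hy). destruct Hd as [H1 H2]. simpl in H1, H2.
  change (Rabs (u y - u t - (y - t) * a) <= eps / 2 * Rabs (y - t))%R in H1.
  change (Rabs (v y - v t - (y - t) * b) <= eps / 2 * Rabs (y - t))%R in H2.
  set (p := (u y - u t - (y - t) * a)%R) in *.
  set (q := (v y - v t - (y - t) * b)%R) in *.
  replace ((u y, v y) - (u t, v t) - (a, b) * RtoC (y - t)) with (RtoC p + Ci * RtoC q).
  2:{ apply injective_projections; simpl; unfold p, q; ring. }
  eapply Rle_trans; [apply Cmod_triangle|]. rewrite Cmod_mult, !Cmod_RtoC, Cmod_Ci.
  lra.
Qed.

(** * The complex exponential *)

Lemma Cexp_plus z w : Cexp (z + w) = Cexp z * Cexp w.
Proof.
  unfold Cexp. rewrite re_plus, im_plus, exp_plus, cos_plus, sin_plus.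
  apply injective_projections; simpl; ring.
Qed.

Lemma Cexp_RtoC x : Cexp (RtoC x) = RtoC (exp x).
Proof.
  unfold Cexp. simpl. rewrite cos_0, sin_0.
  apply injective_projections; simpl; ring.
Qed.

Lemma Cexp_0 : Cexp 0 = 1.
Proof. rewrite Cexp_RtoC, exp_0. reflexivity. Qed.

Lemma Cexp_Ci x : Cexp (Ci * RtoC x) = (cos x, sin x).
Proof.
  unfold Cexp. replace (Re (Ci * RtoC x)) with 0%R by (simpl; ring).
  replace (Im (Ci * RtoC x)) with x by (simpl; ring).
  rewrite exp_0. apply injective_projections; simpl; ring.
Qed.

Lemma Cmod_cos_sin x : Cmod (cos x, sin x) = 1%R.
Proof.
  unfold Cmod; simpl. rewrite !Rmult_1_r, Rplus_comm.
  change (sqrt (Rsqr (sin x) + Rsqr (cos x)) = 1%R). now rewrite sin2_cos2, sqrt_1.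
Qed.

Lemma Cmod_Cexp z : Cmod (Cexp z) = exp (Re z).
Proof.
  unfold Cexp. rewrite Cmod_mult, Cmod_cos_sin, Cmod_RtoC, Rabs_pos_eq; [ring|].
  left. apply exp_pos.
Qed.

Lemma Cexp_neq_0 z : Cexp z <> 0.
Proof. apply Cmod_gt_0. rewrite Cmod_Cexp. apply exp_pos. Qed.

Lemma Cexp_opp z : Cexp (- z) = / Cexp z.
Proof.
  assert (H := Cexp_neq_0 z).
  replace (Cexp (- z)) with (Cexp (- z) * Cexp z * / Cexp z) by (field; auto).
  rewrite <- Cexp_plus. replace (- z + z) with (RtoC 0) by ring. rewrite Cexp_0. ring.
Qed.

Lemma Cexp_minus z w : Cexp (z - w) = Cexp z / Cexp w.
Proof. unfold Cminus, Cdiv. now rewrite Cexp_plus, Cexp_opp. Qed.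

Lemma Cexp_nat_mult n z : Cexp (RtoC (INR n) * z) = Cexp z ^ n.
Proof.
  induction n as [|n IH].
  - simpl. replace (RtoC 0 * z) with (RtoC 0) by ring. apply Cexp_0.
  - rewrite S_INR, RtoC_plus, Cmult_plus_distr_r, Cexp_plus, IH, Cpow_S, Cmult_1_l. ring.
Qed.

Lemma Cexp_conj z : Cexp (Cconj z) = Cconj (Cexp z).
Proof.
  unfold Cexp. rewrite re_conj, im_conj, cos_neg, sin_neg.
  apply injective_projections; simpl; ring.
Qed.

(** Integrated over [[0, 1]], this derivative in a real variable yields the two Taylor bounds below,
    and they in turn yield the complex derivative of [Cexp]. *)
Lemma der_Cexp_line (h : C) t :
  der RtoC (fun t => Cexp (RtoC t * h)) t (h * Cexp (RtoC t * h)).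
Proof.
  apply der_ext with (fun t => (exp (t * Re h) * cos (t * Im h), exp (t * Re h) * sin (t * Im h)))%R.
  { intros y. unfold Cexp. rewrite re_scal_l, im_scal_l.
    apply injective_projections; simpl; ring. }
  replace (h * Cexp (RtoC t * h)) with
    ((Re h * (exp (t * Re h) * cos (t * Im h)) - Im h * (exp (t * Re h) * sin (t * Im h)))%R,
     (Re h * (exp (t * Re h) * sin (t * Im h)) + Im h * (exp (t * Re h) * cos (t * Im h)))%R).
  - apply der_pair; auto_derive; auto; ring.
  - unfold Cexp. rewrite re_scal_l, im_scal_l.
    destruct h; apply injective_projections; simpl; ring.
Qed.

Lemma Re_le_Cmod z : (Re z <= Cmod z)%R.
Proof. eapply Rle_trans; [apply Rle_abs|apply re_le_Cmod]. Qed.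

Lemma exp_line_le h t : (0 <= t <= 1)%R -> (Cmod (Cexp (RtoC t * h)) <= exp (Cmod h))%R.
Proof.
  intros Ht. rewrite Cmod_Cexp, re_scal_l.
  assert (H := Re_le_Cmod h). assert (P := Cmod_ge_0 h).
  assert (K : (t * Re h <= Cmod h)%R) by nra.
  destruct K as [K|K]; [left; now apply exp_increasing|right; now rewrite K].
Qed.

Lemma Cexp_minus_1_bound h : (Cmod (Cexp h - 1) <= Cmod h * exp (Cmod h))%R.
Proof.
  assert (Hc : cont_on (fun t => h * Cexp (RtoC t * h)) 0 1).
  { intros t _. apply cont_mult; [apply cont_const|].
    eapply der_cont. apply der_Cexp_line. }
  assert (E := CI_FTC (fun t => Cexp (RtoC t * h)) _ 0 1 Rle_0_1
    (fun t _ => der_Cexp_line h t) Hc).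
  simpl in E. rewrite Cmult_1_l, Cmult_0_l, Cexp_0 in E. rewrite <- E.
  eapply Rle_trans; [apply (CI_bound _ 0 1 (Cmod h * exp (Cmod h))); auto; try lra|lra].
  intros t Ht. rewrite Cmod_mult. apply Rmult_le_compat_l; [apply Cmod_ge_0|].
  now apply exp_line_le.
Qed.

Lemma Cexp_taylor1_bound h : (Cmod (Cexp h - 1 - h) <= Cmod h * Cmod h * exp (Cmod h))%R.
Proof.
  assert (Hd : forall t, der RtoC (fun t => Cexp (RtoC t * h) - RtoC t * h) t
    (h * (Cexp (RtoC t * h) - 1))).
  { intros t. eapply der_eq.
    - apply der_minus; [apply der_Cexp_line|].
      apply der_mult; [apply der_iota|apply der_const].
    - simpl. ring. }
  assert (Hc : cont_on (fun t => h * (Cexp (RtoC t * h) - 1)) 0 1).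
  { intros t _. apply cont_mult; [apply cont_const|].
    apply cont_minus; [|apply cont_const]. eapply der_cont. apply der_Cexp_line. }
  assert (E := CI_FTC _ _ 0 1 Rle_0_1 (fun t _ => Hd t) Hc).
  simpl in E. rewrite Cmult_1_l, Cmult_0_l, Cexp_0 in E.
  replace (Cexp h - 1 - h) with (Cexp h - h - (1 - 0)) by ring. rewrite <- E.
  eapply Rle_trans; [apply (CI_bound _ 0 1 (Cmod h * Cmod h * exp (Cmod h))); auto; try lra|lra].
  intros t Ht. rewrite Cmod_mult, Rmult_assoc. apply Rmult_le_compat_l; [apply Cmod_ge_0|].
  eapply Rle_trans; [apply Cexp_minus_1_bound|].
  rewrite Cmod_mult, Cmod_RtoC, (Rabs_pos_eq t); [|lra].
  assert (P := Cmod_ge_0 h).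
  apply Rmult_le_compat; [nra|left; apply exp_pos|nra|].
  destruct (Rle_lt_or_eq_dec (t * Cmod h) (Cmod h)) as [K|K]; [nra| |].
  - left; now apply exp_increasing.
  - right; now rewrite K.
Qed.

Lemma der_Cexp z : der cid Cexp z (Cexp z).
Proof.
  apply der_of_limit; [apply cid_inj|]. intros eps He. unfold cid.
  pose (M := (Cmod (Cexp z) * exp 1)%R).
  assert (HM : (0 < M)%R).
  { apply Rmult_lt_0_compat; [apply Cmod_gt_0, Cexp_neq_0|apply exp_pos]. }
  exists (Rmin 1 (eps / M)). split.
  { apply Rmin_pos; [lra|now apply Rdiv_lt_0_compat]. }
  intros y Hy. set (h := y - z) in *.
  assert (H1 : (Cmod h < 1)%R) by (eapply Rlt_le_trans; [exact Hy|apply Rmin_l]).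
  assert (H2 : (Cmod h < eps / M)%R) by (eapply Rlt_le_trans; [exact Hy|apply Rmin_r]).
  replace y with (z + h) by (unfold h; ring). rewrite Cexp_plus.
  replace (Cexp z * Cexp h - Cexp z - Cexp z * h) with (Cexp z * (Cexp h - 1 - h)) by ring.
  rewrite Cmod_mult.
  apply Rle_trans with (Cmod (Cexp z) * (Cmod h * Cmod h * exp 1))%R.
  - apply Rmult_le_compat_l; [apply Cmod_ge_0|].
    eapply Rle_trans; [apply Cexp_taylor1_bound|].
    apply Rmult_le_compat_l; [assert (P := Cmod_ge_0 h); nra|].
    left. now apply exp_increasing.
  - replace (Cmod (Cexp z) * (Cmod h * Cmod h * exp 1))%R with (M * Cmod h * Cmod h)%R
      by (unfold M; ring).
    apply Rmult_le_compat_r; [apply Cmod_ge_0|].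
    apply Rle_trans with (M * (eps / M))%R; [apply Rmult_le_compat_l; lra|].
    right. field. lra.
Qed.

Lemma holo_Cexp z : holo Cexp z.
Proof. eexists; apply der_Cexp. Qed.

Lemma der_Cexp_comp {T} (iota : T -> C) f x a : der iota f x a ->
  der iota (fun y => Cexp (f y)) x (Cexp (f x) * a).
Proof. intros H. apply (der_comp iota Cexp f); [exact H|apply der_Cexp]. Qed.

Lemma cont_Cexp {T} (iota : T -> C) f x : cont iota f x ->
  cont iota (fun y => Cexp (f y)) x.
Proof. intros H. apply (cont_comp iota Cexp f); [exact H|apply holo_cont, holo_Cexp]. Qed.

(** * Goursat's theorem and residues on rectangles *)

Definition in_box (x0 x1 y0 y1 : R) (z : C) : Prop :=
  (x0 <= Re z <= x1)%R /\ (y0 <= Im z <= y1)%R.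

(** The contour integral over the border, counterclockwise: [dz] is [dx] on horizontal sides and
    [Ci dy] on vertical ones. *)
Definition rect (F : C -> C) (x0 x1 y0 y1 : R) : C :=
  CI (fun x => F (x, y0)) x0 x1 - CI (fun x => F (x, y1)) x0 x1 +
  Ci * (CI (fun y => F (x1, y)) y0 y1 - CI (fun y => F (x0, y)) y0 y1).

Lemma der_horizontal y x : der RtoC (fun x => (x, y) : C) x 1.
Proof.
  apply der_ext with (fun x => RtoC x + (0%R, y)).
  { intros t. apply injective_projections; simpl; ring. }
  eapply der_eq; [apply der_plus; [apply der_iota|apply der_const]|]. ring.
Qed.

Lemma der_vertical x y : der RtoC (fun y => (x, y) : C) y Ci.
Proof.
  apply der_ext with (fun y => Ci * RtoC y + RtoC x).
  { intros t. apply injective_projections; simpl; ring. }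
  eapply der_eq; [apply der_plus; [apply der_scal, der_iota|apply der_const]|]. ring.
Qed.

Lemma cont_horizontal F x y : cont cid F (x, y) -> cont RtoC (fun x => F (x, y)) x.
Proof.
  intros H. apply (cont_comp RtoC F (fun x => (x, y) : C)); auto.
  eapply der_cont, der_horizontal.
Qed.

Lemma cont_vertical F x y : cont cid F (x, y) -> cont RtoC (fun y => F (x, y)) y.
Proof.
  intros H. apply (cont_comp RtoC F (fun y => (x, y) : C)); auto.
  eapply der_cont, der_vertical.
Qed.

Definition on_border (x0 x1 y0 y1 : R) (z : C) : Prop :=
  in_box x0 x1 y0 y1 z /\ (Re z = x0 \/ Re z = x1 \/ Im z = y0 \/ Im z = y1).

Section Rect.
Variables (F : C -> C) (x0 x1 y0 y1 : R).
Hypothesis Hx : (x0 <= x1)%R.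
Hypothesis Hy : (y0 <= y1)%R.
Hypothesis HF : forall z, on_border x0 x1 y0 y1 z -> cont cid F z.

Lemma border_bot : cont_on (fun x => F (x, y0)) x0 x1.
Proof. intros t Ht. apply cont_horizontal, HF. split; [split|]; simpl; lra. Qed.
Lemma border_top : cont_on (fun x => F (x, y1)) x0 x1.
Proof. intros t Ht. apply cont_horizontal, HF. split; [split|]; simpl; lra. Qed.
Lemma border_left : cont_on (fun y => F (x0, y)) y0 y1.
Proof. intros t Ht. apply cont_vertical, HF. split; [split|]; simpl; lra. Qed.
Lemma border_right : cont_on (fun y => F (x1, y)) y0 y1.
Proof. intros t Ht. apply cont_vertical, HF. split; [split|]; simpl; lra. Qed.

Lemma rect_vsplit x : (x0 <= x <= x1)%R ->
  rect F x0 x1 y0 y1 = rect F x0 x y0 y1 + rect F x x1 y0 y1.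
Proof.
  intros H. unfold rect.
  rewrite (CI_Chasles (fun t => F (t, y0)) x0 x x1), (CI_Chasles (fun t => F (t, y1)) x0 x x1);
    try lra; [ring|apply border_top|apply border_bot].
Qed.

Lemma rect_hsplit y : (y0 <= y <= y1)%R ->
  rect F x0 x1 y0 y1 = rect F x0 x1 y0 y + rect F x0 x1 y y1.
Proof.
  intros H. unfold rect.
  rewrite (CI_Chasles (fun t => F (x0, t)) y0 y y1), (CI_Chasles (fun t => F (x1, t)) y0 y y1);
    try lra; [ring|apply border_right|apply border_left].
Qed.

Lemma rect_bound M : (forall z, on_border x0 x1 y0 y1 z -> (Cmod (F z) <= M)%R) ->
  (Cmod (rect F x0 x1 y0 y1) <= 2 * M * ((x1 - x0) + (y1 - y0)))%R.
Proof.
  intros HM. unfold rect.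
  assert (B1 := CI_bound _ _ _ M Hx border_bot).
  assert (B2 := CI_bound _ _ _ M Hx border_top).
  assert (B3 := CI_bound _ _ _ M Hy border_left).
  assert (B4 := CI_bound _ _ _ M Hy border_right).
  eapply Rle_trans; [apply Cmod_triangle|]. rewrite Cmod_mult, Cmod_Ci.
  assert (T1 := Cmod_minus_triangle (CI (fun x => F (x, y0)) x0 x1) (CI (fun x => F (x, y1)) x0 x1)).
  assert (T2 := Cmod_minus_triangle (CI (fun y => F (x1, y)) y0 y1) (CI (fun y => F (x0, y)) y0 y1)).
  assert (Cmod (CI (fun x => F (x, y0)) x0 x1) <= (x1 - x0) * M)%R.
  { apply B1. intros t Ht. apply HM. split; [split|]; simpl; lra. }
  assert (Cmod (CI (fun x => F (x, y1)) x0 x1) <= (x1 - x0) * M)%R.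
  { apply B2. intros t Ht. apply HM. split; [split|]; simpl; lra. }
  assert (Cmod (CI (fun x => F (x0, x)) y0 y1) <= (y1 - y0) * M)%R.
  { apply B3. intros t Ht. apply HM. split; [split|]; simpl; lra. }
  assert (Cmod (CI (fun x => F (x1, x)) y0 y1) <= (y1 - y0) * M)%R.
  { apply B4. intros t Ht. apply HM. split; [split|]; simpl; lra. }
  lra.
Qed.

Lemma rect_minus G : (forall z, on_border x0 x1 y0 y1 z -> cont cid G z) ->
  rect (fun z => F z - G z) x0 x1 y0 y1 = rect F x0 x1 y0 y1 - rect G x0 x1 y0 y1.
Proof.
  intros HG. unfold rect.
  rewrite !CI_minus; auto; try apply border_bot; try apply border_top;
    try apply border_left; try apply border_right; try ring;
  intros t Ht; (apply (cont_horizontal G) || apply (cont_vertical G));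
    apply HG; split; try split; simpl; lra.
Qed.

Lemma rect_primitive G : (forall z, on_border x0 x1 y0 y1 z -> der cid G z (F z)) ->
  rect F x0 x1 y0 y1 = 0.
Proof.
  intros HG. unfold rect.
  assert (Hh : forall y t, on_border x0 x1 y0 y1 (t, y) ->
    der RtoC (fun x => G (x, y)) t (F (t, y))).
  { intros y t H. eapply der_eq.
    - apply (der_comp RtoC G (fun x => (x, y) : C)); [apply der_horizontal|apply HG, H].
    - ring. }
  assert (Hv : forall x t, on_border x0 x1 y0 y1 (x, t) ->
    der RtoC (fun y => G (x, y)) t (Ci * F (x, t))).
  { intros x t H. eapply der_eq.
    - apply (der_comp RtoC G (fun y => (x, y) : C)); [apply der_vertical|apply HG, H].
    - ring. }
  assert (E : forall a b : C, Ci * (a - b) = Ci * a - Ci * b) by (intros; ring). rewrite E.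
  rewrite <- !CI_scal; auto using border_left, border_right.
  rewrite (CI_FTC (fun x => G (x, y0))), (CI_FTC (fun x => G (x, y1))),
    (CI_FTC (fun y => G (x1, y))), (CI_FTC (fun y => G (x0, y))); auto.
  - ring.
  - intros t Ht. apply Hv. split; [split|]; simpl; lra.
  - intros t Ht. apply cont_mult; [apply cont_const|]. now apply border_left.
  - intros t Ht. apply Hv. split; [split|]; simpl; lra.
  - intros t Ht. apply cont_mult; [apply cont_const|]. now apply border_right.
  - intros t Ht. apply Hh. split; [split|]; simpl; lra.
  - apply border_top.
  - intros t Ht. apply Hh. split; [split|]; simpl; lra.
  - apply border_bot.
Qed.

End Rect.

(** * Additive functions of rectangles *)

Lemma nested_intervals (a b : nat -> R) :
  (forall n, (a n <= a (S n))%R) -> (forall n, (b (S n) <= b n)%R) ->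
  (forall n, (a n <= b n)%R) -> exists p, forall n, (a n <= p <= b n)%R.
Proof.
  intros Ha Hb Hab.
  assert (Ma : forall n m, (n <= m)%nat -> (a n <= a m)%R).
  { intros n m H. induction H; [lra|]. specialize (Ha m). lra. }
  assert (Mb : forall n m, (n <= m)%nat -> (b m <= b n)%R).
  { intros n m H. induction H; [lra|]. specialize (Hb m). lra. }
  assert (Mab : forall n m, (a n <= b m)%R).
  { intros n m. specialize (Ma n (Nat.max n m) (Nat.le_max_l _ _)).
    specialize (Mb m (Nat.max n m) (Nat.le_max_r _ _)).
    specialize (Hab (Nat.max n m)). lra. }
  destruct (completeness (fun x => exists n, x = a n)) as [p [Hu Hl]].
  - exists (b O). intros x [n ->]. apply Mab.
  - exists (a O). now exists O.
  - exists p. intros n. split.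
    + apply Hu. now exists n.
    + apply Hl. intros x [m ->]. apply Mab.
Qed.

Section Bisection.
Variable Phi : R -> R -> R -> R -> C.
Variables X0 X1 Y0 Y1 : R.
Hypothesis HX : (X0 <= X1)%R.
Hypothesis HY : (Y0 <= Y1)%R.

Definition subrect (x0 x1 y0 y1 : R) : Prop :=
  (X0 <= x0)%R /\ (x0 <= x1)%R /\ (x1 <= X1)%R /\ (Y0 <= y0)%R /\ (y0 <= y1)%R /\ (y1 <= Y1)%R.

Hypothesis Hv : forall x0 x1 y0 y1 x, subrect x0 x1 y0 y1 -> (x0 <= x <= x1)%R ->
  Phi x0 x1 y0 y1 = Phi x0 x y0 y1 + Phi x x1 y0 y1.
Hypothesis Hh : forall x0 x1 y0 y1 y, subrect x0 x1 y0 y1 -> (y0 <= y <= y1)%R ->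
  Phi x0 x1 y0 y1 = Phi x0 x1 y0 y + Phi x0 x1 y y1.
Hypothesis Hloc : forall u v eps, (X0 <= u <= X1)%R -> (Y0 <= v <= Y1)%R -> (0 < eps)%R ->
  exists d, (0 < d)%R /\ forall x0 x1 y0 y1, subrect x0 x1 y0 y1 ->
    (x0 <= u <= x1)%R -> (y0 <= v <= y1)%R -> (x1 - x0 < d)%R -> (y1 - y0 < d)%R ->
    (Cmod (Phi x0 x1 y0 y1) <= eps * (x1 - x0 + (y1 - y0)) ^ 2)%R.

Let quad : Type := ((R * R) * (R * R))%type.
Let good (eps : R) (q : quad) : Prop :=
  let '((a, b), (c, d)) := q in (Cmod (Phi a b c d) <= eps * (b - a + (d - c)) ^ 2)%R.
Let good_dec eps q : {good eps q} + {~ good eps q}.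
Proof. destruct q as [[a b] [c d]]. apply Rle_dec. Defined.

Let next (eps : R) (q : quad) : quad :=
  let '((a, b), (c, d)) := q in
  let m := ((a + b) / 2)%R in let k := ((c + d) / 2)%R in
  if good_dec eps ((a, m), (c, k)) then
  if good_dec eps ((m, b), (c, k)) then
  if good_dec eps ((a, m), (k, d)) then ((m, b), (k, d))
  else ((a, m), (k, d)) else ((m, b), (c, k)) else ((a, m), (c, k)).

Let sub (q : quad) : Prop := let '((a, b), (c, d)) := q in subrect a b c d.

(** A quarter has half the side lengths, hence a quarter of the squared size. If all four quarters
    were good, additivity would make the whole good; so the fourth quarter, which [next] takes
    without a test, is bad when the other three are good. *)
Lemma bisection_next eps q : sub q -> ~ good eps q ->
  sub (next eps q) /\ ~ good eps (next eps q) /\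
  (fst (fst q) <= fst (fst (next eps q)))%R /\ (snd (fst (next eps q)) <= snd (fst q))%R /\
  (fst (snd q) <= fst (snd (next eps q)))%R /\ (snd (snd (next eps q)) <= snd (snd q))%R /\
  (snd (fst (next eps q)) - fst (fst (next eps q)) = (snd (fst q) - fst (fst q)) / 2)%R /\
  (snd (snd (next eps q)) - fst (snd (next eps q)) = (snd (snd q) - fst (snd q)) / 2)%R.
Proof.
  destruct q as [[a b] [c d]]. intros Hs Hg. simpl in Hs.
  unfold next. pose (m := ((a + b) / 2)%R). pose (k := ((c + d) / 2)%R).
  fold m k. unfold sub, subrect in *.
  assert (Hm : (m - a = (b - a) / 2 /\ b - m = (b - a) / 2)%R) by (unfold m; lra).
  assert (Hk : (k - c = (d - c) / 2 /\ d - k = (d - c) / 2)%R) by (unfold k; lra).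
  destruct (good_dec eps ((a, m), (c, k))) as [g1|g1].
  2:{ split; [|split; [exact g1|]]; simpl; repeat split; lra. }
  destruct (good_dec eps ((m, b), (c, k))) as [g2|g2].
  2:{ split; [|split; [exact g2|]]; simpl; repeat split; lra. }
  destruct (good_dec eps ((a, m), (k, d))) as [g3|g3].
  2:{ split; [|split; [exact g3|]]; simpl; repeat split; lra. }
  assert (g4 : ~ good eps ((m, b), (k, d))).
  { intros g4. apply Hg. unfold good in *.
    rewrite (Hv a b c d m), (Hh a m c d k), (Hh m b c d k); unfold subrect; try lra.
    eapply Rle_trans; [apply Cmod_triangle|].
    assert (T1 := Cmod_triangle (Phi a m c k) (Phi a m k d)).
    assert (T2 := Cmod_triangle (Phi m b c k) (Phi m b k d)).
    destruct Hm as [Hm1 Hm2]. destruct Hk as [Hk1 Hk2].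
    rewrite Hm1, Hk1 in g1. rewrite Hm2, Hk1 in g2.
    rewrite Hm1, Hk2 in g3. rewrite Hm2, Hk2 in g4.
    replace (eps * (b - a + (d - c)) ^ 2)%R with
      (4 * (eps * ((b - a) / 2 + (d - c) / 2) ^ 2))%R by field.
    lra. }
  split; [|split; [exact g4|]]; simpl; repeat split; lra.
Qed.

Lemma additive_bound eps : (0 < eps)%R ->
  (Cmod (Phi X0 X1 Y0 Y1) <= eps * (X1 - X0 + (Y1 - Y0)) ^ 2)%R.
Proof.
  intros He. set (q0 := ((X0, X1), (Y0, Y1)) : quad).
  change (good eps q0). destruct (good_dec eps q0) as [g|g]; [exact g|exfalso].
  set (q := fun n => Nat.iter n (next eps) q0).
  assert (Hq : forall n, sub (q n) /\ ~ good eps (q n)).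
  { induction n as [|n [IH1 IH2]].
    - split; [|exact g]. unfold q; simpl; unfold subrect; lra.
    - assert (K := bisection_next eps (q n) IH1 IH2). split; apply K. }
  assert (HS : forall n, q (S n) = next eps (q n)) by reflexivity.
  assert (Hw : forall n, (snd (fst (q n)) - fst (fst (q n)) = (X1 - X0) / 2 ^ n)%R /\
     (snd (snd (q n)) - fst (snd (q n)) = (Y1 - Y0) / 2 ^ n)%R).
  { induction n as [|n [IH1 IH2]]; [simpl; lra|].
    destruct (Hq n) as [A B]. assert (K := bisection_next eps (q n) A B).
    rewrite HS. destruct K as (_ & _ & _ & _ & _ & _ & -> & ->).
    rewrite IH1, IH2. simpl. split; field; apply pow_nonzero; lra. }
  destruct (nested_intervals (fun n => fst (fst (q n))) (fun n => snd (fst (q n)))) as [u Hu].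
  { intros n. destruct (Hq n) as [A B]. rewrite HS. apply (bisection_next eps (q n) A B). }
  { intros n. destruct (Hq n) as [A B]. rewrite HS. apply (bisection_next eps (q n) A B). }
  { intros n. destruct (Hq n) as [A _]. destruct (q n) as [[a b] [c d]]. apply A. }
  destruct (nested_intervals (fun n => fst (snd (q n))) (fun n => snd (snd (q n)))) as [v Hv'].
  { intros n. destruct (Hq n) as [A B]. rewrite HS. apply (bisection_next eps (q n) A B). }
  { intros n. destruct (Hq n) as [A B]. rewrite HS. apply (bisection_next eps (q n) A B). }
  { intros n. destruct (Hq n) as [A _]. destruct (q n) as [[a b] [c d]]. apply A. }
  destruct (Hloc u v eps (Hu O) (Hv' O) He) as [d [Hd K]].
  (* After [n] halvings both sides are shorter than [d]; the [+ 1] allows degenerate rectangles. *)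
  destruct (pow_lt_1_zero (1 / 2) ltac:(rewrite Rabs_pos_eq; lra) (d / (X1 - X0 + (Y1 - Y0) + 1)))
    as [n Hn].
  { apply Rdiv_lt_0_compat; lra. }
  specialize (Hn n (Nat.le_refl n)). rewrite Rabs_pos_eq in Hn; [|apply pow_le; lra].
  assert (Hn' : ((X1 - X0 + (Y1 - Y0) + 1) / 2 ^ n < d)%R).
  { apply Rmult_lt_compat_r with (r := (X1 - X0 + (Y1 - Y0) + 1)%R) in Hn; [|lra].
    replace (d / (X1 - X0 + (Y1 - Y0) + 1) * (X1 - X0 + (Y1 - Y0) + 1))%R with d in Hn by (field; lra).
    replace (((1 / 2) ^ n))%R with (/ 2 ^ n)%R in Hn.
    - unfold Rdiv. rewrite Rmult_comm. exact Hn.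
    - rewrite <- pow_inv. f_equal. lra. }
  assert (P2 : (0 < / 2 ^ n)%R) by (apply Rinv_0_lt_compat, pow_lt; lra).
  destruct (Hq n) as [A B]. destruct (Hw n) as [W1 W2].
  specialize (Hu n). specialize (Hv' n).
  destruct (q n) as [[a b] [c e]]. simpl in *. apply B. apply K; auto.
  - rewrite W1. unfold Rdiv in *. nra.
  - rewrite W2. unfold Rdiv in *. nra.
Qed.

(** Stated for an abstract [Phi] because it is applied twice: to contour integrals in [goursat], and
    to the difference of two iterated integrals in [CI_fubini]. *)
Lemma additive_zero : Phi X0 X1 Y0 Y1 = 0.
Proof.
  apply Cmod_eq_0. apply Rle_antisym; [|apply Cmod_ge_0].
  apply Rnot_lt_le. intros H.
  pose (S := ((X1 - X0 + (Y1 - Y0)) ^ 2 + 1)%R).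
  assert (HS : (0 < S)%R).
  { unfold S. assert (Q := pow2_ge_0 (X1 - X0 + (Y1 - Y0))). lra. }
  assert (K := additive_bound (Cmod (Phi X0 X1 Y0 Y1) / 2 / S)).
  assert (L : (0 < Cmod (Phi X0 X1 Y0 Y1) / 2 / S)%R).
  { apply Rdiv_lt_0_compat; lra. }
  specialize (K L).
  assert (Q : (Cmod (Phi X0 X1 Y0 Y1) / 2 / S * (X1 - X0 + (Y1 - Y0)) ^ 2 <=
     Cmod (Phi X0 X1 Y0 Y1) / 2 / S * S)%R).
  { apply Rmult_le_compat_l; [lra|]. unfold S. lra. }
  replace (Cmod (Phi X0 X1 Y0 Y1) / 2 / S * S)%R with (Cmod (Phi X0 X1 Y0 Y1) / 2)%R in Q
    by (field; lra).
  lra.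
Qed.

End Bisection.

Lemma Cmod_le_Re_Im z : (Cmod z <= Rabs (Re z) + Rabs (Im z))%R.
Proof.
  replace z with (RtoC (Re z) + Ci * RtoC (Im z)) at 1.
  - eapply Rle_trans; [apply Cmod_triangle|]. rewrite Cmod_mult, Cmod_Ci, !Cmod_RtoC. lra.
  - destruct z; apply injective_projections; simpl; ring.
Qed.

Theorem goursat F X0 X1 Y0 Y1 : (X0 <= X1)%R -> (Y0 <= Y1)%R ->
  (forall z, in_box X0 X1 Y0 Y1 z -> holo F z) -> rect F X0 X1 Y0 Y1 = 0.
Proof.
  intros HX HY HF.
  assert (HC : forall x0 x1 y0 y1, subrect X0 X1 Y0 Y1 x0 x1 y0 y1 ->
    forall z, on_border x0 x1 y0 y1 z -> cont cid F z).
  { intros x0 x1 y0 y1 Hs z [[Hz1 Hz2] _]. apply holo_cont, HF.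
    unfold subrect in Hs. split; lra. }
  apply additive_zero; auto.
  - intros x0 x1 y0 y1 x Hs Hxx. apply rect_vsplit; auto; try apply Hs.
    now apply HC.
  - intros x0 x1 y0 y1 x Hs Hxx. apply rect_hsplit; auto; try apply Hs.
    now apply HC.
  - intros u v eps Hu Hv He. set (p := (u, v) : C).
    destruct (HF p) as [l Hl]; [split; auto|].
    destruct (der_limit _ _ _ _ Hl (eps / 2)%R) as [d [Hd K]]; [lra|].
    exists (d / 2)%R. split; [lra|]. intros x0 x1 y0 y1 Hs Hux Hvy Hdx Hdy.
    (* The affine part of [F] at [p] has a primitive and contributes nothing. The remainder is at
       most [eps / 2] times the half-perimeter, and integrating it brings a second factor of that
       size. *)
    pose (A := fun z : C => F p + l * (z - p)).
    assert (DA : forall z, der cid A z l).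
    { intros z. eapply der_eq.
      - apply der_plus; [apply der_const|]. apply der_scal.
        apply der_minus; [apply (der_iota cid)|apply der_const].
      - ring. }
    assert (CA : forall z, cont cid A z) by (intros z; eapply der_cont, DA).
    assert (EA : rect A x0 x1 y0 y1 = 0).
    { apply rect_primitive with (fun z => F p * z + l * ((z - p) * (z - p) / RtoC 2)); auto;
        try apply Hs.
      intros z _. eapply der_eq.
      - apply der_plus; [apply der_scal, (der_iota cid)|]. apply der_scal.
        unfold Cdiv. apply der_mult; [|apply der_const].
        apply der_mult; (apply der_minus; [apply (der_iota cid)|apply der_const]).
      - unfold A. simpl. field. }
    replace (rect F x0 x1 y0 y1) with (rect (fun z => F z - A z) x0 x1 y0 y1).
    2:{ rewrite rect_minus, EA; auto; try apply Hs; [ring|].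
        now apply HC. }
    replace (eps * (x1 - x0 + (y1 - y0)) ^ 2)%R with
      (2 * (eps / 2 * (x1 - x0 + (y1 - y0))) * (x1 - x0 + (y1 - y0)))%R by field.
    apply rect_bound; try apply Hs.
    + intros z Hz. apply cont_minus; auto. eapply HC; eauto.
    + intros z [[Hz1 Hz2] _].
      assert (Hb : (Cmod (z - p) <= x1 - x0 + (y1 - y0))%R).
      { eapply Rle_trans; [apply Cmod_le_Re_Im|].
        unfold p; destruct z as [zx zy]; simpl in *.
        assert (Rabs (zx + - u) <= x1 - x0)%R by (apply Rabs_le; lra).
        assert (Rabs (zy + - v) <= y1 - y0)%R by (apply Rabs_le; lra). lra. }
      replace (F z - A z) with (F z - F p - l * (z - p)) by (unfold A; ring).
      eapply Rle_trans; [apply (K z)|].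
      * unfold cid. lra.
      * unfold cid. apply Rmult_le_compat_l; lra.
Qed.

Lemma C_ext (z w : C) : Re z = Re w -> Im z = Im w -> z = w.
Proof. destruct z, w; simpl. now intros -> ->. Qed.

Lemma im_le_Cmod z : (Rabs (Im z) <= Cmod z)%R.
Proof.
  assert (H := re_le_Cmod (- (Ci * z))). rewrite Cmod_opp, Cmod_mult, Cmod_Ci, Rmult_1_l in H.
  replace (Re (- (Ci * z))) with (Im z) in H by (destruct z; simpl; ring). exact H.
Qed.

(** * Simple poles and the residue theorem *)

Lemma pair_neq_0_r (x y : R) : y <> 0%R -> (x, y) <> RtoC 0.
Proof. intros H E. apply H. now apply (f_equal Im) in E. Qed.

Lemma CI_inv_line d e : (0 < d)%R -> (e = d \/ e = - d)%R ->
  cont_on (fun u => / ((u, e) : C)) (- d) d /\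
  CI (fun u => / ((u, e) : C)) (- d) d = - Ci * RtoC (e / d * (PI / 2)).
Proof.
  intros Hd He.
  assert (He0 : e <> 0%R) by (destruct He; lra).
  assert (He2 : (e * e = d * d)%R) by (destruct He; subst; ring).
  assert (Hc : cont_on (fun u => / ((u, e) : C)) (- d) d).
  { intros t _. apply (cont_horizontal (fun z => / z)).
    apply cont_inv; [now apply pair_neq_0_r|apply (cont_iota cid)]. }
  split; [exact Hc|].
  assert (Hpos : forall u, (0 < u * u + d * d)%R) by (intros; nra).
  (* A branch of the logarithm of [u + i e] up to a constant; [e / d] is the sign of [e]. *)
  rewrite (CI_FTC (fun u => (ln (u * u + d * d) / 2, - (e / d) * atan (u / d))%R)
    (fun u => / ((u, e) : C))); [|lra| |exact Hc].
  - replace (d / d)%R with 1%R by (field; lra).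
    replace (- d / d)%R with (- (1))%R by (field; lra).
    rewrite atan_opp, atan_1. replace (- d * - d)%R with (d * d)%R by ring.
    apply injective_projections; simpl; field; lra.
  - intros u _. specialize (Hpos u).
    apply (der_eq RtoC _ u ((u / (u * u + d * d))%R, (- e / (u * u + d * d))%R)).
    + apply der_pair; auto_derive; auto; try lra; field; try lra.
    + apply C_ext; simpl; rewrite !Rmult_1_r, He2; field; lra.
Qed.

Lemma CI_inv_line_shift a d e : (0 < d)%R -> (e = d \/ e = - d)%R ->
  CI (fun x => / ((x - a, e)%R : C)) (a - d) (a + d) = - Ci * RtoC (e / d * (PI / 2)).
Proof.
  intros Hd He. destruct (CI_inv_line d e Hd He) as [Hc <-].
  assert (K := CI_shift (fun u => / ((u, e) : C)) (a - d) (a + d) (- a)).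
  replace (a - d + - a)%R with (- d)%R in K by ring.
  replace (a + d + - a)%R with d in K by ring.
  apply K; auto. lra.
Qed.

(** Each side of the centred square is seen from [p] under a right angle and contributes
    [Ci * PI / 2]. *)
Lemma rect_inv_square p d : (0 < d)%R ->
  rect (fun z => / (z - p)) (Re p - d) (Re p + d) (Im p - d) (Im p + d) = 2 * PI * Ci.
Proof.
  intros Hd. destruct p as [a b]. unfold rect. simpl Re. simpl Im.
  assert (Hh : forall e, (e = d \/ e = - d)%R ->
     CI (fun x => / ((x, b + e)%R - (a, b))) (a - d) (a + d) = - Ci * RtoC (e / d * (PI / 2))).
  { intros e He. rewrite <- (CI_inv_line_shift a); auto. apply CI_ext; [lra|].
    intros t _. f_equal. apply injective_projections; simpl; ring. }
  assert (Hv : forall e, (e = d \/ e = - d)%R ->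
     CI (fun y => / ((a + e, y)%R - (a, b))) (b - d) (b + d) = RtoC (e / d * (PI / 2))).
  { intros e He. assert (He' : (- e = d \/ - e = - d)%R) by lra.
    transitivity (- Ci * CI (fun y => / ((y - b, - e)%R : C)) (b - d) (b + d)).
    - rewrite <- CI_scal; [|lra|].
      + apply CI_ext; [lra|]. intros t _.
        replace ((a + e, t)%R - (a, b)) with (Ci * ((t - b, - e)%R : C))
          by (apply injective_projections; simpl; ring).
        assert ((t - b, - e)%R <> RtoC 0) by (apply pair_neq_0_r; destruct He; lra).
        assert (Ci * (t - b, - e)%R <> 0) by (apply Cmult_neq_0; auto; apply Ci_nz).
        replace (- Ci) with (/ Ci) by apply Ci_inv.
        field. split; auto. apply Ci_nz.
      + intros t _. apply (cont_comp RtoC (fun z => / z) (fun y => (y - b, - e)%R : C)).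
        * apply cont_pair; [|apply continuous_const].
          apply (continuous_minus (V := R_NormedModule)); [apply continuous_id|apply continuous_const].
        * apply cont_inv; [|apply (cont_iota cid)]. apply pair_neq_0_r; destruct He; lra.
    - rewrite CI_inv_line_shift; auto.
      replace (- e / d)%R with (- (e / d))%R by (field; lra).
      apply injective_projections; simpl; ring. }
  assert (H1 := Hh d (or_introl eq_refl)). assert (H2 := Hh (- d)%R (or_intror eq_refl)).
  assert (H3 := Hv d (or_introl eq_refl)). assert (H4 := Hv (- d)%R (or_intror eq_refl)).
  unfold Rminus in *. rewrite H1, H2, H3, H4.
  replace (d / d)%R with 1%R by (field; lra).
  replace (- d / d)%R with (- (1))%R by (field; lra).
  apply injective_projections; simpl; field.
Qed.

Definition strictly_in (x0 x1 y0 y1 : R) (z : C) : Prop :=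
  (x0 < Re z < x1)%R /\ (y0 < Im z < y1)%R.

Lemma rect_cut_square F p d x0 x1 y0 y1 :
  (0 < d)%R -> (x0 < Re p - d)%R -> (Re p + d < x1)%R ->
  (y0 < Im p - d)%R -> (Im p + d < y1)%R ->
  (forall z, in_box x0 x1 y0 y1 z -> (on_border x0 x1 y0 y1 z \/
     Re z = (Re p - d)%R \/ Re z = (Re p + d)%R \/
     Im z = (Im p - d)%R \/ Im z = (Im p + d)%R) -> cont cid F z) ->
  rect F x0 (Re p - d) y0 y1 = 0 -> rect F (Re p + d) x1 y0 y1 = 0 ->
  rect F (Re p - d) (Re p + d) y0 (Im p - d) = 0 ->
  rect F (Re p - d) (Re p + d) (Im p + d) y1 = 0 ->
  rect F x0 x1 y0 y1 = rect F (Re p - d) (Re p + d) (Im p - d) (Im p + d).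
Proof.
  intros Hd H1 H2 H3 H4 Hc E1 E2 E3 E4.
  rewrite (rect_vsplit F x0 x1 y0 y1) with (x := (Re p - d)%R); try lra.
  2:{ intros z [Hz Hb]. apply Hc; auto. left. split; auto. }
  rewrite (rect_vsplit F (Re p - d) x1 y0 y1) with (x := (Re p + d)%R); try lra.
  2:{ intros z [Hz Hb]. apply Hc; unfold on_border, in_box in *; [lra|].
      destruct Hb as [Hb|[Hb|[Hb|Hb]]]; [now right; left|left|left|left]; split; try lra; tauto. }
  rewrite (rect_hsplit F (Re p - d) (Re p + d) y0 y1) with (y := (Im p - d)%R); try lra.
  2:{ intros z [Hz Hb]. apply Hc; unfold on_border, in_box in *; [lra|].
      destruct Hb as [Hb|[Hb|[Hb|Hb]]]; [now right; left|now right; right; left|left|left]; split; try lra; tauto. }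
  rewrite (rect_hsplit F (Re p - d) (Re p + d) (Im p - d) y1) with (y := (Im p + d)%R); try lra.
  2:{ intros z [Hz Hb]. apply Hc; unfold on_border, in_box in *; [lra|].
      destruct Hb as [Hb|[Hb|[Hb|Hb]]]; [now right; left|now right; right; left|now right; right; right; left|left]; split; try lra; tauto. }
  rewrite E1, E2, E3, E4. ring.
Qed.

(** The prolonged sides of the square must miss [S] too, because the rectangle is cut along them. *)
Lemma generic_square (p : C) (S : list C) : ~ In p S ->
  exists d0, (0 < d0)%R /\ forall d, (0 < d < d0)%R -> forall q, In q S ->
    (Rabs (Re q - Re p) <> d)%R /\ (Rabs (Im q - Im p) <> d)%R /\
    ~ ((Rabs (Re q - Re p) <= d)%R /\ (Rabs (Im q - Im p) <= d)%R).
Proof.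
  induction S as [|r S IH]; intros Hp.
  - exists 1%R. split; [lra|]. intros d Hd q [].
  - destruct IH as [d0 [Hd0 H]]; [intros K; apply Hp; now right|].
    assert (Hr : r <> p) by (intros K; apply Hp; now left).
    set (a := Rabs (Re r - Re p)). set (b := Rabs (Im r - Im p)).
    assert (Ha : (0 <= a)%R) by apply Rabs_pos. assert (Hb : (0 <= b)%R) by apply Rabs_pos.
    assert (K : exists d1, (0 < d1)%R /\ forall d, (0 < d < d1)%R ->
       (a <> d /\ b <> d /\ ~ (a <= d /\ b <= d))%R).
    { destruct (Req_dec a 0) as [Ea|Na]; [destruct (Req_dec b 0) as [Eb|Nb]|].
      - exfalso. apply Hr. unfold a, b in *.
        assert (Ea' : (Re r - Re p = 0)%R).
        { destruct (Req_dec (Re r - Re p) 0) as [?|n]; auto. now apply Rabs_no_R0 in n. }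
        assert (Eb' : (Im r - Im p = 0)%R).
        { destruct (Req_dec (Im r - Im p) 0) as [?|n]; auto. now apply Rabs_no_R0 in n. }
        apply injective_projections; [change (Re r = Re p)|change (Im r = Im p)]; lra.
      - exists b. split; [lra|]. intros d Hd. repeat split; lra.
      - destruct (Req_dec b 0) as [Eb|Nb].
        + exists a. split; [lra|]. intros d Hd. repeat split; lra.
        + exists (Rmin a b). split; [apply Rmin_pos; lra|]. intros d Hd.
          assert (M1 := Rmin_l a b). assert (M2 := Rmin_r a b). repeat split; lra. }
    destruct K as [d1 [Hd1 K]].
    exists (Rmin d0 d1). split; [now apply Rmin_pos|]. intros d Hd q [<-|Hq].
    + apply K. assert (M := Rmin_r d0 d1). lra.
    + apply H; auto. assert (M := Rmin_l d0 d1). lra.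
Qed.

(** [c] is the residue when the pole is at most simple; [c = 0] is Riemann's condition for a
    removable singularity. The value of [F] at [p] does not enter. *)
Definition residue_limit (F : C -> C) (p c : C) : Prop :=
  forall eps, (0 < eps)%R -> exists d, (0 < d)%R /\ forall z, z <> p ->
    (Cmod (z - p) < d)%R -> (Cmod ((z - p) * F z - c) <= eps)%R.

(** Induction on the exceptional points. The induction hypothesis removes everything except a square
    of half-width [d] around the first one; on its border, of length [8 d], [|F|] is at most
    [eps / 8 / d], so the integral is at most [eps]. *)
Lemma goursat_removable S : NoDup S -> forall F x0 x1 y0 y1, (x0 <= x1)%R -> (y0 <= y1)%R ->
  (forall p, In p S -> in_box x0 x1 y0 y1 p -> strictly_in x0 x1 y0 y1 p) ->
  (forall z, in_box x0 x1 y0 y1 z -> ~ In z S -> holo F z) ->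
  (forall p, In p S -> in_box x0 x1 y0 y1 p -> residue_limit F p 0) ->
  rect F x0 x1 y0 y1 = 0.
Proof.
  induction S as [|p S IH]; intros HN F x0 x1 y0 y1 Hx Hy Hin HF Hres.
  { apply goursat; auto. }
  inversion HN as [|? ? HpS HN']; subst. specialize (IH HN').
  assert (Hdec : in_box x0 x1 y0 y1 p \/ ~ in_box x0 x1 y0 y1 p).
  { unfold in_box. destruct (Rle_dec x0 (Re p)), (Rle_dec (Re p) x1),
      (Rle_dec y0 (Im p)), (Rle_dec (Im p) y1); tauto. }
  destruct Hdec as [Hp|Hp].
  2:{ apply IH; auto.
      - intros q Hq. apply Hin. now right.
      - intros z Hz HzS. apply HF; auto. intros [<-|K]; auto.
      - intros q Hq. apply Hres. now right. }
  assert (Hsp := Hin p (or_introl eq_refl) Hp). destruct Hsp as [Hpx Hpy].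
  destruct (generic_square p S HpS) as [d0 [Hd0 Hgen]].
  apply Cmod_eq_0. apply Rle_antisym; [|apply Cmod_ge_0].
  apply le_epsilon. intros eps He. rewrite Rplus_0_l.
  destruct (Hres p (or_introl eq_refl) Hp (eps / 8)%R) as [d1 [Hd1 Hr]]; [lra|].
  destruct (lower_bound4_pos (Re p - x0) (x1 - Re p) (Im p - y0) (y1 - Im p))
    as (m0 & Hm0 & B1 & B2 & B3 & B4); try lra.
  destruct (lower_bound4_pos m0 d0 (d1 / 2) 1) as (m & Hm & B5 & B6 & B7 & _); try lra.
  set (d := (m / 2)%R).
  assert (Hd : (0 < d)%R) by (unfold d; lra).
  assert (Hdm : (d < m)%R) by (unfold d; lra).
  clearbody d.
  assert (Hg : forall q, In q S -> Re q <> (Re p - d)%R /\ Re q <> (Re p + d)%R /\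
     Im q <> (Im p - d)%R /\ Im q <> (Im p + d)%R /\
     ~ (Re p - d <= Re q <= Re p + d /\ Im p - d <= Im q <= Im p + d)%R).
  { intros q Hq. destruct (Hgen d ltac:(lra) q Hq) as [K1 [K2 K3]].
    assert (A1 : forall t, (t = d \/ t = - d)%R -> Rabs t = d).
    { intros t [->| ->]; [|rewrite Rabs_Ropp]; apply Rabs_pos_eq; lra. }
    repeat split.
    - intros E. apply K1, A1. lra.
    - intros E. apply K1, A1. lra.
    - intros E. apply K2, A1. lra.
    - intros E. apply K2, A1. lra.
    - intros [E1 E2]. apply K3. split; apply Rabs_le; lra. }
  assert (Hslab : forall a0 a1 b0 b1, subrect x0 x1 y0 y1 a0 a1 b0 b1 ->
     (a0 = x0 \/ a0 = Re p - d \/ a0 = Re p + d)%R -> (a1 = x1 \/ a1 = Re p - d \/ a1 = Re p + d)%R ->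
     (b0 = y0 \/ b0 = Im p - d \/ b0 = Im p + d)%R -> (b1 = y1 \/ b1 = Im p - d \/ b1 = Im p + d)%R ->
     ~ in_box a0 a1 b0 b1 p -> rect F a0 a1 b0 b1 = 0).
  { unfold subrect. intros a0 a1 b0 b1 Hs Ha0 Ha1 Hb0 Hb1 Hnp.
    assert (Hsub : forall z, in_box a0 a1 b0 b1 z -> in_box x0 x1 y0 y1 z).
    { unfold in_box. intros z Hz. lra. }
    apply IH; try lra.
    - intros q Hq Hqb. assert (Q := Hin q (or_intror Hq) (Hsub _ Hqb)).
      destruct (Hg q Hq) as (G1 & G2 & G3 & G4 & _).
      destruct Q as [Q1 Q2]. destruct Hqb as [W1 W2].
      clear - Q1 Q2 W1 W2 G1 G2 G3 G4 Ha0 Ha1 Hb0 Hb1.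
      assert (Re q <> a0) by (destruct Ha0 as [->|[->| ->]]; lra).
      assert (Re q <> a1) by (destruct Ha1 as [->|[->| ->]]; lra).
      assert (Im q <> b0) by (destruct Hb0 as [->|[->| ->]]; lra).
      assert (Im q <> b1) by (destruct Hb1 as [->|[->| ->]]; lra).
      clear Ha0 Ha1 Hb0 Hb1. split; lra.
    - intros z Hz HzS. apply HF; auto. intros [<-|K]; auto.
    - intros q Hq Hqb. apply Hres; auto. now right. }
  assert (HpR : forall z, (Re z = Re p - d \/ Re z = Re p + d \/
     Im z = Im p - d \/ Im z = Im p + d)%R -> z <> p).
  { intros z Hz ->. lra. }
  rewrite (rect_cut_square F p d); try lra.
  - assert (Hcen : forall z, on_border (Re p - d) (Re p + d) (Im p - d) (Im p + d) z ->
       holo F z /\ (Cmod (F z) <= eps / 8 / d)%R).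
    { intros z [[Hz1 Hz2] Hb]. assert (Hzp := HpR z Hb). split.
      - apply HF; [unfold in_box; lra|]. intros [->|K]; [now apply Hzp|].
        apply (Hg z K). lra.
      - assert (K := Hr z Hzp).
        assert (Hlow : (d <= Cmod (z - p))%R).
        { assert (R1 := re_le_Cmod (z - p)). assert (R2 := im_le_Cmod (z - p)).
          replace (Re (z - p)) with (Re z - Re p)%R in R1 by (destruct z, p; reflexivity).
          replace (Im (z - p)) with (Im z - Im p)%R in R2 by (destruct z, p; reflexivity).
          destruct Hb as [E|[E|[E|E]]]; rewrite E in *.
          - replace (Re p - d - Re p)%R with (- d)%R in R1 by ring.
            rewrite Rabs_Ropp, Rabs_pos_eq in R1; lra.
          - replace (Re p + d - Re p)%R with d in R1 by ring.
            rewrite Rabs_pos_eq in R1; lra.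
          - replace (Im p - d - Im p)%R with (- d)%R in R2 by ring.
            rewrite Rabs_Ropp, Rabs_pos_eq in R2; lra.
          - replace (Im p + d - Im p)%R with d in R2 by ring.
            rewrite Rabs_pos_eq in R2; lra. }
        assert (Hup : (Cmod (z - p) < d1)%R).
        { eapply Rle_lt_trans; [apply Cmod_le_Re_Im|].
          replace (Re (z - p)) with (Re z - Re p)%R by (destruct z, p; reflexivity).
          replace (Im (z - p)) with (Im z - Im p)%R by (destruct z, p; reflexivity).
          assert (Rabs (Re z - Re p) <= d)%R by (apply Rabs_le; lra).
          assert (Rabs (Im z - Im p) <= d)%R by (apply Rabs_le; lra). lra. }
        specialize (K Hup). unfold Cminus in K at 1. rewrite Copp_0, Cplus_0_r, Cmod_mult in K.
        apply Rmult_le_reg_l with d; [exact Hd|].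
        replace (d * (eps / 8 / d))%R with (eps / 8)%R by (field; lra).
        eapply Rle_trans; [|exact K]. apply Rmult_le_compat_r; [apply Cmod_ge_0|exact Hlow]. }
    eapply Rle_trans; [apply (rect_bound F _ _ _ _) with (M := (eps / 8 / d)%R); try lra|].
    + intros z Hz. apply holo_cont, Hcen, Hz.
    + intros z Hz. apply Hcen, Hz.
    + right. field. lra.
  - intros z Hz Hb. apply holo_cont, HF; auto.
    intros [<-|K].
    + destruct Hb as [[_ Hb]|Hb]; lra.
    + assert (Q := Hin z (or_intror K) Hz). destruct (Hg z K) as (G1 & G2 & G3 & G4 & _).
      unfold strictly_in, on_border, in_box in *. lra.
  - apply Hslab; unfold subrect, in_box; try lra.
  - apply Hslab; unfold subrect, in_box; try lra.
  - apply Hslab; unfold subrect, in_box; try lra.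
  - apply Hslab; unfold subrect, in_box; try lra.
Qed.

Lemma holo_pole c p z : z <> p -> holo (fun w => c / (w - p)) z.
Proof.
  intros H. apply holo_div; [now apply Cminus_eq_contra|apply holo_const|].
  apply holo_minus; [apply holo_id|apply holo_const].
Qed.

Lemma rect_pole c p x0 x1 y0 y1 : strictly_in x0 x1 y0 y1 p ->
  rect (fun z => c / (z - p)) x0 x1 y0 y1 = 2 * PI * Ci * c.
Proof.
  intros [Hx Hy].
  destruct (lower_bound4_pos (Re p - x0) (x1 - Re p) (Im p - y0) (y1 - Im p))
    as (m & Hm & B1 & B2 & B3 & B4); try lra.
  set (d := (m / 2)%R). assert (Hd' : (0 < d < m)%R) by (unfold d; lra). clearbody d.
  assert (HpR : forall z, (Re z <= Re p - d \/ Re z >= Re p + d \/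
     Im z <= Im p - d \/ Im z >= Im p + d)%R -> z <> p).
  { intros z Hz ->. lra. }
  rewrite (rect_cut_square _ p d); try lra.
  - assert (Hn : forall z, on_border (Re p - d) (Re p + d) (Im p - d) (Im p + d) z -> z <> p).
    { intros z [_ Hb]. apply HpR. lra. }
    assert (E : rect (fun z => c / (z - p)) (Re p - d) (Re p + d) (Im p - d) (Im p + d) =
      c * rect (fun z => / (z - p)) (Re p - d) (Re p + d) (Im p - d) (Im p + d)).
    { assert (HC : forall z, on_border (Re p - d) (Re p + d) (Im p - d) (Im p + d) z ->
        cont cid (fun z => / (z - p)) z).
      { intros z Hz. apply cont_inv; [now apply Cminus_eq_contra, Hn|].
        apply cont_minus; [apply (cont_iota cid)|apply cont_const]. }
      unfold rect, Cdiv.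
      rewrite !CI_scal; try lra; [ring| | | |].
      - eapply (border_left (fun z => / (z - p))); try exact HC; lra.
      - eapply (border_right (fun z => / (z - p))); try exact HC; lra.
      - eapply (border_top (fun z => / (z - p))); try exact HC; lra.
      - eapply (border_bot (fun z => / (z - p))); try exact HC; lra. }
    rewrite E, rect_inv_square; [ring|lra].
  - intros z Hz Hb. apply holo_cont, holo_pole, HpR. unfold on_border, in_box in *. lra.
  - apply goursat; try lra. intros z Hz. apply holo_pole, HpR. unfold in_box in Hz. lra.
  - apply goursat; try lra. intros z Hz. apply holo_pole, HpR. unfold in_box in Hz. lra.
  - apply goursat; try lra. intros z Hz. apply holo_pole, HpR. unfold in_box in Hz. lra.
  - apply goursat; try lra. intros z Hz. apply holo_pole, HpR. unfold in_box in Hz. lra.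
Qed.

Lemma residue_limit_sub_other F p q c b : q <> p -> residue_limit F q b ->
  residue_limit (fun z => F z - c / (z - p)) q b.
Proof.
  intros Hqp HF eps He. destruct (HF (eps / 2)%R) as [d1 [Hd1 H1]]; [lra|].
  assert (HC : cont cid (fun z => (z - q) * (c / (z - p))) q).
  { apply cont_mult.
    - apply cont_minus; [apply (cont_iota cid)|apply cont_const].
    - apply holo_cont, holo_pole, Hqp. }
  destruct (HC (eps / 2)%R) as [d2 [Hd2 H2]]; [lra|].
  exists (Rmin d1 d2). split; [now apply Rmin_pos|]. intros z Hz Hzd.
  assert (K1 := H1 z Hz (Rlt_le_trans _ _ _ Hzd (Rmin_l _ _))).
  assert (K2 := H2 z (Rlt_le_trans _ _ _ Hzd (Rmin_r _ _))).
  replace ((z - q) * (c / (z - p)) - (q - q) * (c / (q - p))) with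
    ((z - q) * (c / (z - p))) in K2 by ring.
  replace ((z - q) * (F z - c / (z - p)) - b) with
    (((z - q) * F z - b) - (z - q) * (c / (z - p))) by ring.
  eapply Rle_trans; [apply Cmod_minus_triangle|]. lra.
Qed.

Lemma residue_limit_sub_same F p c : residue_limit F p c ->
  residue_limit (fun z => F z - c / (z - p)) p 0.
Proof.
  intros HF eps He. destruct (HF eps He) as [d [Hd H]]. exists d. split; auto.
  intros z Hz Hzd. replace ((z - p) * (F z - c / (z - p)) - 0) with ((z - p) * F z - c).
  - auto.
  - field. now apply Cminus_eq_contra.
Qed.

Theorem residue_rect (res : C -> C) x0 x1 y0 y1 S : (x0 <= x1)%R -> (y0 <= y1)%R ->
  NoDup S -> (forall p, In p S -> strictly_in x0 x1 y0 y1 p) ->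
  forall F, (forall z, in_box x0 x1 y0 y1 z -> ~ In z S -> holo F z) ->
  (forall p, In p S -> residue_limit F p (res p)) ->
  rect F x0 x1 y0 y1 = 2 * PI * Ci * fold_right (fun p a => res p + a) 0 S.
Proof.
  intros Hx Hy HN Hin.
  (* [S1] holds the poles still to be treated, [S0] those whose principal part has been subtracted,
     so that they have become removable. *)
  assert (G : forall S1 S0, NoDup (S1 ++ S0) ->
    (forall p, In p (S1 ++ S0) -> strictly_in x0 x1 y0 y1 p) ->
    forall F, (forall z, in_box x0 x1 y0 y1 z -> ~ In z (S1 ++ S0) -> holo F z) ->
    (forall p, In p S1 -> residue_limit F p (res p)) ->
    (forall p, In p S0 -> residue_limit F p 0) ->
    rect F x0 x1 y0 y1 = 2 * PI * Ci * fold_right (fun p a => res p + a) 0 S1).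
  { induction S1 as [|p S1 IH]; intros S0 HN' Hin' F HF H1 H0.
    - simpl in *. rewrite (goursat_removable S0); auto. ring.
    - assert (Hsp := Hin' p (or_introl eq_refl)).
      assert (HpN : ~ In p (S1 ++ S0)) by (inversion HN'; auto).
      assert (Hinc : forall q, In q (S1 ++ p :: S0) -> In q ((p :: S1) ++ S0)).
      { intros q Hq. apply in_app_or in Hq. simpl in *. rewrite in_app_iff. tauto. }
      assert (Hinc' : forall q, In q ((p :: S1) ++ S0) -> In q (S1 ++ p :: S0)).
      { intros q Hq. apply in_or_app. simpl in *. rewrite in_app_iff in Hq. tauto. }
      assert (HR : rect (fun z => F z - res p / (z - p)) x0 x1 y0 y1 =
        2 * PI * Ci * fold_right (fun p a => res p + a) 0 S1).
      { apply (IH (p :: S0)).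
        - apply NoDup_Add with (a := p) (l := S1 ++ S0); [apply Add_app|].
          split; [now inversion HN'|exact HpN].
        - intros q Hq. apply Hin'. auto.
        - intros z Hz HzS. apply holo_minus.
          + apply HF; auto.
          + apply holo_pole. intros ->. apply HzS. apply in_or_app. right. now left.
        - intros q Hq. apply residue_limit_sub_other.
          + intros ->. apply HpN. apply in_or_app. now left.
          + apply H1. now right.
        - intros q [<-|Hq].
          + apply residue_limit_sub_same, H1. now left.
          + apply residue_limit_sub_other; auto.
            intros ->. apply HpN. apply in_or_app. now right. }
      rewrite rect_minus in HR; auto.
      + rewrite rect_pole in HR; auto. simpl.
        rewrite Cmult_plus_distr_l, <- HR. ring.
      + intros z [Hz Hb]. apply holo_cont, HF; auto. intros K.
        destruct (Hin' z K). lra.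
      + intros z [Hz Hb]. apply holo_cont, holo_pole. intros ->. destruct Hsp. lra. }
  intros F HF Hr. apply (G S nil); try rewrite app_nil_r; auto. intros p [].
Qed.

(** * The identity theorem *)

Lemma Cexp_pair x y : Cexp (x, y) = RtoC (exp x) * (cos y, sin y).
Proof. reflexivity. Qed.

Lemma Cmod_Cexp_pair x y : Cmod (Cexp (x, y)) = exp x.
Proof. now rewrite Cmod_Cexp. Qed.

Lemma Cexp_2PI x : Cexp (x, 2 * PI)%R = Cexp (x, 0%R).
Proof. rewrite !Cexp_pair, cos_2PI, sin_2PI, cos_0, sin_0. reflexivity. Qed.

(** [V A] is [2 PI] times the mean of [F] over the circle of radius [exp A]. Goursat's theorem for
    [F (Cexp w)] on a rectangle of height [2 PI], whose horizontal sides cancel by periodicity,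
    shows that it does not depend on [A <= 0]; as [A] tends to minus infinity it tends to
    [2 PI * F 0]. *)
Lemma mean_value_bound F M : (forall z, (Cmod z <= 1)%R -> holo F z) ->
  (forall t, (0 <= t <= 2 * PI)%R -> (Cmod (F (Cexp (0%R, t))) <= M)%R) ->
  (Cmod (F 0) <= M)%R.
Proof.
  intros HF HM. assert (Hpi := PI_RGT_0).
  set (V := fun A => CI (fun y => F (Cexp (A, y))) 0 (2 * PI)).
  assert (Hh : forall z, (Re z <= 0)%R -> holo (fun w => F (Cexp w)) z).
  { intros z Hz. apply holo_comp; [apply holo_Cexp|]. apply HF.
    rewrite Cmod_Cexp, <- exp_0. destruct Hz as [Hz|Hz]; [left; now apply exp_increasing|].
    rewrite Hz. lra. }
  assert (Hcont : forall A, (A <= 0)%R -> cont_on (fun y => F (Cexp (A, y))) 0 (2 * PI)).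
  { intros A HA t Ht. apply (cont_vertical (fun w => F (Cexp w))). apply holo_cont, Hh. exact HA. }
  assert (HV : forall A, (A <= 0)%R -> V A = V 0%R).
  { intros A HA.
    assert (G := goursat (fun w => F (Cexp w)) A 0 0 (2 * PI) HA ltac:(lra)
      (fun z Hz => Hh z (proj2 (proj1 Hz)))).
    unfold rect in G.
    rewrite (CI_ext (fun x => F (Cexp (x, (2 * PI)%R))) (fun x => F (Cexp (x, 0%R)))) in G; auto.
    2:{ intros t _. now rewrite Cexp_2PI. }
    fold (V 0%R) in G. fold (V A) in G.
    assert (E : V 0%R - V A = 0).
    { replace (V 0%R - V A) with (- Ci * (Ci * (V 0%R - V A))).
      - match type of G with ?a - ?a + ?b = _ => replace b with (a - a + b) by ring end.
        rewrite G. ring.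
      - apply C_ext; simpl; ring. }
    replace (V A) with (V 0%R - (V 0%R - V A)) by ring. rewrite E. ring. }
  assert (HV0 : (Cmod (V 0%R) <= 2 * PI * M)%R).
  { replace (2 * PI * M)%R with ((2 * PI - 0) * M)%R by ring.
    apply CI_bound; auto; [lra|]. apply Hcont; lra. }
  apply le_epsilon. intros eps He.
  assert (HC : cont cid F 0) by (apply holo_cont, HF; rewrite Cmod_0; lra).
  destruct (HC eps He) as [d [Hd K]].
  set (A := Rmin 0 (ln (d / 2))).
  assert (HA0 : (A <= 0)%R) by apply Rmin_l.
  assert (HAd : (exp A < d)%R).
  { apply Rle_lt_trans with (d / 2)%R; [|lra].
    rewrite <- (exp_ln (d / 2)); [|lra].
    destruct (Rmin_r 0 (ln (d / 2))) as [H|H]; [left; now apply exp_increasing|right].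
    unfold A. now rewrite H. }
  assert (HB : (Cmod (V A - RtoC (2 * PI) * F 0%R) <= (2 * PI - 0) * eps)%R).
  { replace (RtoC (2 * PI) * F 0%R) with (CI (fun _ => F 0%R) 0 (2 * PI)).
    2:{ rewrite CI_const. f_equal. f_equal. ring. }
    unfold V. rewrite <- CI_minus; [|lra|apply Hcont; auto|intros t _; apply cont_const].
    apply CI_bound; [lra| |].
    - intros t Ht. apply cont_minus; [now apply Hcont|apply cont_const].
    - intros t Ht. left. apply K. unfold cid.
      replace (Cexp (A, t) - 0) with (Cexp (A, t)) by ring. now rewrite Cmod_Cexp_pair. }
  rewrite HV in HB; auto.
  assert (T := Cmod_sub_triangle (RtoC (2 * PI) * F 0%R) (V 0%R)).
  rewrite Cmod_minus_sym in T. rewrite Cmod_mult, Cmod_RtoC, Rabs_pos_eq in T; [|lra].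
  apply Rmult_le_reg_l with (2 * PI)%R; [lra|]. lra.
Qed.

Lemma cont_on_bounded f a b : (a <= b)%R -> cont_on f a b ->
  exists M, forall t, (a <= t <= b)%R -> (Cmod (f t) <= M)%R.
Proof.
  intros Hab Hf.
  destruct (continuity_ab_maj (fun t => Cmod (f t)) a b Hab) as [x [Hx _]].
  - intros c Hc eps He. destruct (Hf c Hc eps He) as [d [Hd K]].
    exists d. split; auto. intros x [_ Hx]. simpl in *. unfold R_dist in *.
    specialize (K x). rewrite <- RtoC_minus, Cmod_RtoC in K. specialize (K Hx).
    eapply Rle_lt_trans; [|exact K].
    assert (T1 := Cmod_sub_triangle (f x) (f c)).
    assert (T2 := Cmod_sub_triangle (f c) (f x)). rewrite Cmod_minus_sym in T2.
    apply Rabs_le. lra.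
  - exists (Cmod (f x)). exact Hx.
Qed.

Lemma Cmod_sqr z : (Cmod z ^ 2 = Re z * Re z + Im z * Im z)%R.
Proof. rewrite Cmod2_alt. ring. Qed.

(* The Schwarz-Pick identity for the disc automorphism [z |-> (z + w) / (1 + Cconj w * z)]. *)
Lemma mobius_identity z w :
  (Cmod (1 + Cconj w * z) ^ 2 - Cmod (z + w) ^ 2 =
   (1 - Cmod z ^ 2) * (1 - Cmod w ^ 2))%R.
Proof. rewrite !Cmod_sqr. destruct z, w; simpl. ring. Qed.

Lemma Cmod_lt_sqr a b : (Cmod a ^ 2 <= Cmod b ^ 2)%R -> (Cmod a <= Cmod b)%R.
Proof.
  intros H. assert (P := Cmod_ge_0 a). assert (Q := Cmod_ge_0 b).
  apply Rsqr_incr_0; auto. unfold Rsqr. simpl in H. lra.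
Qed.

Lemma mobius_den z w : (Cmod z <= 1)%R -> (Cmod w < 1)%R -> 1 + Cconj w * z <> 0.
Proof.
  intros Hz Hw E.
  assert (K := mobius_identity z w). rewrite E, Cmod_0 in K.
  assert (T := Cmod_sub_triangle 1 (- (Cconj w * z))).
  replace (1 - - (Cconj w * z)) with (1 + Cconj w * z) in T by ring.
  rewrite E, Cmod_0, Cmod_1, Cmod_opp, Cmod_mult, Cmod_conj in T.
  assert (P := Cmod_ge_0 z). assert (Q := Cmod_ge_0 w). nra.
Qed.

Lemma eq_0_of_le_pow (a M q : R) : (0 <= a)%R -> (0 <= q < 1)%R ->
  (forall n, a <= M * q ^ n)%R -> a = 0%R.
Proof.
  intros Ha Hq H. apply Rle_antisym; auto. apply le_epsilon. intros eps He.
  assert (HM : (0 <= M)%R) by (specialize (H O); simpl in H; lra).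
  destruct (pow_lt_1_zero q ltac:(rewrite Rabs_pos_eq; lra) (eps / (M + 1))) as [n Hn].
  { apply Rdiv_lt_0_compat; lra. }
  specialize (Hn n (Nat.le_refl n)). rewrite Rabs_pos_eq in Hn; [|apply pow_le; lra].
  specialize (H n).
  assert (M * q ^ n <= M * (eps / (M + 1)))%R by (apply Rmult_le_compat_l; lra).
  assert (M * (eps / (M + 1)) <= eps)%R.
  { apply Rmult_le_reg_r with (M + 1)%R; [lra|].
    replace (M * (eps / (M + 1)) * (M + 1))%R with (M * eps)%R by (field; lra). nra. }
  lra.
Qed.

(* The mean value of [F (phi z) / phi z ^ n], with [phi] a disc automorphism taking 0 to [w],
   gives [|F w| <= M |w|^n] for all [n]. *)
Lemma holo_zero_unit_disc F d : (forall z, (Cmod z <= 1)%R -> holo F z) -> (0 < d)%R ->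
  (forall z, (Cmod z < d)%R -> F z = 0) -> forall w, (Cmod w < 1)%R -> F w = 0.
Proof.
  intros HF Hd H0 w Hw.
  destruct (Ceq_dec w 0) as [->|Hw0]; [apply H0; now rewrite Cmod_0|].
  set (phi := fun z => (z + w) / (1 + Cconj w * z)).
  assert (Hphi : forall z, (Cmod z <= 1)%R -> holo phi z).
  { intros z Hz. apply holo_div; [now apply mobius_den| |].
    - apply holo_plus; [apply holo_id|apply holo_const].
    - apply holo_plus; [apply holo_const|].
      apply (holo_mult (fun _ => Cconj w) (fun z => z)); [apply holo_const|apply holo_id]. }
  assert (Hw2 : (0 < 1 - Cmod w ^ 2)%R) by (assert (Q := Cmod_ge_0 w); nra).
  assert (Hle : forall z, (Cmod z <= 1)%R -> (Cmod (phi z) <= 1)%R).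
  { intros z Hz. assert (Hn := mobius_den z w Hz Hw). unfold phi. rewrite Cmod_div; auto.
    assert (Hp : (0 < Cmod (1 + Cconj w * z))%R) by now apply Cmod_gt_0.
    apply Rmult_le_reg_r with (Cmod (1 + Cconj w * z)); auto.
    unfold Rdiv. rewrite Rmult_assoc, Rinv_l, Rmult_1_r, Rmult_1_l; [|lra].
    apply Cmod_lt_sqr. assert (K := mobius_identity z w).
    assert (P := Cmod_ge_0 z). assert (0 <= (1 - Cmod z ^ 2) * (1 - Cmod w ^ 2))%R; [|lra].
    apply Rmult_le_pos; [nra|lra]. }
  assert (Heq : forall z, (Cmod z = 1)%R -> (Cmod (phi z) = 1)%R).
  { intros z Hz. assert (Hn := mobius_den z w ltac:(lra) Hw). unfold phi. rewrite Cmod_div; auto.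
    assert (Hp : (0 < Cmod (1 + Cconj w * z))%R) by now apply Cmod_gt_0.
    replace (Cmod (z + w)) with (Cmod (1 + Cconj w * z)); [field; lra|].
    assert (K := mobius_identity z w). rewrite Hz in K.
    apply Rle_antisym; apply Cmod_lt_sqr; lra. }
  assert (Hc1 : forall t, Cmod (Cexp (0%R, t)) = 1%R).
  { intros t. rewrite Cmod_Cexp_pair. apply exp_0. }
  destruct (cont_on_bounded (fun t => F (phi (Cexp (0%R, t)))) 0 (2 * PI)) as [M HM].
  { assert (Q := PI_RGT_0). lra. }
  { intros t _. apply (cont_vertical (fun z => F (phi (Cexp z)))).
    apply holo_cont. apply (holo_comp (fun z => F (phi z)) Cexp); [apply holo_Cexp|].
    apply holo_comp; [apply Hphi|apply HF, Hle]; rewrite Hc1; lra. }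
  assert (Hp0 : phi 0 = w).
  { unfold phi. rewrite Cmult_0_r. field. }
  assert (HB : forall n, (Cmod (F w / w ^ n) <= M)%R).
  { intros n. rewrite <- Hp0 at 1 2.
    apply (mean_value_bound (fun z => F (phi z) / phi z ^ n)).
    (* Where [phi] vanishes, [F (phi y)] is [0] for all nearby [y], so the quotient is locally [0],
       its default value at the zero of [phi] included. *)
    - intros z Hz. destruct (Ceq_dec (phi z) 0) as [E|E].
      + destruct (holo_cont _ _ (Hphi z Hz) d Hd) as [e [He K]].
        apply holo_ext_near with (fun _ => RtoC 0) e; auto; [|apply holo_const].
        intros y Hy. specialize (K y Hy). rewrite E in K.
        replace (phi y - 0) with (phi y) in K by ring.
        rewrite (H0 _ K). unfold Cdiv. ring.
      + apply holo_div; [now apply Cpow_nz| |].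
        * apply holo_comp; auto.
        * apply (holo_comp (fun z => z ^ n) phi); auto. apply holo_pow.
    - intros t Ht. rewrite Cmod_div, Cmod_pow, Heq, pow1; auto.
      + unfold Rdiv. rewrite Rinv_1, Rmult_1_r. auto.
      + apply Cpow_nz. apply Cmod_gt_0. rewrite Heq; auto. lra. }
  apply Cmod_eq_0. apply eq_0_of_le_pow with M (Cmod w); [apply Cmod_ge_0|split; auto; apply Cmod_ge_0|].
  intros n. specialize (HB n). rewrite Cmod_div, Cmod_pow in HB; [|now apply Cpow_nz].
  assert (P : (0 < Cmod w ^ n)%R) by (apply pow_lt; now apply Cmod_gt_0).
  apply Rmult_le_reg_r with (/ Cmod w ^ n)%R; [now apply Rinv_0_lt_compat|].
  rewrite Rmult_assoc, Rinv_r, Rmult_1_r; [exact HB|lra].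
Qed.

Lemma holo_zero_disc F a R d : (0 < R)%R -> (forall z, (Cmod (z - a) <= R)%R -> holo F z) ->
  (0 < d)%R -> (forall z, (Cmod (z - a) < d)%R -> F z = 0) ->
  forall w, (Cmod (w - a) < R)%R -> F w = 0.
Proof.
  intros HR HF Hd H0 w Hw.
  assert (HRn : RtoC R <> 0) by (intros E; apply RtoC_inj in E; lra).
  assert (Hs : forall z, (Cmod (a + RtoC R * z - a) = R * Cmod z)%R).
  { intros z. replace (a + RtoC R * z - a) with (RtoC R * z) by ring.
    rewrite Cmod_mult, Cmod_RtoC, Rabs_pos_eq; lra. }
  replace w with (a + RtoC R * ((w - a) / RtoC R)) by (field; auto).
  apply (holo_zero_unit_disc (fun z => F (a + RtoC R * z)) (d / R)).
  - intros z Hz. apply (holo_comp F (fun z => a + RtoC R * z)).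
    + apply holo_plus; [apply holo_const|].
      apply (holo_mult (fun _ => RtoC R) (fun z => z)); [apply holo_const|apply holo_id].
    + apply HF. rewrite Hs. nra.
  - now apply Rdiv_lt_0_compat.
  - intros z Hz. apply H0. rewrite Hs.
    replace d with (R * (d / R))%R by (field; lra). now apply Rmult_lt_compat_l.
  - rewrite Cmod_div, Cmod_RtoC, Rabs_pos_eq; auto; [|lra].
    apply Rmult_lt_reg_r with R; auto. unfold Rdiv.
    rewrite Rmult_assoc, Rinv_l; lra.
Qed.

Definition zero_near (F : C -> C) (a : C) : Prop :=
  exists d, (0 < d)%R /\ forall z, (Cmod (z - a) < d)%R -> F z = 0.

Definition holo_near (F : C -> C) (a : C) : Prop :=
  exists d, (0 < d)%R /\ forall z, (Cmod (z - a) < d)%R -> holo F z.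

(** Let [s] be the supremum of the parameters up to which [F] vanishes locally. [F] is holomorphic
    in a disc of radius [d] about [g s]; a disc of radius [d / 2] about a slightly earlier point
    [g t] lies in it, reaches beyond [g s], and carries the vanishing past [s] unless [s = 1]. *)
Theorem identity_segment F a b :
  (forall t, (0 <= t <= 1)%R -> holo_near F (a + RtoC t * (b - a))) ->
  zero_near F a -> zero_near F b.
Proof.
  intros HF Ha. set (g := fun t => a + RtoC t * (b - a)).
  set (E := fun t => (0 <= t <= 1)%R /\ forall u, (0 <= u <= t)%R -> zero_near F (g u)).
  assert (Hg0 : g 0%R = a) by (unfold g; ring).
  assert (Hg1 : g 1%R = b) by (unfold g; ring).
  assert (HE0 : E 0%R).
  { split; [lra|]. intros u Hu. replace u with 0%R by lra. now rewrite Hg0. }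
  destruct (completeness E) as [s [Hub Hlub]].
  { exists 1%R. intros t [Ht _]. lra. }
  { now exists 0%R. }
  assert (Hs : (0 <= s <= 1)%R).
  { split; [now apply Hub|]. apply Hlub. intros t [Ht _]. lra. }
  destruct (HF s Hs) as [d [Hd K]]. fold (g s) in K.
  set (L := (Cmod (b - a) + 1)%R).
  assert (HL : (0 < L)%R) by (unfold L; assert (Q := Cmod_ge_0 (b - a)); lra).
  set (eta := (d / 8 / L)%R).
  assert (Heta : (0 < eta)%R) by (apply Rdiv_lt_0_compat; lra).
  assert (Hgd : forall u v, (Rabs (u - v) <= 2 * eta)%R -> (Cmod (g u - g v) <= d / 4)%R).
  { intros u v Huv. unfold g.
    replace (a + RtoC u * (b - a) - (a + RtoC v * (b - a))) with (RtoC (u - v) * (b - a))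
      by (rewrite RtoC_minus; ring).
    rewrite Cmod_mult, Cmod_RtoC.
    apply Rle_trans with (2 * eta * L)%R.
    - apply Rmult_le_compat; try apply Rabs_pos; try apply Cmod_ge_0; auto.
      unfold L. lra.
    - right. unfold eta. field. lra. }
  assert (Hex : exists t, E t /\ (s - eta < t)%R).
  { destruct (Classical_Prop.classic (exists t, E t /\ (s - eta < t)%R)) as [?|N]; auto.
    exfalso. assert (s <= s - eta)%R; [|lra]. apply Hlub. intros t Ht.
    apply Rnot_lt_le. intros Hlt. apply N. now exists t. }
  destruct Hex as [t [[Ht Hz] Hts]].
  assert (Hts' : (t <= s)%R) by (apply Hub; split; auto).
  destruct (Hz t ltac:(lra)) as [e [He Z]].
  assert (Hdt : (Cmod (g t - g s) <= d / 4)%R) by (apply Hgd; apply Rabs_le; lra).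
  assert (Zd : forall w, (Cmod (w - g t) < d / 2)%R -> F w = 0).
  { apply (holo_zero_disc F (g t) (d / 2) e); auto; [lra|].
    intros z Hzz. apply K.
    replace (z - g s) with ((z - g t) + (g t - g s)) by ring.
    eapply Rle_lt_trans; [apply Cmod_triangle|]. lra. }
  assert (Znear : forall u, (Rabs (u - t) <= 2 * eta)%R -> zero_near F (g u)).
  { intros u Hu. exists (d / 4)%R. split; [lra|]. intros w Hw. apply Zd.
    replace (w - g t) with ((w - g u) + (g u - g t)) by ring.
    eapply Rle_lt_trans; [apply Cmod_triangle|].
    specialize (Hgd u t Hu). lra. }
  assert (HE : E (Rmin 1 (t + 2 * eta))).
  { assert (M1 := Rmin_l 1 (t + 2 * eta)). assert (M2 := Rmin_r 1 (t + 2 * eta)).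
    assert (M3 : (0 <= Rmin 1 (t + 2 * eta))%R) by (apply Rmin_glb; lra).
    split; [lra|]. intros u Hu. destruct (Rle_dec u t) as [Hle|Hgt].
    - apply Hz. lra.
    - apply Znear. apply Rabs_le. lra. }
  assert (HM : (Rmin 1 (t + 2 * eta) <= s)%R) by now apply Hub.
  assert (H1 : (Rmin 1 (t + 2 * eta) = 1)%R).
  { unfold Rmin in *. destruct (Rle_dec 1 (t + 2 * eta)); auto. lra. }
  rewrite H1 in HE. rewrite <- Hg1. apply HE. lra.
Qed.

(** * Improper integrals and Laplace transforms *)

Definition is_rint (F : R -> C) (l : C) : Prop :=
  forall eps, (0 < eps)%R -> exists T0, (0 <= T0)%R /\
    forall T, (T0 <= T)%R -> (Cmod (CI F 0 T - l) < eps)%R.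

(** The integral over the whole line; splitting at [0] keeps the limits at the two ends
    independent. *)
Definition is_lint (F : R -> C) (l : C) : Prop :=
  exists l1 l2, is_rint F l1 /\ is_rint (fun t => F (- t)%R) l2 /\ l = l2 + l1.

Lemma C_eq_of_small (z w : C) : (forall eps, (0 < eps)%R -> (Cmod (z - w) <= eps)%R) -> z = w.
Proof.
  intros H. apply Ceq_minus. apply Cmod_eq_0. apply Rle_antisym; [|apply Cmod_ge_0].
  apply le_epsilon. intros eps He. rewrite Rplus_0_l. auto.
Qed.

Lemma Cmod_triangle3 a b c : (Cmod (a - c) <= Cmod (a - b) + Cmod (b - c))%R.
Proof. replace (a - c) with ((a - b) + (b - c)) by ring. apply Cmod_triangle. Qed.

Lemma is_rint_unique F l l' : is_rint F l -> is_rint F l' -> l = l'.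
Proof.
  intros H H'. apply C_eq_of_small. intros eps He.
  destruct (H (eps / 2)%R) as [T [HT K]]; [lra|].
  destruct (H' (eps / 2)%R) as [T' [HT' K']]; [lra|].
  specialize (K (Rmax T T') (Rmax_l _ _)). specialize (K' (Rmax T T') (Rmax_r _ _)).
  eapply Rle_trans; [apply (Cmod_triangle3 _ (CI F 0 (Rmax T T')))|].
  rewrite Cmod_minus_sym. lra.
Qed.

Lemma is_rint_le F l c M : is_rint F l ->
  (exists T0, forall T, (T0 <= T)%R -> (0 <= T)%R -> (Cmod (CI F 0 T - c) <= M)%R) ->
  (Cmod (l - c) <= M)%R.
Proof.
  intros H [T1 HT1]. apply le_epsilon. intros eps He.
  destruct (H eps He) as [T0 [HT0 K]].
  specialize (K (Rmax T0 T1) (Rmax_l _ _)).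
  assert (Q := Rmax_l T0 T1).
  specialize (HT1 (Rmax T0 T1) (Rmax_r _ _) ltac:(lra)).
  eapply Rle_trans; [apply (Cmod_triangle3 _ (CI F 0 (Rmax T0 T1)))|].
  rewrite Cmod_minus_sym. lra.
Qed.

Lemma exp_decay_primitive C b t : b <> 0%R ->
  is_derive (fun t => - (C / b) * exp (- (b * t)))%R t (C * exp (- (b * t)))%R.
Proof. intros Hb. auto_derive; auto. field. auto. Qed.

Lemma continuous_exp_decay C b t : continuous (fun t => C * exp (- (b * t)))%R t.
Proof.
  apply (ex_derive_continuous (fun t => C * exp (- (b * t)))%R). auto_derive. auto.
Qed.

Lemma CI_tail F C b T T' : (0 < b)%R -> (T <= T')%R -> (0 <= C)%R -> cont_on F T T' ->
  (forall t, (T <= t <= T')%R -> (Cmod (F t) <= C * exp (- (b * t)))%R) ->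
  (Cmod (CI F T T') <= C / b * exp (- (b * T)))%R.
Proof.
  intros Hb HT HC Hc HF.
  eapply Rle_trans.
  - apply (CI_bound_prim F _ (fun t => - (C / b) * exp (- (b * t)))%R T T' HT Hc HF).
    + intros t _. apply exp_decay_primitive. lra.
    + intros t _. apply continuous_exp_decay.
  - assert (P := exp_pos (- (b * T'))).
    assert (0 <= C / b)%R by (apply Rdiv_le_0_compat; lra). nra.
Qed.

Lemma exp_decay_small C b eps : (0 < b)%R -> (0 <= C)%R -> (0 < eps)%R ->
  exists T0, (0 <= T0)%R /\ forall T, (T0 <= T)%R -> (C * exp (- (b * T)) < eps)%R.
Proof.
  intros Hb P He. exists (C / eps / b)%R. split.
  { unfold Rdiv in *. repeat apply Rmult_le_pos; try (left; apply Rinv_0_lt_compat; lra); lra. }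
  intros T HT. rewrite exp_Ropp.
  assert (E : (1 + b * T <= exp (b * T))%R) by apply exp_ineq1_le.
  assert (Q : (C / eps <= b * T)%R).
  { replace (C / eps)%R with (b * (C / eps / b))%R by (field; lra).
    apply Rmult_le_compat_l; lra. }
  apply Rmult_lt_reg_r with (exp (b * T)); [apply exp_pos|].
  rewrite Rmult_assoc, Rinv_l, Rmult_1_r; [|apply Rgt_not_eq, exp_pos].
  apply Rlt_le_trans with (eps * (1 + b * T))%R; [|apply Rmult_le_compat_l; lra].
  apply Rlt_le_trans with (eps * (1 + C / eps))%R; [|apply Rmult_le_compat_l; lra].
  replace (eps * (1 + C / eps))%R with (eps + C)%R by (field; lra). lra.
Qed.

Lemma rint_ex F C b : (0 < b)%R -> (0 <= C)%R ->
  (forall t, (0 <= t)%R -> cont RtoC F t) ->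
  (forall t, (0 <= t)%R -> (Cmod (F t) <= C * exp (- (b * t)))%R) ->
  exists l, is_rint F l /\
    forall T, (0 <= T)%R -> (Cmod (l - CI F 0 T) <= C / b * exp (- (b * T)))%R.
Proof.
  intros Hb HC Hc HF.
  assert (Hd : forall T T', (0 <= T)%R -> (T <= T')%R ->
    (Cmod (CI F 0 T' - CI F 0 T) <= C / b * exp (- (b * T)))%R).
  { intros T T' HT HTT. rewrite (CI_Chasles F 0 T T'); auto.
    2:{ intros t Ht. apply Hc. lra. }
    replace (CI F 0 T + CI F T T' - CI F 0 T) with (CI F T T') by ring.
    apply CI_tail; auto; intros t Ht; [apply Hc|apply HF]; lra. }
  assert (Hex : exists y : C_CompleteNormedModule,
     filterlim (fun T => CI F 0 T : C_CompleteNormedModule) (Rbar_locally p_infty) (locally y)).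
  { apply (filterlim_locally_cauchy (U := C_CompleteNormedModule)).
    intros eps. destruct (exp_decay_small (C / b) b (eps / 2)) as [T0 [HT0 K]];
      [auto|apply Rdiv_le_0_compat; lra|apply is_pos_div_2|].
    exists (fun T => T0 < T)%R. split; [now exists T0|].
    intros u v Hu Hv. apply ball_C_Cmod.
    eapply Rle_lt_trans; [apply (Cmod_triangle3 _ (CI F 0 T0))|].
    rewrite (Cmod_minus_sym (CI F 0 T0)).
    assert (A1 := Hd T0 u HT0 ltac:(lra)). assert (A2 := Hd T0 v HT0 ltac:(lra)).
    specialize (K T0 ltac:(lra)). lra. }
  destruct Hex as [l Hl]. exists l.
  assert (HR : is_rint F l).
  { intros eps He. assert (He2 : (0 < eps / 2)%R) by lra.
    destruct (proj1 (filterlim_locally _ _) Hl (mkposreal _ He2)) as [M HM].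
    exists (Rmax 0 M + 1)%R. assert (Q1 := Rmax_l 0 M). assert (Q2 := Rmax_r 0 M).
    split; [lra|]. intros T HT.
    assert (B := Cmod_ball_C _ _ _ (HM T ltac:(lra))). simpl in B. lra. }
  split; auto.
  intros T HT. apply (is_rint_le F l); auto. exists T. intros T' H1 H2. now apply Hd.
Qed.

Lemma CI_reflect F T : (0 <= T)%R -> cont_on F (- T) 0 ->
  CI (fun t => F (- t)%R) 0 T = CI F (- T) 0.
Proof.
  intros HT Hc. apply CI_unique.
  assert (H := CI_is F (- T) 0 ltac:(lra) Hc).
  assert (K := is_RInt_comp_opp (V := C_R_NormedModule) F T 0 (CI F (- T) 0)).
  rewrite Ropp_0 in K. specialize (K H).
  apply is_RInt_swap in K. apply (is_RInt_opp (V := C_R_NormedModule)) in K.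
  rewrite opp_opp in K. revert K. apply is_RInt_ext. intros t _. apply opp_opp.
Qed.

Lemma is_lint_approx F l : (forall t, cont RtoC F t) -> is_lint F l ->
  forall eps, (0 < eps)%R -> exists T0, (0 <= T0)%R /\
    forall A B, (T0 <= A)%R -> (T0 <= B)%R -> (Cmod (CI F (- A) B - l) < eps)%R.
Proof.
  intros Hc [l1 [l2 [H1 [H2 ->]]]] eps He.
  destruct (H1 (eps / 2)%R) as [T1 [P1 K1]]; [lra|].
  destruct (H2 (eps / 2)%R) as [T2 [P2 K2]]; [lra|].
  assert (Q1 := Rmax_l T1 T2). assert (Q2 := Rmax_r T1 T2).
  exists (Rmax T1 T2). split; [lra|]. intros A B HA HB.
  rewrite (CI_Chasles F (- A) 0 B); try lra; [|intros t _; apply Hc].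
  specialize (K1 B ltac:(lra)). specialize (K2 A ltac:(lra)).
  rewrite CI_reflect in K2; [|lra|intros t _; apply Hc].
  replace (CI F (- A) 0 + CI F 0 B - (l2 + l1)) with
    ((CI F (- A) 0 - l2) + (CI F 0 B - l1)) by ring.
  eapply Rle_lt_trans; [apply Cmod_triangle|]. lra.
Qed.

(** The substitution [x = exp t], with [exp t] as Jacobian. It moves the integrals of [Gamma] and of
    [zeta] to the line, where [x^s] is an exponential. *)
Lemma Cint_0_infty_log f l :
  (forall t, cont RtoC (fun t => RtoC (exp t) * f (exp t)) t) ->
  is_lint (fun t => RtoC (exp t) * f (exp t)) l -> Cint_0_infty f = l.
Proof.
  intros Hc H. set (F := fun t => RtoC (exp t) * f (exp t)) in *.
  unfold Cint_0_infty.
  apply (@is_RInt_gen_unique C_R_CompleteNormedModule (at_right 0) (Rbar_locally p_infty) _ _ f l).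
  assert (K := is_lint_approx F l Hc H).
  intros P [eps HP]. destruct (K eps (cond_pos eps)) as [T0 [HT0 L]].
  exists (fun a => 0 < a < exp (- T0))%R (fun b => exp T0 < b)%R.
  - exists (mkposreal _ (exp_pos (- T0))). intros y Hy Hy0. simpl in *.
    unfold ball in Hy; simpl in Hy; unfold AbsRing_ball, abs, minus, plus, opp in Hy; simpl in Hy.
    rewrite Ropp_0, Rplus_0_r, Rabs_pos_eq in Hy; lra.
  - now exists (exp T0).
  - intros a b [Ha1 Ha2] Hb. exists (CI F (ln a) (ln b)). simpl.
    assert (Hab : (a < b)%R).
    { eapply Rlt_trans; [exact Ha2|]. eapply Rle_lt_trans; [|exact Hb].
      destruct (Req_dec T0 0) as [->|n]; [rewrite Ropp_0; lra|].
      left. apply exp_increasing. lra. }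
    split.
    + assert (I := is_RInt_comp (V := C_R_CompleteNormedModule) F ln (fun x => / x)%R a b).
      rewrite Rmin_left, Rmax_right in I; try lra.
      apply is_RInt_ext with (f := fun y => scal (/ y)%R (F (ln y) : C_R_CompleteNormedModule)).
      * rewrite Rmin_left, Rmax_right; try lra. intros x Hx.
        change (scal (V := C_R_ModuleSpace) (/ x)%R (F (ln x)) = f x).
        rewrite scal_R_Cmult. unfold F. rewrite exp_ln; [|lra].
        rewrite Cmult_assoc, <- RtoC_mult, Rinv_l, Cmult_1_l; [reflexivity|lra].
      * apply I.
        -- intros x Hx. apply cont_continuous_R. apply Hc.
        -- intros x Hx. split.
           ++ auto_derive; [lra|]. field. lra.
           ++ apply (ex_derive_continuous (fun x => / x)%R). auto_derive. lra.
    + apply HP. apply ball_C_Cmod.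
      replace (ln a) with (- - ln a)%R by ring. apply L.
      * assert (E : (ln a < - T0)%R).
        { rewrite <- (ln_exp (- T0)). apply ln_increasing; lra. }
        lra.
      * assert (E : (T0 < ln b)%R).
        { rewrite <- (ln_exp T0). apply ln_increasing; auto. apply exp_pos. }
        lra.
Qed.

(** * Laplace transforms *)

Lemma sqr_le_exp x : (0 <= x)%R -> (x * x <= 4 * exp x)%R.
Proof.
  intros Hx. assert (E : (1 + x / 2 <= exp (x / 2))%R) by apply exp_ineq1_le.
  replace x with (x / 2 + x / 2)%R at 3 by field. rewrite exp_plus. nra.
Qed.

Lemma cont_RtoC_id t : cont RtoC RtoC t.
Proof. apply (cont_iota RtoC). Qed.

Lemma cont_Cexp_line s t : cont RtoC (fun t => Cexp (s * RtoC t)) t.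
Proof. apply cont_Cexp. apply cont_mult; [apply cont_const|apply cont_RtoC_id]. Qed.

(** Differentiation under the integral with an explicit error. By [Cexp_taylor1_bound] the pointwise
    error has the factor [|h|^2 t^2 e^(|h| t)]. Of the decay rate [b], one quarter absorbs [t^2],
    one quarter absorbs [e^(|h| t)], and the remaining half is integrated. The bound does not depend
    on [T] and so survives the limit. *)
Lemma laplace_remainder k C b s h T : (0 <= T)%R -> (0 <= C)%R -> (0 < b)%R ->
  cont_on k 0 T ->
  (forall t, (0 <= t <= T)%R -> (Cmod (Cexp (s * RtoC t) * k t) <= C * exp (- (b * t)))%R) ->
  (Cmod h <= b / 4)%R ->
  (Cmod (CI (fun t => Cexp ((s + h) * RtoC t) * k t)%C 0 T - CI (fun t => Cexp (s * RtoC t) * k t)%C 0 T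
    - h * CI (fun t => RtoC t * (Cexp (s * RtoC t) * k t))%C 0 T) <=
    128 * C / (b * b * b) * (Cmod h * Cmod h))%R.
Proof.
  intros HT HC Hb Hk HB Hh.
  assert (C1 : forall s, cont_on (fun t => Cexp (s * RtoC t) * k t) 0 T).
  { intros s' t Ht. apply cont_mult; auto. apply cont_Cexp_line. }
  assert (C2 : cont_on (fun t => RtoC t * (Cexp (s * RtoC t) * k t)) 0 T).
  { intros t Ht. apply cont_mult; [apply cont_RtoC_id|now apply C1]. }
  assert (C3 : cont_on (fun t => h * (RtoC t * (Cexp (s * RtoC t) * k t))) 0 T).
  { intros t Ht. apply cont_mult; [apply cont_const|now apply C2]. }
  rewrite <- CI_scal, <- CI_minus, <- CI_minus; auto.
  2:{ intros t Ht. apply cont_minus; now apply C1. }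
  assert (Hm : (0 <= Cmod h)%R) by apply Cmod_ge_0.
  set (D := (64 * C / (b * b) * (Cmod h * Cmod h))%R).
  assert (HD : (0 <= D)%R).
  { unfold D, Rdiv. repeat apply Rmult_le_pos; try lra.
    left. apply Rinv_0_lt_compat. nra. }
  replace (128 * C / (b * b * b) * (Cmod h * Cmod h))%R with
    (D / (b / 2) * exp (- (b / 2 * 0)))%R.
  2:{ rewrite Rmult_0_r, Ropp_0, exp_0. unfold D. field. lra. }
  apply CI_tail; auto; [lra| |].
  { intros t Ht. apply cont_minus; [apply cont_minus; now apply C1|now apply C3]. }
  intros t Ht.
  replace (Cexp ((s + h) * RtoC t) * k t - Cexp (s * RtoC t) * k t - h * (RtoC t * (Cexp (s * RtoC t) * k t)))
    with ((Cexp (s * RtoC t) * k t) * (Cexp (h * RtoC t) - 1 - h * RtoC t)).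
  2:{ rewrite Cmult_plus_distr_r, Cexp_plus. ring. }
  rewrite Cmod_mult.
  assert (E1 := HB t Ht).
  assert (E2 := Cexp_taylor1_bound (h * RtoC t)).
  rewrite Cmod_mult, Cmod_RtoC, Rabs_pos_eq in E2; [|lra].
  assert (E3 : (exp (Cmod h * t) <= exp (b / 4 * t))%R).
  { destruct (Rle_lt_or_eq_dec (Cmod h * t) (b / 4 * t)) as [K|K]; [nra| |].
    - left; now apply exp_increasing.
    - right; now rewrite K. }
  assert (E4 : (t * t <= 64 / (b * b) * exp (b / 4 * t))%R).
  { assert (Q := sqr_le_exp (b / 4 * t) ltac:(nra)).
    replace (t * t)%R with (16 / (b * b) * (b / 4 * t * (b / 4 * t)))%R by (field; lra).
    replace (64 / (b * b) * exp (b / 4 * t))%R with (16 / (b * b) * (4 * exp (b / 4 * t)))%R by (field; lra).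
    apply Rmult_le_compat_l; auto. left. apply Rdiv_lt_0_compat; nra. }
  assert (E5 : (exp (- (b * t)) * (exp (b / 4 * t) * exp (b / 4 * t)) = exp (- (b / 2 * t)))%R).
  { rewrite <- !exp_plus. f_equal. field. }
  apply Rle_trans with ((C * exp (- (b * t))) * (Cmod h * Cmod h * (t * t) * exp (b / 4 * t)))%R.
  - apply Rmult_le_compat; try apply Cmod_ge_0; auto.
    eapply Rle_trans; [exact E2|].
    replace (Cmod h * t * (Cmod h * t))%R with (Cmod h * Cmod h * (t * t))%R by ring.
    apply Rmult_le_compat_l; auto. apply Rmult_le_pos; nra.
  - unfold D.
    replace (64 * C / (b * b) * (Cmod h * Cmod h) * exp (- (b / 2 * t)))%R with
      ((C * exp (- (b * t))) * (Cmod h * Cmod h * (64 / (b * b) * exp (b / 4 * t)) * exp (b / 4 * t)))%R.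
    2:{ rewrite <- E5. field. lra. }
    assert (P1 := exp_pos (- (b * t))). assert (P2 := exp_pos (b / 4 * t)).
    apply Rmult_le_compat_l; [apply Rmult_le_pos; lra|].
    apply Rmult_le_compat_r; [lra|]. apply Rmult_le_compat_l; auto.
    apply Rmult_le_pos; auto.
Qed.

Lemma der_of_quadratic (L : C -> C) (s L1 : C) (M d : R) : (0 < d)%R -> (0 <= M)%R ->
  (forall h, (Cmod h <= d)%R -> (Cmod (L (s + h)%C - L s - h * L1) <= M * (Cmod h * Cmod h))%R) ->
  der cid L s L1.
Proof.
  intros Hd HM H. apply der_of_limit; [apply cid_inj|]. intros eps He. unfold cid.
  exists (Rmin d (eps / (M + 1))). split.
  { apply Rmin_pos; auto. apply Rdiv_lt_0_compat; lra. }
  intros y Hy. set (h := y - s) in *.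
  assert (K := H h). replace (s + h) with y in K by (unfold h; ring).
  assert (B1 : (Cmod h <= d)%R) by (left; eapply Rlt_le_trans; [exact Hy|apply Rmin_l]).
  assert (B2 : (Cmod h <= eps / (M + 1))%R) by (left; eapply Rlt_le_trans; [exact Hy|apply Rmin_r]).
  specialize (K B1). rewrite (Cmult_comm L1).
  eapply Rle_trans; [exact K|]. rewrite <- Rmult_assoc.
  apply Rmult_le_compat_r; [apply Cmod_ge_0|].
  assert (Cmod h * (M + 1) <= eps)%R.
  { replace eps with (eps / (M + 1) * (M + 1))%R by (field; lra).
    apply Rmult_le_compat_r; lra. }
  assert (Q := Cmod_ge_0 h). nra.
Qed.

Lemma laplace_fin_holo k T s : (0 <= T)%R -> cont_on k 0 T ->
  holo (fun s => CI (fun t => Cexp (s * RtoC t) * k t) 0 T) s.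
Proof.
  intros HT Hk.
  (* On a bounded interval any decay rate can be had at the price of the constant; the rate here is
     [1]. *)
  destruct (cont_on_bounded (fun t => Cexp (s * RtoC t) * k t * RtoC (exp t)) 0 T HT) as [M HM].
  { intros t Ht. apply cont_mult; [apply cont_mult; auto; apply cont_Cexp_line|].
    apply cont_ext with (fun t => Cexp (1 * RtoC t)); [|apply cont_Cexp_line].
    intros y. now rewrite Cmult_1_l, Cexp_RtoC. }
  assert (HM0 : (0 <= M)%R).
  { eapply Rle_trans; [apply Cmod_ge_0|apply (HM 0%R); lra]. }
  eexists. eapply (der_of_quadratic _ s _ (128 * M / (1 * 1 * 1)) (1 / 4)); try lra.
  intros h Hh. apply (laplace_remainder k M 1 s h T); auto; try lra.
  intros t Ht. specialize (HM t Ht). rewrite Rmult_1_l.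
  rewrite Cmod_mult, Cmod_RtoC, Rabs_pos_eq in HM; [|left; apply exp_pos].
  rewrite exp_Ropp. apply Rmult_le_reg_r with (exp t); [apply exp_pos|].
  rewrite Rmult_assoc, Rinv_l, Rmult_1_r; [exact HM|]. apply Rgt_not_eq, exp_pos.
Qed.

Lemma laplace_integrand_bound k C b s t :
  (Cmod (k t) <= C * exp (- (b * t)))%R ->
  (Cmod (Cexp (s * RtoC t) * k t) <= C * exp (- ((b - Re s) * t)))%R.
Proof.
  intros H. rewrite Cmod_mult, Cmod_Cexp, re_scal_r.
  replace (- ((b - Re s) * t))%R with (Re s * t + - (b * t))%R by ring.
  rewrite exp_plus. assert (P := exp_pos (Re s * t)).
  replace (C * (exp (Re s * t) * exp (- (b * t))))%R with
    (exp (Re s * t) * (C * exp (- (b * t))))%R by ring.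
  apply Rmult_le_compat_l; lra.
Qed.

Lemma laplace_ex k C b s : (0 <= C)%R -> (Re s < b)%R ->
  (forall t, (0 <= t)%R -> cont RtoC k t) ->
  (forall t, (0 <= t)%R -> (Cmod (k t) <= C * exp (- (b * t)))%R) ->
  exists l, is_rint (fun t => Cexp (s * RtoC t) * k t) l.
Proof.
  intros HC Hs Hk HB.
  destruct (rint_ex (fun t => Cexp (s * RtoC t) * k t) C (b - Re s)) as [l [Hl _]]; auto.
  - lra.
  - intros t Ht. apply cont_mult; [apply cont_Cexp_line|auto].
  - intros t Ht. apply laplace_integrand_bound. auto.
  - now exists l.
Qed.

Lemma laplace_holo k C b L s : (0 <= C)%R -> (Re s < b)%R ->
  (forall t, (0 <= t)%R -> cont RtoC k t) ->
  (forall t, (0 <= t)%R -> (Cmod (k t) <= C * exp (- (b * t)))%R) ->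
  (forall s, (Re s < b)%R -> is_rint (fun t => Cexp (s * RtoC t) * k t) (L s)) ->
  holo L s.
Proof.
  intros HC Hs Hk HB HL. set (c := (b - Re s)%R). assert (Hc : (0 < c)%R) by (unfold c; lra).
  assert (HB' : forall t, (0 <= t)%R ->
    (Cmod (Cexp (s * RtoC t) * k t) <= C * exp (- (c * t)))%R).
  { intros t Ht. apply laplace_integrand_bound. auto. }
  assert (C1 : forall s t, (0 <= t)%R -> cont RtoC (fun t => Cexp (s * RtoC t) * k t) t).
  { intros s' t Ht. apply cont_mult; auto. apply cont_Cexp_line. }
  (* The derivative is the transform of [t * k t]; the factor [t] uses up half of the decay rate. *)
  destruct (rint_ex (fun t => RtoC t * (Cexp (s * RtoC t) * k t)) (2 / c * C) (c / 2))
    as [L1 [HL1 _]]; [lra| | | |].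
  { apply Rmult_le_pos; auto. left. apply Rdiv_lt_0_compat; lra. }
  { intros t Ht. apply cont_mult; [apply cont_RtoC_id|auto]. }
  { intros t Ht. rewrite Cmod_mult, Cmod_RtoC, Rabs_pos_eq; auto.
    assert (E := exp_ineq1_le (c / 2 * t)). assert (P := exp_pos (- (c * t))).
    assert (Q : (t <= 2 / c * exp (c / 2 * t))%R).
    { replace t with (2 / c * (c / 2 * t))%R at 1 by (field; lra).
      apply Rmult_le_compat_l; [left; apply Rdiv_lt_0_compat|]; lra. }
    apply Rle_trans with (2 / c * exp (c / 2 * t) * (C * exp (- (c * t))))%R.
    - apply Rmult_le_compat; auto. apply Cmod_ge_0.
    - right. replace (- (c / 2 * t))%R with (c / 2 * t + - (c * t))%R by field.
      rewrite exp_plus. ring. }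
  exists L1. apply (der_of_quadratic L s L1 (128 * C / (c * c * c)) (c / 4)); [lra| |].
  { unfold Rdiv. repeat apply Rmult_le_pos; try lra. left. apply Rinv_0_lt_compat.
    repeat apply Rmult_lt_0_compat; auto. }
  intros h Hh.
  assert (Hsh : (Re (s + h) < b)%R).
  { rewrite re_plus. assert (Q := Re_le_Cmod h). unfold c in *. lra. }
  assert (I1 := HL _ Hsh). assert (I2 := HL _ Hs).
  apply le_epsilon. intros eps He.
  assert (Hm := Cmod_ge_0 h).
  destruct (I1 (eps / 4)%R) as [T1 [_ J1]]; [lra|].
  destruct (I2 (eps / 4)%R) as [T2 [_ J2]]; [lra|].
  destruct (HL1 (eps / 4 / (Cmod h + 1))%R) as [T3 [_ J3]];
    [apply div_succ_pos; lra|].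
  destruct (upper_bound4 0 T1 T2 T3) as (T & A0 & A1 & A2 & A3).
  specialize (J1 T ltac:(lra)). specialize (J2 T ltac:(lra)). specialize (J3 T ltac:(lra)).
  assert (R := laplace_remainder k C c s h T A0 HC Hc (fun t Ht => Hk t (proj1 Ht))
    (fun t Ht => HB' t (proj1 Ht)) Hh).
  set (X1 := CI (fun t => Cexp ((s + h) * RtoC t) * k t) 0 T) in *.
  set (X2 := CI (fun t => Cexp (s * RtoC t) * k t) 0 T) in *.
  set (X3 := CI (fun t => RtoC t * (Cexp (s * RtoC t) * k t)) 0 T) in *.
  replace (L (s + h) - L s - h * L1) with
    ((X1 - X2 - h * X3) + (- (X1 - L (s + h)) + ((X2 - L s) + h * (X3 - L1)))) by ring.
  eapply Rle_trans; [apply Cmod_triangle|].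
  eapply Rle_trans; [apply Rplus_le_compat_l, Cmod_triangle|].
  eapply Rle_trans; [apply Rplus_le_compat_l, Rplus_le_compat_l, Cmod_triangle|].
  rewrite Cmod_opp, Cmod_mult.
  assert (Q := mult_lt_div_succ _ _ _ Hm (Cmod_ge_0 _) J3).
  lra.
Qed.

(** * The Gamma integral and its reflection formula *)

Lemma exp_le_exp x y : (x <= y)%R -> (exp x <= exp y)%R.
Proof. intros [H| ->]; [left; now apply exp_increasing|lra]. Qed.

Lemma cont_reflect F t : cont RtoC F (- t)%R -> cont RtoC (fun t => F (- t)%R) t.
Proof.
  intros H eps He. destruct (H eps He) as [d [Hd K]]. exists d. split; [exact Hd|].
  intros y Hy. apply K. rewrite <- RtoC_minus in *. rewrite Cmod_RtoC in *.
  rewrite <- Rabs_Ropp. replace (- (- y - - t))%R with (y - t)%R by ring. exact Hy.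
Qed.

Lemma lint_ex F C b : (0 < b)%R -> (0 <= C)%R -> (forall t, cont RtoC F t) ->
  (forall t, (Cmod (F t) <= C * exp (- (b * Rabs t)))%R) ->
  exists l, is_lint F l /\ forall A B, (0 <= A)%R -> (0 <= B)%R ->
    (Cmod (CI F (- A) B - l) <= C / b * (exp (- (b * A)) + exp (- (b * B))))%R.
Proof.
  intros Hb HC Hc HF.
  destruct (rint_ex F C b Hb HC (fun t _ => Hc t)) as [l1 [H1 K1]].
  { intros t Ht. specialize (HF t). rewrite Rabs_pos_eq in HF; auto. }
  assert (Hc' := fun t => cont_reflect F t (Hc (- t)%R)).
  destruct (rint_ex (fun t => F (- t)%R) C b Hb HC (fun t _ => Hc' t)) as [l2 [H2 K2]].
  { intros t Ht. specialize (HF (- t)%R). rewrite Rabs_Ropp, Rabs_pos_eq in HF; auto. }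
  exists (l2 + l1). split; [now exists l1, l2|]. intros A B HA HB.
  rewrite (CI_Chasles F (- A) 0 B); try lra; [|intros t _; apply Hc].
  specialize (K1 B HB). specialize (K2 A HA).
  rewrite CI_reflect in K2; [|lra|intros t _; apply Hc].
  rewrite Cmod_minus_sym.
  replace (l2 + l1 - (CI F (- A) 0 + CI F 0 B)) with ((l2 - CI F (- A) 0) + (l1 - CI F 0 B)) by ring.
  eapply Rle_trans; [apply Cmod_triangle|]. lra.
Qed.

(** The weight [e^(-x)] at [x = exp t]; the Gamma integral is its two-sided Laplace transform. *)
Definition gamma_kernel (t : R) : C := RtoC (exp (- exp t)).

Lemma der_RtoC_fun (f : R -> R) t l : is_derive f t l -> der RtoC (fun t => RtoC (f t)) t (RtoC l).
Proof. intros H. apply der_pair; [exact H|]. apply (is_derive_const (0%R : R_NormedModule)). Qed.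

Lemma der_gamma_kernel t : der RtoC gamma_kernel t (- (RtoC (exp t) * gamma_kernel t)).
Proof.
  unfold gamma_kernel. rewrite <- RtoC_mult, <- RtoC_opp. apply der_RtoC_fun.
  auto_derive; auto. ring.
Qed.

Lemma cont_gamma_kernel t : cont RtoC gamma_kernel t.
Proof. eapply der_cont, der_gamma_kernel. Qed.

Lemma Cmod_gamma_kernel_le_1 t : (Cmod (gamma_kernel t) <= 1)%R.
Proof.
  unfold gamma_kernel. rewrite Cmod_RtoC, Rabs_pos_eq; [|left; apply exp_pos].
  rewrite <- exp_0. apply exp_le_exp. assert (P := exp_pos t). lra.
Qed.

(** From [t^2 / 4 <= exp t], and [b t - t^2 / 4 <= b^2] by completing the square. *)
Lemma Cmod_gamma_kernel_decay b t : (0 <= t)%R ->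
  (Cmod (gamma_kernel t) <= exp (b * b) * exp (- (b * t)))%R.
Proof.
  intros Ht. unfold gamma_kernel. rewrite Cmod_RtoC, Rabs_pos_eq; [|left; apply exp_pos].
  rewrite <- exp_plus. apply exp_le_exp. assert (Q := sqr_le_exp t Ht).
  assert (0 <= (b - t / 2) * (b - t / 2))%R by apply Rle_0_sqr. lra.
Qed.

Definition gamma_integrand (z : C) (t : R) : C := Cexp (z * RtoC t) * gamma_kernel t.

Lemma cont_gamma_integrand z t : cont RtoC (gamma_integrand z) t.
Proof. apply cont_mult; [apply cont_Cexp_line|apply cont_gamma_kernel]. Qed.

Lemma gamma_integrand_bound z b t : (0 < b <= Re z)%R ->
  (Cmod (gamma_integrand z t) <= exp ((Re z + b) * (Re z + b)) * exp (- (b * Rabs t)))%R.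
Proof.
  intros Hb. unfold gamma_integrand.
  destruct (Rle_dec 0 t) as [Ht|Ht].
  - rewrite Rabs_pos_eq; auto.
    assert (K := laplace_integrand_bound gamma_kernel _ (Re z + b) z t
      (Cmod_gamma_kernel_decay (Re z + b) t Ht)).
    replace (Re z + b - Re z)%R with b in K by ring. exact K.
  - rewrite Rabs_left; [|lra]. rewrite Cmod_mult, Cmod_Cexp, re_scal_r.
    assert (K := Cmod_gamma_kernel_le_1 t).
    apply Rle_trans with (exp (Re z * t) * 1)%R.
    + apply Rmult_le_compat_l; [left; apply exp_pos|exact K].
    + rewrite Rmult_1_r, <- exp_plus. apply exp_le_exp. nra.
Qed.

Lemma Rpow_C_exp t w : Rpow_C (exp t) w = Cexp (w * RtoC t).
Proof. unfold Rpow_C. now rewrite ln_exp. Qed.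

Lemma Gamma_integral_log z t :
  RtoC (exp t) * (RtoC (exp (- exp t)) * Rpow_C (exp t) (z - RtoC 1)) = gamma_integrand z t.
Proof.
  rewrite Rpow_C_exp. unfold gamma_integrand, gamma_kernel.
  replace ((z - 1) * RtoC t) with (z * RtoC t - RtoC t) by ring.
  rewrite Cexp_minus, Cexp_RtoC. field.
  apply RtoC_neq_0, Rgt_not_eq, exp_pos.
Qed.

(** The error bound for independent [A] and [B] is needed in [Gamma_product_beta], where the window
    of integration is off centre. *)
Lemma Gamma_integral_lint z : (0 < Re z)%R -> is_lint (gamma_integrand z) (Gamma_integral z) /\
  forall A B, (0 <= A)%R -> (0 <= B)%R ->
    (Cmod (CI (gamma_integrand z) (- A) B - Gamma_integral z) <=
      exp ((Re z + Re z) * (Re z + Re z)) / Re z * (exp (- (Re z * A)) + exp (- (Re z * B))))%R.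
Proof.
  intros Hz.
  destruct (lint_ex (gamma_integrand z) (exp ((Re z + Re z) * (Re z + Re z))) (Re z)) as [l [Hl K]]; auto.
  - left. apply exp_pos.
  - intros t. apply cont_gamma_integrand.
  - intros t. apply gamma_integrand_bound. lra.
  - assert (E : Gamma_integral z = l).
    { apply Cint_0_infty_log.
      - intros t. eapply cont_ext; [|apply cont_gamma_integrand].
        intros y. symmetry. apply Gamma_integral_log.
      - destruct Hl as [l1 [l2 [H1 [H2 E]]]]. exists l1, l2. split; [|split; [|exact E]].
        + intros eps He. destruct (H1 eps He) as [T0 [HT0 L]]. exists T0. split; [assumption|].
          intros T HT. rewrite (CI_ext _ (gamma_integrand z)); [auto|lra|].
          intros t _. apply Gamma_integral_log.
        + intros eps He. destruct (H2 eps He) as [T0 [HT0 L]]. exists T0. split; [assumption|].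
          intros T HT. rewrite (CI_ext _ (fun t => gamma_integrand z (- t)%R)); [auto|lra|].
          intros t _. apply Gamma_integral_log. }
    rewrite E. auto.
Qed.

(** The line is split at [0]. The right half is a Laplace transform that converges for every [s];
    the left half, reflected, is one in the variable [- s] and converges for [Re s > 0]. *)
Lemma holo_Gamma_integral z : (0 < Re z)%R -> holo Gamma_integral z.
Proof.
  intros Hz.
  assert (HR : forall s, exists l, is_rint (fun t => Cexp (s * RtoC t) * gamma_kernel t) l).
  { intros s. apply (laplace_ex gamma_kernel (exp ((Re s + 1) * (Re s + 1))) (Re s + 1)); try lra.
    - left. apply exp_pos.
    - intros. apply cont_gamma_kernel.
    - intros. now apply Cmod_gamma_kernel_decay. }
  assert (Hc : forall t, cont RtoC (fun t => gamma_kernel (- t)%R) t).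
  { intros t. unfold gamma_kernel. eapply der_cont. apply der_RtoC_fun. auto_derive; auto. }
  assert (HL : forall s, (Re s < 0)%R -> exists l,
    is_rint (fun t => Cexp (s * RtoC t) * gamma_kernel (- t)%R) l).
  { intros s Hs. apply (laplace_ex (fun t => gamma_kernel (- t)%R) 1 0); try lra; auto.
    intros t Ht. rewrite Rmult_0_l, Ropp_0, exp_0, Rmult_1_l. apply Cmod_gamma_kernel_le_1. }
  assert (HC : forall s, exists l, (0 < Re s)%R -> is_rint (fun t => Cexp (s * RtoC t) * gamma_kernel t) l /\
     is_rint (fun t => Cexp (- s * RtoC t) * gamma_kernel (- t)%R) (Gamma_integral s - l)).
  { intros s. destruct (Rlt_dec 0 (Re s)) as [Hs|Hs]; [|exists 0; lra].
    destruct (proj1 (Gamma_integral_lint s Hs)) as [l1 [l2 [H1 [H2 E]]]].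
    exists l1. intros _. split; auto. replace (Gamma_integral s - l1) with l2 by (rewrite E; ring).
    intros eps He. destruct (H2 eps He) as [T0 [HT0 L]]. exists T0. split; [assumption|].
    intros T HT. erewrite CI_ext; [apply L; auto|lra|]. intros t _.
    unfold gamma_integrand. rewrite RtoC_opp. do 2 f_equal. ring. }
  destruct (IndefiniteDescription.functional_choice _ HC) as [L1 HL1].
  assert (E : holo (fun s => L1 s + (Gamma_integral s - L1 s)) z).
  { apply (holo_plus L1 (fun s => Gamma_integral s - L1 s)).
    - assert (HX : exists f, forall s, is_rint (fun t => Cexp (s * RtoC t) * gamma_kernel t) (f s)).
      { destruct (IndefiniteDescription.functional_choice _ HR) as [f Hf]. now exists f. }
      destruct HX as [f Hf].
      apply holo_ext_near with f (Re z); auto.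
      + intros w Hw. assert (Hw' : (0 < Re w)%R).
        { assert (Q := re_le_Cmod (w - z)). replace (Re (w - z)) with (Re w - Re z)%R in Q
            by (destruct w, z; reflexivity).
          assert (Q' := Rabs_def2 _ _ (Rle_lt_trans _ _ _ Q Hw)). lra. }
        apply (is_rint_unique (fun t => Cexp (w * RtoC t) * gamma_kernel t)); [apply Hf|].
        apply (proj1 (HL1 w Hw')).
      + apply (laplace_holo gamma_kernel (exp ((Re z + 1) * (Re z + 1))) (Re z + 1)); try lra.
        * left. apply exp_pos.
        * intros. apply cont_gamma_kernel.
        * intros. now apply Cmod_gamma_kernel_decay.
        * auto.
    - apply (holo_ext (fun s => (fun u => Gamma_integral (- u) - L1 (- u)) (- s))).
      { intros w. now replace (- - w) with w by ring. }
      apply (holo_comp (fun u => Gamma_integral (- u) - L1 (- u)) (fun s => - s)).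
      { eexists. apply der_opp, (der_iota cid). }
      apply (laplace_holo (fun t => gamma_kernel (- t)%R) 1 0); try lra; auto.
      + rewrite re_opp. lra.
      + intros t Ht. rewrite Rmult_0_l, Ropp_0, exp_0, Rmult_1_l. apply Cmod_gamma_kernel_le_1.
      + intros s Hs. assert (Hs' : (0 < Re (- s))%R) by (rewrite re_opp; lra).
        destruct (HL1 (- s) Hs') as [_ K]. replace (- - s) with s in K by ring. exact K. }
  refine (holo_ext _ _ z _ E). intros w. cbv beta. ring.
Qed.

Lemma lin_exp_decay_small C b eps : (0 < b)%R -> (0 <= C)%R -> (0 < eps)%R ->
  exists T0, (0 <= T0)%R /\ forall T, (T0 <= T)%R -> (C * T * exp (- (b * T)) < eps)%R.
Proof.
  intros Hb P He.
  destruct (exp_decay_small (C * (2 / b)) (b / 2) eps) as [T0 [HT0 H]]; [lra| |auto|].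
  { apply Rmult_le_pos; auto. left. apply Rdiv_lt_0_compat; lra. }
  exists T0. split; [assumption|]. intros T HT. eapply Rle_lt_trans; [|apply (H T HT)].
  replace (- (b / 2 * T))%R with (b / 2 * T + - (b * T))%R by field. rewrite exp_plus.
  assert (E := exp_ineq1_le (b / 2 * T)). assert (Q := exp_pos (- (b * T))).
  replace (C * (2 / b) * (exp (b / 2 * T) * exp (- (b * T))))%R with
    (C * (2 / b * exp (b / 2 * T)) * exp (- (b * T)))%R by ring.
  apply Rmult_le_compat_r; [lra|]. apply Rmult_le_compat_l; auto.
  replace T with (2 / b * (b / 2 * T))%R at 1 by (field; lra).
  apply Rmult_le_compat_l; [left; apply Rdiv_lt_0_compat; lra|]. lra.
Qed.

(** Integration by parts: [gamma_integrand z] tends to [0] at both ends of the line, and its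
    derivative is [z * gamma_integrand z - gamma_integrand (z + 1)]. *)
Lemma Gamma_integral_succ z : (0 < Re z)%R -> Gamma_integral (z + 1) = z * Gamma_integral z.
Proof.
  intros Hz. assert (Hz1 : (0 < Re (z + 1))%R) by (rewrite re_plus; simpl; lra).
  apply C_eq_of_small. intros eps He.
  set (M := exp ((Re z + Re z) * (Re z + Re z))).
  assert (HM : (0 < M)%R) by apply exp_pos.
  destruct (is_lint_approx _ _ (cont_gamma_integrand _) (proj1 (Gamma_integral_lint _ Hz1)) (eps / 4)%R)
    as [T1 [HT1 K1]]; [lra|].
  destruct (is_lint_approx _ _ (cont_gamma_integrand _) (proj1 (Gamma_integral_lint _ Hz)) (eps / 4 / (Cmod z + 1))%R)
    as [T2 [HT2 K2]]; [apply div_succ_pos; [apply Cmod_ge_0|lra]|].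
  destruct (exp_decay_small M (Re z) (eps / 4)) as [T3 [HT3 K3]]; [lra|lra|lra|].
  destruct (upper_bound4 0 T1 T2 T3) as (T & A0 & A1 & A2 & A3).
  specialize (K1 T T ltac:(lra) ltac:(lra)). specialize (K2 T T ltac:(lra) ltac:(lra)).
  specialize (K3 T ltac:(lra)).
  assert (D : forall t, der RtoC (gamma_integrand z) t (z * gamma_integrand z t - gamma_integrand (z + 1) t)).
  { intros t. eapply der_eq.
    - apply der_mult; [|apply der_gamma_kernel]. apply der_Cexp_comp. apply der_scal, der_iota.
    - unfold gamma_integrand. cbv beta.
      rewrite Cmult_plus_distr_r, Cexp_plus, Cmult_1_l, Cexp_RtoC. ring. }
  assert (F : CI (fun t => z * gamma_integrand z t - gamma_integrand (z + 1) t) (- T) T =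
    gamma_integrand z T - gamma_integrand z (- T)).
  { apply CI_FTC; [lra|auto|]. intros t _.
    apply cont_minus; [apply cont_mult; [apply cont_const|]|]; apply cont_gamma_integrand. }
  rewrite CI_minus, CI_scal in F; try lra; try (intros t _); try apply cont_gamma_integrand.
  2:{ apply cont_mult; [apply cont_const|apply cont_gamma_integrand]. }
  assert (B1 := gamma_integrand_bound z (Re z) T ltac:(lra)).
  assert (B2 := gamma_integrand_bound z (Re z) (- T) ltac:(lra)).
  fold M in B1, B2. rewrite Rabs_Ropp, Rabs_pos_eq in B2; [|lra]. rewrite Rabs_pos_eq in B1; [|lra].
  set (X := CI (gamma_integrand z) (- T) T) in *.
  set (Y := CI (gamma_integrand (z + 1)) (- T) T) in *.
  replace (Gamma_integral (z + 1) - z * Gamma_integral z) with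
    (- (Y - Gamma_integral (z + 1)) + (z * (X - Gamma_integral z) - (z * X - Y))) by ring.
  rewrite F.
  eapply Rle_trans; [apply Cmod_triangle|]. rewrite Cmod_opp.
  eapply Rle_trans; [apply Rplus_le_compat_l, Cmod_minus_triangle|].
  eapply Rle_trans; [apply Rplus_le_compat_l, Rplus_le_compat_l, Cmod_minus_triangle|].
  rewrite Cmod_mult.
  assert (Q := mult_lt_div_succ _ _ _ (Cmod_ge_0 z) (Cmod_ge_0 _) K2).
  lra.
Qed.

Lemma rising_S_l z n : rising z (S n) = z * rising (z + 1) n.
Proof.
  induction n as [|n IH].
  - simpl. ring.
  - change (rising z (S n) * (z + RtoC (INR (S n))) =
      z * (rising (z + 1) n * (z + 1 + RtoC (INR n)))).
    rewrite IH, S_INR, RtoC_plus. ring.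
Qed.

Lemma Gamma_integral_rising z n : (0 < Re z)%R ->
  Gamma_integral (z + RtoC (INR n)) = rising z n * Gamma_integral z.
Proof.
  intros Hz. induction n as [|n IH].
  - simpl. rewrite Cplus_0_r. ring.
  - rewrite S_INR, RtoC_plus, Cplus_assoc, Gamma_integral_succ, IH.
    + simpl. ring.
    + rewrite re_plus. simpl. assert (Q := pos_INR n). lra.
Qed.

(** * The product of two Gamma integrals *)

Lemma CI_near_const f c a b eps : (a <= b)%R -> cont_on f a b ->
  (forall t, (a <= t <= b)%R -> (Cmod (f t - c) <= eps)%R) ->
  (Cmod (CI f a b - RtoC (b - a) * c) <= (b - a) * eps)%R.
Proof.
  intros Hab Hf H. rewrite <- CI_const.
  rewrite <- CI_minus; auto; [|intros t _; apply cont_const].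
  apply CI_bound; auto. intros t Ht. apply cont_minus; auto. apply cont_const.
Qed.

(** The difference of the two iterated integrals is additive under cuts, and near a point [p] both
    are the area times [H p] up to [eps] times the area. Continuity of the inner integrals is
    assumed, since in the application they are known explicitly. *)
Lemma CI_fubini (H : C -> C) X0 X1 Y0 Y1 : (X0 <= X1)%R -> (Y0 <= Y1)%R ->
  (forall z, in_box X0 X1 Y0 Y1 z -> cont cid H z) ->
  (forall y0 y1 t, (Y0 <= y0)%R -> (y0 <= y1)%R -> (y1 <= Y1)%R -> (X0 <= t <= X1)%R ->
     cont RtoC (fun x => CI (fun y => H (x, y)) y0 y1) t) ->
  (forall x0 x1 t, (X0 <= x0)%R -> (x0 <= x1)%R -> (x1 <= X1)%R -> (Y0 <= t <= Y1)%R ->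
     cont RtoC (fun y => CI (fun x => H (x, y)) x0 x1) t) ->
  CI (fun x => CI (fun y => H (x, y)) Y0 Y1) X0 X1 =
  CI (fun y => CI (fun x => H (x, y)) X0 X1) Y0 Y1.
Proof.
  intros HX HY HC Hxy Hyx.
  set (Phi := fun x0 x1 y0 y1 =>
    CI (fun x => CI (fun y => H (x, y)) y0 y1) x0 x1 -
    CI (fun y => CI (fun x => H (x, y)) x0 x1) y0 y1).
  assert (Chor : forall y, (Y0 <= y <= Y1)%R -> cont_on (fun x => H (x, y)) X0 X1).
  { intros y Hy t Ht. apply cont_horizontal, HC. now split. }
  assert (Cver : forall x, (X0 <= x <= X1)%R -> cont_on (fun y => H (x, y)) Y0 Y1).
  { intros x Hx t Ht. apply cont_vertical, HC. now split. }
  assert (Z : Phi X0 X1 Y0 Y1 = 0).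
  { apply additive_zero; auto.
    - intros x0 x1 y0 y1 x (S1 & S2 & S3 & S4 & S5 & S6) Hx. unfold Phi.
      rewrite (CI_Chasles (fun x => CI (fun y => H (x, y)) y0 y1) x0 x x1); try lra.
      2:{ intros t Ht. apply Hxy; lra. }
      rewrite (CI_ext (fun y => CI (fun x => H (x, y)) x0 x1)
        (fun y => CI (fun x => H (x, y)) x0 x + CI (fun x => H (x, y)) x x1)); auto.
      2:{ intros t Ht. apply CI_Chasles; try lra. eapply cont_on_sub; [| |apply Chor]; lra. }
      rewrite CI_plus; auto; [ring| |]; intros t Ht; apply Hyx; lra.
    - intros x0 x1 y0 y1 y (S1 & S2 & S3 & S4 & S5 & S6) Hy. unfold Phi.
      rewrite (CI_Chasles (fun y => CI (fun x => H (x, y)) x0 x1) y0 y y1); try lra.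
      2:{ intros t Ht. apply Hyx; lra. }
      rewrite (CI_ext (fun x => CI (fun y => H (x, y)) y0 y1)
        (fun x => CI (fun y => H (x, y)) y0 y + CI (fun y => H (x, y)) y y1)); auto.
      2:{ intros t Ht. apply CI_Chasles; try lra. eapply cont_on_sub; [| |apply Cver]; lra. }
      rewrite CI_plus; auto; [ring| |]; intros t Ht; apply Hxy; lra.
    - intros u v eps Hu Hv He. set (p := (u, v) : C).
      destruct (HC p (conj Hu Hv) eps He) as [d [Hd K]].
      exists (d / 2)%R. split; [lra|].
      intros x0 x1 y0 y1 (S1 & S2 & S3 & S4 & S5 & S6) Hux Hvy Hdx Hdy.
      assert (KB : forall x y, (x0 <= x <= x1)%R -> (y0 <= y <= y1)%R ->
        (Cmod (H (x, y) - H p) <= eps)%R).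
      { intros x y Hx Hy. left. apply K. unfold cid.
        eapply Rle_lt_trans; [apply Cmod_le_Re_Im|]. unfold p; simpl.
        assert (Rabs (x + - u) <= x1 - x0)%R by (apply Rabs_le; lra).
        assert (Rabs (y + - v) <= y1 - y0)%R by (apply Rabs_le; lra). lra. }
      unfold Phi.
      assert (I1 : (Cmod (CI (fun x => CI (fun y => H (x, y)) y0 y1) x0 x1 -
         RtoC (x1 - x0) * (RtoC (y1 - y0) * H p)) <= (x1 - x0) * ((y1 - y0) * eps))%R).
      { apply CI_near_const; auto.
        - intros t Ht. apply Hxy; lra.
        - intros t Ht. apply CI_near_const; auto.
          eapply cont_on_sub; [| |apply Cver]; lra. }
      assert (I2 : (Cmod (CI (fun y => CI (fun x => H (x, y)) x0 x1) y0 y1 -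
         RtoC (y1 - y0) * (RtoC (x1 - x0) * H p)) <= (y1 - y0) * ((x1 - x0) * eps))%R).
      { apply CI_near_const; auto.
        - intros t Ht. apply Hyx; lra.
        - intros t Ht. apply CI_near_const; auto.
          eapply cont_on_sub; [| |apply Chor]; lra. }
      eapply Rle_trans; [apply (Cmod_triangle3 _ (RtoC (x1 - x0) * (RtoC (y1 - y0) * H p)))|].
      rewrite (Cmod_minus_sym (RtoC (x1 - x0) * _)).
      replace (RtoC (x1 - x0) * (RtoC (y1 - y0) * H p)) with
        (RtoC (y1 - y0) * (RtoC (x1 - x0) * H p)) at 2 by ring.
      (* Twice the area is at most the square of the half-perimeter. *)
      assert (0 <= (x1 - x0) * (x1 - x0) + (y1 - y0) * (y1 - y0))%R by nra. nra. }
  unfold Phi in Z. now apply Ceq_minus.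
Qed.

Lemma cont_comp_R (f : R -> C) (phi : C -> R) z :
  cont RtoC f (phi z) -> cont cid (fun w => RtoC (phi w)) z -> cont cid (fun w => f (phi w)) z.
Proof.
  intros Hf Hp eps He. destruct (Hf eps He) as [d1 [Hd1 K1]].
  destruct (Hp d1 Hd1) as [d [Hd K]]. exists d. split; [exact Hd|].
  intros y Hy. apply K1, K, Hy.
Qed.

Lemma cont_Re z : cont cid (fun w => RtoC (Re w)) z.
Proof.
  intros eps He. exists eps. split; [exact He|]. intros y Hy.
  rewrite <- RtoC_minus, Cmod_RtoC. eapply Rle_lt_trans; [|exact Hy].
  replace (Re y - Re z)%R with (Re (cid y - cid z)) by (destruct y, z; reflexivity).
  apply re_le_Cmod.
Qed.

Lemma cont_Im z : cont cid (fun w => RtoC (Im w)) z.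
Proof.
  intros eps He. exists eps. split; [exact He|]. intros y Hy.
  rewrite <- RtoC_minus, Cmod_RtoC. eapply Rle_lt_trans; [|exact Hy].
  replace (Im y - Im z)%R with (Im (cid y - cid z)) by (destruct y, z; reflexivity).
  apply im_le_Cmod.
Qed.

Lemma CI_primitive_cont f a t : (forall t, cont RtoC f t) -> (a < t)%R ->
  cont RtoC (fun x => CI f a x) t.
Proof.
  intros Hf Hat eps He. destruct (Hf t 1%R Rlt_0_1) as [d [Hd K]].
  set (M := (Cmod (f t) + 1)%R). assert (HM : (0 < M)%R) by (unfold M; assert (Q := Cmod_ge_0 (f t)); lra).
  set (d2 := Rmin (Rmin d (t - a)) (eps / (2 * M))).
  assert (B1 := Rmin_l (Rmin d (t - a)) (eps / (2 * M))).
  assert (B2 := Rmin_r (Rmin d (t - a)) (eps / (2 * M))).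
  assert (B3 := Rmin_l d (t - a)). assert (B4 := Rmin_r d (t - a)). fold d2 in B1, B2.
  assert (HE : (0 < eps / (2 * M))%R) by (apply Rdiv_lt_0_compat; lra).
  exists d2. split; [unfold d2; repeat apply Rmin_pos; lra|].
  intros y Hy. rewrite <- RtoC_minus, Cmod_RtoC in Hy. apply Rabs_def2 in Hy.
  assert (KM : forall u, (Rabs (u - t) < d2)%R -> (Cmod (f u) <= M)%R).
  { intros u Hu. specialize (K u). rewrite <- RtoC_minus, Cmod_RtoC in K.
    assert (T := Cmod_sub_triangle (f u) (f t)). unfold M. specialize (K ltac:(lra)). lra. }
  assert (HL : (d2 * M < eps)%R).
  { apply Rle_lt_trans with (eps / (2 * M) * M)%R; [apply Rmult_le_compat_r; lra|].
    replace (eps / (2 * M) * M)%R with (eps / 2)%R by (field; lra). lra. }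
  destruct (Rle_dec t y) as [L|L].
  - rewrite (CI_Chasles f a t y); try lra; [|intros u _; apply Hf].
    replace (CI f a t + CI f t y - CI f a t) with (CI f t y) by ring.
    eapply Rle_lt_trans; [apply (CI_bound f t y M); auto; [intros u _; apply Hf|]|].
    + intros u Hu. apply KM. apply Rabs_def1; lra.
    + nra.
  - rewrite (CI_Chasles f a y t); try lra; [|intros u _; apply Hf].
    replace (CI f a y - (CI f a y + CI f y t)) with (- CI f y t) by ring. rewrite Cmod_opp.
    eapply Rle_lt_trans; [apply (CI_bound f y t M); auto; [lra|intros u _; apply Hf|]|].
    + intros u Hu. apply KM. apply Rabs_def1; lra.
    + nra.
Qed.

Lemma CI_primitive_cont_shift f a y t : (forall t, cont RtoC f t) -> (a < t + y)%R ->
  cont RtoC (fun x => CI f a (x + y)) t.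
Proof.
  intros Hf Hat eps He. destruct (CI_primitive_cont f a (t + y) Hf Hat eps He) as [d [Hd K]].
  exists d. split; [exact Hd|]. intros x Hx. apply K.
  replace (RtoC (x + y) - RtoC (t + y)) with (RtoC x - RtoC t); auto.
  rewrite !RtoC_plus. ring.
Qed.

Lemma CI_moving_window_cont f y0 y1 t : (forall t, cont RtoC f t) -> (y0 <= y1)%R ->
  cont RtoC (fun x => CI f (x + y0) (x + y1)) t.
Proof.
  intros Hf Hy. set (a := (t + y0 - 1)%R).
  apply cont_ext_near with (f := fun x => CI f a (x + y1) - CI f a (x + y0)) (d := 1%R).
  - lra.
  - intros x Hx. rewrite <- RtoC_minus, Cmod_RtoC in Hx. apply Rabs_def2 in Hx.
    rewrite (CI_Chasles f a (x + y0) (x + y1)); [ring| | |]; unfold a; try lra.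
    intros u _. apply Hf.
  - apply cont_minus; apply CI_primitive_cont_shift; auto; unfold a; lra.
Qed.

(** Euler's [x^(s-1) / (1 + x) dx] at [x = exp v]. *)
Definition beta_integrand (s : C) (v : R) : C := Cexp (s * RtoC v) / (1 + Cexp (RtoC v)).

Lemma one_plus_exp_neq_0 v : 1 + Cexp (RtoC v) <> 0.
Proof.
  rewrite Cexp_RtoC, <- RtoC_plus. apply RtoC_neq_0. assert (P := exp_pos v). lra.
Qed.

Lemma cont_Cexp_RtoC t : cont RtoC (fun v => Cexp (RtoC v)) t.
Proof. apply cont_Cexp, cont_RtoC_id. Qed.

Lemma cont_beta_integrand s t : cont RtoC (beta_integrand s) t.
Proof.
  apply cont_div; [apply one_plus_exp_neq_0|apply cont_Cexp_line|].
  apply cont_plus; [apply cont_const|apply cont_Cexp_RtoC].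
Qed.

Lemma Cmod_beta_integrand s v : Cmod (beta_integrand s v) = (exp (Re s * v) / (1 + exp v))%R.
Proof.
  unfold beta_integrand. rewrite Cmod_div; [|apply one_plus_exp_neq_0].
  rewrite Cmod_Cexp, re_scal_r, Cexp_RtoC, <- RtoC_plus, Cmod_RtoC, Rabs_pos_eq; auto.
  assert (P := exp_pos v). lra.
Qed.

Lemma beta_integrand_bound s b t : (0 < b <= Re s)%R -> (b <= 1 - Re s)%R ->
  (Cmod (beta_integrand s t) <= 1 * exp (- (b * Rabs t)))%R.
Proof.
  intros H1 H2. rewrite Cmod_beta_integrand, Rmult_1_l.
  assert (P := exp_pos t).
  apply Rmult_le_reg_r with (1 + exp t)%R; [lra|].
  unfold Rdiv. rewrite Rmult_assoc, Rinv_l, Rmult_1_r; [|lra].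
  assert (Q := exp_pos (- (b * Rabs t))).
  destruct (Rle_dec 0 t) as [Ht|Ht].
  - rewrite Rabs_pos_eq in *; auto.
    apply Rle_trans with (exp (- (b * t)) * exp t)%R.
    + rewrite <- exp_plus. apply exp_le_exp. nra.
    + apply Rmult_le_compat_l; lra.
  - rewrite Rabs_left in *; try lra.
    apply Rle_trans with (exp (- (b * - t)) * 1)%R.
    + rewrite Rmult_1_r. apply exp_le_exp. nra.
    + apply Rmult_le_compat_l; lra.
Qed.

(* In logarithmic coordinates, [Gamma s * Gamma (1 - s)] is the double integral of
   [e^((1-s) t - e^t) e^(s (t+v) - e^(t+v)) = e^(s v) e^(t - e^t (1 + e^v))]. *)
Lemma gamma_beta_fubini s A B : (0 <= A)%R -> (0 <= B)%R ->
  CI (fun t => gamma_integrand (1 - s) t * CI (gamma_integrand s) (t - B) (t + B)) (- A) A =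
  CI (fun v => beta_integrand s v *
    RtoC (exp (- (exp (- A) * (1 + exp v))) - exp (- (exp A * (1 + exp v))))) (- B) B.
Proof.
  intros HA HB.
  set (H := fun z : C => gamma_integrand (1 - s) (Re z) * gamma_integrand s (Re z + Im z)).
  assert (E1 : forall t y0 y1, (y0 <= y1)%R -> CI (fun y => H (t, y)) y0 y1 =
     gamma_integrand (1 - s) t * CI (gamma_integrand s) (t + y0) (t + y1)).
  { intros t y0 y1 Hy. unfold H; simpl.
    rewrite CI_scal; auto.
    - f_equal. rewrite (Rplus_comm t y0), (Rplus_comm t y1).
      rewrite <- CI_shift; auto; [|intros u _; apply cont_gamma_integrand].
      apply CI_ext; auto. intros u _. now rewrite Rplus_comm.
    - intros u _. apply (cont_vertical (fun z => gamma_integrand s (Re z + Im z)) t u).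
      apply (cont_comp_R (gamma_integrand s) (fun z => Re z + Im z)%R).
      + apply cont_gamma_integrand.
      + apply cont_ext with (fun w => RtoC (Re w) + RtoC (Im w)).
        { intros y. now rewrite RtoC_plus. }
        apply cont_plus; [apply cont_Re|apply cont_Im]. }
  assert (CH : forall z, cont cid H z).
  { intros z. apply cont_mult.
    - apply (cont_comp_R (gamma_integrand (1 - s)) Re); [apply cont_gamma_integrand|apply cont_Re].
    - apply (cont_comp_R (gamma_integrand s) (fun z => Re z + Im z)%R).
      + apply cont_gamma_integrand.
      + apply cont_ext with (fun w => RtoC (Re w) + RtoC (Im w)).
        { intros y. now rewrite RtoC_plus. }
        apply cont_plus; [apply cont_Re|apply cont_Im]. }
  assert (E2 : forall v x0 x1, (x0 <= x1)%R -> CI (fun x => H (x, v)) x0 x1 =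
     beta_integrand s v *
    RtoC (exp (- (exp x0 * (1 + exp v))) - exp (- (exp x1 * (1 + exp v))))).
  { intros v x0 x1 Hx. assert (P := exp_pos v).
    rewrite (CI_FTC (fun x => - (beta_integrand s v * RtoC (exp (- (exp x * (1 + exp v))))))); auto.
    - rewrite RtoC_minus. ring.
    - intros t _. eapply der_eq.
      + apply der_opp, der_scal.
        apply (der_RtoC_fun (fun x => exp (- (exp x * (1 + exp v)))%R) t
          (- (exp t * (1 + exp v)) * exp (- (exp t * (1 + exp v))))%R).
        auto_derive; auto. ring.
      + unfold H, beta_integrand, gamma_integrand, gamma_kernel; simpl.
        rewrite RtoC_plus, exp_plus.
        replace ((1 - s) * RtoC t) with (RtoC t - s * RtoC t) by ring.
        rewrite Cexp_minus, !Cmult_plus_distr_l, Cexp_plus, !Cexp_RtoC.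
        replace (- (exp t * (1 + exp v)))%R with (- exp t + - (exp t * exp v))%R by ring.
        rewrite exp_plus, !RtoC_mult.
        replace (RtoC (- exp t + - (exp t * exp v))) with (- (RtoC (exp t) * (1 + RtoC (exp v)))).
        2:{ rewrite RtoC_plus, !RtoC_opp, RtoC_mult. ring. }
        field. split.
        * apply Cexp_neq_0.
        * rewrite <- RtoC_plus. intros E. apply RtoC_inj in E. lra.
    - intros t _. apply cont_horizontal, CH. }
  transitivity (CI (fun t => CI (fun v => H (t, v)) (- B) B) (- A) A).
  { apply CI_ext; [lra|]. intros t _. rewrite E1; [|lra]. reflexivity. }
  rewrite CI_fubini; try lra; auto.
  - apply CI_ext; [lra|]. intros v _. apply E2. lra.
  - intros y0 y1 t Hy0 Hy Hy1 Ht.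
    apply cont_ext with (fun x => gamma_integrand (1 - s) x * CI (gamma_integrand s) (x + y0) (x + y1)).
    { intros x. now rewrite E1. }
    apply cont_mult; [apply cont_gamma_integrand|].
    apply CI_moving_window_cont; auto using cont_gamma_integrand.
  - intros x0 x1 t Hx0 Hx Hx1 Ht.
    apply cont_ext with (fun v => beta_integrand s v *
      RtoC (exp (- (exp x0 * (1 + exp v))) - exp (- (exp x1 * (1 + exp v))))).
    { intros v. now rewrite E2. }
    apply cont_mult; [apply cont_beta_integrand|].
    eapply der_cont. apply (der_RtoC_fun (fun v => (exp (- (exp x0 * (1 + exp v))) - exp (- (exp x1 * (1 + exp v)))))%R).
    auto_derive; auto.
Qed.

(** The double integral is truncated to the square of half-side [B], and each iterated form of it is
    compared with its limit. The errors are exponentially small in [B] up to the length [2 B] of the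
    interval. *)
Lemma Gamma_product_beta s : (0 < Re s < 1)%R ->
  is_lint (beta_integrand s) (Gamma_integral s * Gamma_integral (1 - s)).
Proof.
  intros Hs. set (b := Rmin (Re s) (1 - Re s)).
  assert (Hb1 : (b <= Re s)%R) by apply Rmin_l.
  assert (Hb2 : (b <= 1 - Re s)%R) by apply Rmin_r.
  assert (Hb : (0 < b)%R) by (apply Rmin_pos; lra).
  assert (Hs1 : Re (1 - s) = (1 - Re s)%R) by (destruct s; reflexivity).
  destruct (lint_ex (beta_integrand s) 1 b Hb ltac:(lra) (cont_beta_integrand s)) as [J [HJ KJ]].
  { intros t. apply beta_integrand_bound; lra. }
  replace (Gamma_integral s * Gamma_integral (1 - s)) with J; [exact HJ|].
  destruct (Gamma_integral_lint s ltac:(lra)) as [_ Ks].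
  destruct (Gamma_integral_lint (1 - s) ltac:(lra)) as [L1 _].
  set (Gs := Gamma_integral s) in *. set (G1 := Gamma_integral (1 - s)) in *.
  set (M := (exp ((Re s + Re s) * (Re s + Re s)) / Re s)%R) in *.
  assert (HM : (0 < M)%R) by (apply Rdiv_lt_0_compat; [apply exp_pos|lra]).
  set (M1 := exp ((Re (1 - s) + b) * (Re (1 - s) + b))).
  assert (HM1 : (0 < M1)%R) by apply exp_pos.
  apply C_eq_of_small. intros eps He.
  destruct (is_lint_approx _ _ (cont_gamma_integrand _) L1 (eps / 5 / (Cmod Gs + 1))%R) as [T1 [HT1 K1]];
    [apply div_succ_pos; [apply Cmod_ge_0|lra]|].
  destruct (is_lint_approx _ _ (cont_beta_integrand s) HJ (eps / 5)%R) as [T2 [HT2 K2]]; [lra|].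
  destruct (lin_exp_decay_small (4 * M1 * M) (b / 2) (eps / 5)) as [T3 [HT3 K3]]; [lra|nra|lra|].
  destruct (lin_exp_decay_small 4 b (eps / 5)) as [T4 [HT4 K4]]; [lra|lra|lra|].
  destruct (upper_bound4 T1 T2 T3 T4) as (B & A1 & A2 & A3 & A4).
  specialize (K1 B B ltac:(lra) ltac:(lra)). specialize (K2 B B ltac:(lra) ltac:(lra)).
  specialize (K3 B ltac:(lra)). specialize (K4 B ltac:(lra)).
  assert (F := gamma_beta_fubini s B B ltac:(lra) ltac:(lra)).
  set (X := CI (gamma_integrand (1 - s)) (- B) B) in *.
  set (Y := CI (beta_integrand s) (- B) B) in *.
  assert (CS : cont_on (fun t => CI (gamma_integrand s) (t - B) (t + B)) (- B) B).
  { intros t _. apply (CI_moving_window_cont _ (- B) B t (cont_gamma_integrand s)). lra. }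
  assert (CG : cont_on (gamma_integrand (1 - s)) (- B) B).
  { intros t _. apply cont_gamma_integrand. }
  (* The inner window misses more of the integral as [|t|] approaches [B]; the decay
     [exp (- (b * Rabs t))] of the outer factor makes up for it. *)
  assert (D1 : (Cmod (CI (fun t => gamma_integrand (1 - s) t * CI (gamma_integrand s) (t - B) (t + B))%C (- B) B
      - Gs * X) <= (B - - B) * (M1 * (2 * M * exp (- (b / 2 * B)))))%R).
  { unfold X. rewrite <- CI_scal, <- CI_minus; try lra; auto.
    - apply CI_bound; [lra| |].
      + intros t Ht. apply cont_minus; apply cont_mult; auto. apply cont_const.
      + intros t Ht.
        replace (gamma_integrand (1 - s) t * CI (gamma_integrand s) (t - B) (t + B) - Gs * gamma_integrand (1 - s) t)
          with (gamma_integrand (1 - s) t * (CI (gamma_integrand s) (t - B) (t + B) - Gs)) by ring.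
        rewrite Cmod_mult.
        assert (P1 := gamma_integrand_bound (1 - s) b t ltac:(lra)). fold M1 in P1.
        assert (P2 := Ks (B - t)%R (t + B)%R ltac:(lra) ltac:(lra)).
        replace (- (B - t))%R with (t - B)%R in P2 by ring.
        assert (Bt : (Rabs t <= B)%R) by (apply Rabs_le; lra).
        assert (Bt0 := Rabs_pos t).
        assert (Bt1 := Rle_abs t). assert (Bt2 := Rle_abs (- t)). rewrite Rabs_Ropp in Bt2.
        assert (Q1 : (exp (- (Re s * (B - t))) <= exp (b * Rabs t) * exp (- (b / 2 * B)))%R).
        { rewrite <- exp_plus. apply exp_le_exp.
          assert (b * (B - t) <= Re s * (B - t))%R by (apply Rmult_le_compat_r; lra).
          assert (b * t <= b * Rabs t)%R by (apply Rmult_le_compat_l; lra).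
          assert (0 <= b * B)%R by nra. lra. }
        assert (Q2 : (exp (- (Re s * (t + B))) <= exp (b * Rabs t) * exp (- (b / 2 * B)))%R).
        { rewrite <- exp_plus. apply exp_le_exp.
          assert (b * (t + B) <= Re s * (t + B))%R by (apply Rmult_le_compat_r; lra).
          assert (b * - t <= b * Rabs t)%R by (apply Rmult_le_compat_l; lra).
          assert (0 <= b * B)%R by nra. lra. }
        apply Rle_trans with ((M1 * exp (- (b * Rabs t))) *
          (M * (2 * (exp (b * Rabs t) * exp (- (b / 2 * B))))))%R.
        * apply Rmult_le_compat; try apply Cmod_ge_0; auto.
          eapply Rle_trans; [exact P2|]. apply Rmult_le_compat_l; lra.
        * right. replace (M1 * exp (- (b * Rabs t)) * (M * (2 * (exp (b * Rabs t) * exp (- (b / 2 * B))))))%R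
            with ((exp (- (b * Rabs t)) * exp (b * Rabs t)) * (M1 * (2 * M * exp (- (b / 2 * B)))))%R by ring.
          rewrite <- exp_plus. replace (- (b * Rabs t) + b * Rabs t)%R with 0%R by field.
          rewrite exp_0. ring.
    - intros t Ht. apply cont_mult; auto.
    - intros t Ht. apply cont_mult; auto. apply cont_const. }
  (* The extra factor differs from [1] by at most [2 * (exp (- B) * (1 + exp v))], and [1 + exp v]
     cancels the denominator of [beta_integrand]. *)
  assert (D2 : (Cmod (CI (fun v => beta_integrand s v *
      RtoC (exp (- (exp (- B) * (1 + exp v))) - exp (- (exp B * (1 + exp v)))))%C (- B) B - Y)
      <= (B - - B) * (2 * exp (- (b * B))))%R).
  { assert (CB : cont_on (fun v => beta_integrand s v *
      RtoC (exp (- (exp (- B) * (1 + exp v))) - exp (- (exp B * (1 + exp v))))) (- B) B).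
    { intros t _. apply cont_mult; [apply cont_beta_integrand|].
      eapply der_cont. apply (der_RtoC_fun (fun v => (exp (- (exp (- B) * (1 + exp v))) - exp (- (exp B * (1 + exp v)))))%R).
      auto_derive; auto. }
    assert (CB' : cont_on (beta_integrand s) (- B) B) by (intros t _; apply cont_beta_integrand).
    unfold Y. rewrite <- CI_minus; try lra; auto.
    apply CI_bound; [lra| |].
    - intros t Ht. apply cont_minus; auto.
    - intros v Hv.
      set (e1 := exp (- (exp (- B) * (1 + exp v)))). set (e2 := exp (- (exp B * (1 + exp v)))).
      replace (beta_integrand s v * RtoC (e1 - e2) - beta_integrand s v) with
        (- (beta_integrand s v * RtoC (1 - e1 + e2))).
      2:{ rewrite RtoC_plus, !RtoC_minus. ring. }
      rewrite Cmod_opp, Cmod_mult, Cmod_beta_integrand, Cmod_RtoC.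
      assert (Pv := exp_pos v). assert (PB := exp_pos (- B)). assert (PB' := exp_pos B).
      assert (R1 : (1 - exp (- B) * (1 + exp v) <= e1)%R).
      { unfold e1. assert (Q := exp_ineq1_le (- (exp (- B) * (1 + exp v)))). lra. }
      assert (R2 : (e1 <= 1)%R).
      { unfold e1. apply Rle_trans with (exp 0); [apply exp_le_exp|rewrite exp_0; lra].
        assert (0 < exp (- B) * (1 + exp v))%R by (apply Rmult_lt_0_compat; lra). lra. }
      assert (R3 : (e2 <= exp (- B))%R).
      { unfold e2. apply exp_le_exp. assert (Q := exp_ineq1_le B).
        assert (0 < exp B * exp v)%R by (apply Rmult_lt_0_compat; lra). lra. }
      assert (R4 : (0 < e2)%R) by apply exp_pos.
      rewrite Rabs_pos_eq; [|lra].
      apply Rle_trans with (exp (Re s * v) / (1 + exp v) * (2 * (exp (- B) * (1 + exp v))))%R.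
      + apply Rmult_le_compat_l; [left; apply Rdiv_lt_0_compat; [apply exp_pos|lra]|].
        assert (0 < exp (- B) * exp v)%R by (apply Rmult_lt_0_compat; lra). lra.
      + replace (exp (Re s * v) / (1 + exp v) * (2 * (exp (- B) * (1 + exp v))))%R with
          (2 * (exp (Re s * v) * exp (- B)))%R by (field; lra).
        rewrite <- exp_plus. apply Rmult_le_compat_l; [lra|]. apply exp_le_exp. nra. }
  rewrite F in D1.
  set (Z := CI (fun v => beta_integrand s v *
      RtoC (exp (- (exp (- B) * (1 + exp v))) - exp (- (exp B * (1 + exp v))))) (- B) B) in *.
  replace (J - Gs * G1) with ((- (Y - J)) + ((- (Z - Y)) + ((Z - Gs * X) + Gs * (X - G1)))) by ring.
  eapply Rle_trans; [apply Cmod_triangle|].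
  eapply Rle_trans; [apply Rplus_le_compat_l, Cmod_triangle|].
  eapply Rle_trans; [apply Rplus_le_compat_l, Rplus_le_compat_l, Cmod_triangle|].
  rewrite !Cmod_opp, Cmod_mult.
  assert (Q := mult_lt_div_succ _ _ _ (Cmod_ge_0 Gs) (Cmod_ge_0 _) K1).
  replace ((B - - B) * (M1 * (2 * M * exp (- (b / 2 * B)))))%R with
    (4 * M1 * M * B * exp (- (b / 2 * B)))%R in D1 by ring.
  replace ((B - - B) * (2 * exp (- (b * B))))%R with (4 * B * exp (- (b * B)))%R in D2 by ring.
  lra.
Qed.

(** * Keyhole contours in the logarithmic coordinate *)

Definition log_integrand (g : C -> C) (s w : C) : C := Cexp (s * w) * g (Cexp w).

(** Up to the factor [Ci], the integral of [z^(s-1) g(z) dz] over the circle of radius [exp c], with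
    arguments from [0] to [2 PI]. *)
Definition log_arc (g : C -> C) (s : C) (c : R) : C :=
  CI (fun y => log_integrand g s (c, y)) 0 (2 * PI).

Lemma holo_log_integrand g s w : holo g (Cexp w) -> holo (log_integrand g s) w.
Proof.
  intros H. apply (holo_mult (fun w => Cexp (s * w)) (fun w => g (Cexp w))).
  - apply (holo_comp Cexp (fun w => s * w)); [|apply holo_Cexp].
    apply (holo_mult (fun _ => s) (fun w => w)); [apply holo_const|apply holo_id].
  - apply holo_comp; [apply holo_Cexp|exact H].
Qed.

Lemma holo_log_line g s t : holo g (RtoC (exp t)) ->
  cont RtoC (fun t => log_integrand g s (RtoC t)) t.
Proof.
  intros H. apply (cont_horizontal (log_integrand g s) t 0%R).
  apply holo_cont, holo_log_integrand. rewrite <- Cexp_RtoC in H. exact H.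
Qed.

(* In the coordinate [w = ln z], the keyhole contour of [z^(s-1) g(z) dz] around the positive
   axis is the boundary of a rectangle of height [2 PI]. *)
Lemma rect_log_integrand g s a b : (a <= b)%R ->
  (forall t, (a <= t <= b)%R -> holo g (RtoC (exp t))) ->
  rect (log_integrand g s) a b 0 (2 * PI) =
    (1 - Cexp (2 * PI * Ci * s)) * CI (fun t => log_integrand g s (RtoC t)) a b +
    Ci * (log_arc g s b - log_arc g s a).
Proof.
  intros Hab Hg. unfold rect. fold (log_arc g s b) (log_arc g s a).
  assert (Hc : cont_on (fun t => log_integrand g s (RtoC t)) a b).
  { intros t Ht. apply holo_log_line. auto. }
  (* On the upper side [Cexp w] is the same as on the lower one, while [Cexp (s * w)] gains the
     monodromy factor of [z^s]. *)
  rewrite (CI_ext (fun x => log_integrand g s (x, (2 * PI)%R))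
    (fun x => Cexp (2 * PI * Ci * s) * log_integrand g s (RtoC x))); auto.
  - rewrite CI_scal; auto. change (fun x : R => log_integrand g s (x, 0%R))
      with (fun t => log_integrand g s (RtoC t)). ring.
  - intros t Ht. unfold log_integrand. rewrite Cexp_2PI.
    replace (s * (t, (2 * PI)%R)) with (2 * PI * Ci * s + s * RtoC t).
    + rewrite Cexp_plus. change (t, 0%R) with (RtoC t). ring.
    + apply C_ext; destruct s; simpl; ring.
Qed.

Lemma log_arc_bound g s c M : (0 <= M)%R ->
  (forall z, Cmod z = exp c -> holo g z) ->
  (forall z, Cmod z = exp c -> (Cmod (g z) <= M)%R) ->
  (Cmod (log_arc g s c) <= 2 * PI * exp (2 * PI * Rabs (Im s)) * M * exp (Re s * c))%R.
Proof.
  intros HM Hg HB. assert (Hpi := PI_RGT_0). unfold log_arc.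
  eapply Rle_trans.
  - apply (CI_bound _ 0 (2 * PI) (exp (Re s * c + 2 * PI * Rabs (Im s)) * M)); [lra| |].
    + intros t Ht. apply cont_vertical, holo_cont, holo_log_integrand, Hg. apply Cmod_Cexp_pair.
    + intros t Ht. unfold log_integrand. rewrite Cmod_mult, Cmod_Cexp.
      apply Rmult_le_compat; [left; apply exp_pos|apply Cmod_ge_0| |apply HB, Cmod_Cexp_pair].
      apply exp_le_exp. rewrite re_mult. simpl Re. simpl Im.
      assert (Rabs (Im s * t) <= Rabs (Im s) * (2 * PI))%R.
      { rewrite Rabs_mult. apply Rmult_le_compat_l; [apply Rabs_pos|].
        rewrite Rabs_pos_eq; lra. }
      assert (Q := Rle_abs (- (Im s * t))). rewrite Rabs_Ropp in Q. lra.
  - rewrite exp_plus. right. ring.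
Qed.

(** With Caratheodory's [h z = q z * (z - p)], the product [(z - p) * (f z / h z)] is [f z / q z],
    which is continuous at [p]. *)
Lemma residue_limit_quotient f h p l : cont cid f p -> der cid h p l -> h p = 0 -> l <> 0 ->
  residue_limit (fun z => f z / h z) p (f p / l).
Proof.
  intros Hf [q [Hq [Eq Cq]]] H0 Hl.
  assert (HC : cont cid (fun z => f z / q z) p).
  { apply cont_div; auto. now rewrite Eq. }
  intros eps He. destruct (HC eps He) as [d1 [Hd1 K1]].
  assert (Hm : (0 < Cmod l)%R) by now apply Cmod_gt_0.
  destruct (Cq (Cmod l) Hm) as [d2 [Hd2 K2]].
  exists (Rmin d1 d2). split; [now apply Rmin_pos|]. intros z Hz Hzd.
  left. specialize (K1 z (Rlt_le_trans _ _ _ Hzd (Rmin_l _ _))).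
  specialize (K2 z (Rlt_le_trans _ _ _ Hzd (Rmin_r _ _))).
  rewrite Eq in K1, K2.
  assert (Hqz : q z <> 0).
  { intros E. rewrite E in K2. replace (0 - l) with (- l) in K2 by ring.
    rewrite Cmod_opp in K2. lra. }
  assert (Ezh : h z = q z * (z - p)).
  { rewrite (Hq z), H0. unfold cid. ring. }
  rewrite Ezh.
  replace ((z - p) * (f z / (q z * (z - p))) - f p / l) with (f z / q z - f p / l); auto.
  field. repeat split; auto. now apply Cminus_eq_contra.
Qed.

Lemma Cmod_1 : Cmod 1 = 1%R.
Proof. rewrite Cmod_RtoC. apply Rabs_R1. Qed.

Lemma one_plus_neq_0 z : Cmod z <> 1%R -> 1 + z <> 0.
Proof.
  intros H E. apply H. replace z with (- (1 - (1 + z))) by ring. rewrite E, Cmod_opp.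
  replace (1 - 0) with (RtoC 1) by ring. apply Cmod_1.
Qed.

Lemma holo_inv_one_plus z : 1 + z <> 0 -> holo (fun z => / (1 + z)) z.
Proof.
  intros H. eexists. apply der_inv; auto.
  apply der_plus; [apply der_const|apply (der_iota cid)].
Qed.

Lemma cos_eq_m1 y : (0 <= y <= 2 * PI)%R -> cos y = (-1)%R -> y = PI.
Proof.
  intros Hy E. assert (Hpi := PI_RGT_0).
  assert (S : sin y = 0%R).
  { assert (Q := sin2_cos2 y). rewrite E in Q. unfold Rsqr in Q.
    apply Rsqr_0_uniq. unfold Rsqr. lra. }
  destruct (sin_eq_O_2PI_0 y) as [H|[H|H]]; try lra; rewrite H in E.
  - rewrite cos_0 in E. lra.
  - rewrite cos_2PI in E. lra.
Qed.

(** For [0 <= Im w <= 2 PI], [1 + Cexp w] vanishes only at [w = PI * Ci], where its derivative is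
    [-1]. *)
Lemma beta_rect s A B : (0 < A)%R -> (0 < B)%R ->
  rect (log_integrand (fun z => / (1 + z)) s) (- A) B 0 (2 * PI) =
  - (2 * PI * Ci * Cexp (PI * Ci * s)).
Proof.
  intros HA HB. assert (Hpi := PI_RGT_0).
  set (p := (0%R, PI) : C).
  assert (Hp : Cexp p = - (1)).
  { unfold p. rewrite Cexp_pair, exp_0, cos_PI, sin_PI. apply C_ext; simpl; ring. }
  rewrite (residue_rect (fun p => - Cexp (s * p)) (- A) B 0 (2 * PI) (p :: nil)); try lra.
  - simpl. replace (s * p) with (PI * Ci * s) by (apply C_ext; unfold p; destruct s; simpl; ring). ring.
  - constructor; [intros []|constructor].
  - intros q [<-|[]]. unfold strictly_in, p; simpl. lra.
  - intros z [Hz1 Hz2] Hz. apply holo_log_integrand, holo_inv_one_plus.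
    intros E. apply Hz. left. assert (E' : Cexp z = - (1)).
    { replace (Cexp z) with ((1 + Cexp z) - 1) by ring. rewrite E. ring. }
    assert (Hx : Re z = 0%R).
    { assert (Q := Cmod_Cexp z). rewrite E', Cmod_opp, Cmod_1 in Q.
      rewrite <- (ln_exp (Re z)), <- Q. apply ln_1. }
    assert (Hy : Im z = PI).
    { apply cos_eq_m1; auto. apply (f_equal Re) in E'. unfold Cexp in E'.
      rewrite Hx, exp_0 in E'. simpl in E'. lra. }
    apply C_ext; [now rewrite Hx|now rewrite Hy].
  - intros q [<-|[]].
    replace (- Cexp (s * p)) with (Cexp (s * p) / - (1)).
    + apply (residue_limit_quotient (fun w => Cexp (s * w)) (fun w => 1 + Cexp w) p).
      * apply cont_Cexp. apply cont_mult; [apply cont_const|apply (cont_iota cid)].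
      * eapply der_eq; [apply der_plus; [apply der_const|apply der_Cexp]|]. rewrite Hp. ring.
      * rewrite Hp. ring.
      * intros E. apply (f_equal Re) in E. simpl in E. lra.
    + field.
Qed.

(** The outer arc of the keyhole is of order [exp (- ((1 - Re s) * T))] and the inner one of order
    [exp (- (Re s * T))], so both vanish in the limit when [0 < Re s < 1]. *)
Lemma beta_reflection s J : (0 < Re s < 1)%R -> is_lint (beta_integrand s) J ->
  (1 - Cexp (2 * PI * Ci * s)) * J = - (2 * PI * Ci * Cexp (PI * Ci * s)).
Proof.
  intros Hs HJ. assert (Hpi := PI_RGT_0).
  set (c := 1 - Cexp (2 * PI * Ci * s)).
  set (K := (2 * PI * exp (2 * PI * Rabs (Im s)) * 2)%R).
  assert (HK : (0 < K)%R).
  { unfold K. assert (P := exp_pos (2 * PI * Rabs (Im s))).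
    apply Rmult_lt_0_compat; [|lra]. apply Rmult_lt_0_compat; lra. }
  apply C_eq_of_small. intros eps He.
  destruct (is_lint_approx _ _ (cont_beta_integrand s) HJ (eps / 3 / (Cmod c + 1))%R) as [T1 [HT1 K1]];
    [apply div_succ_pos; [apply Cmod_ge_0|lra]|].
  destruct (exp_decay_small K (Re s) (eps / 3)) as [T2 [HT2 K2]]; [lra|lra|lra|].
  destruct (exp_decay_small K (1 - Re s) (eps / 3)) as [T3 [HT3 K3]]; [lra|lra|lra|].
  (* [T >= 1] gives [exp T >= 2], which keeps both circles away from the pole at [-1]. *)
  destruct (upper_bound4 T1 1 T2 T3) as (T & A1 & A2 & A3 & A4).
  specialize (K1 T T ltac:(lra) ltac:(lra)). specialize (K2 T ltac:(lra)). specialize (K3 T ltac:(lra)).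
  assert (R1 := beta_rect s T T ltac:(lra) ltac:(lra)).
  rewrite rect_log_integrand in R1; [|lra|].
  2:{ intros t _. apply holo_inv_one_plus. rewrite <- Cexp_RtoC. apply one_plus_exp_neq_0. }
  change (CI (fun t => log_integrand (fun z => / (1 + z)) s (RtoC t)) (- T) T) with
    (CI (beta_integrand s) (- T) T) in R1.
  fold c in R1. set (X := CI (beta_integrand s) (- T) T) in *.
  assert (e2 : (2 <= exp T)%R) by (assert (Q := exp_ineq1_le T); lra).
  assert (e2' : (exp (- T) <= / 2)%R).
  { rewrite exp_Ropp. apply Rinv_le_contravar; lra. }
  assert (B1 : (Cmod (log_arc (fun z => / (1 + z))%C s T) <= K * exp (- ((1 - Re s) * T)))%R).
  { eapply Rle_trans.
    - apply (log_arc_bound _ s T (2 * exp (- T))); [assert (P := exp_pos (- T)); lra| |].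
      + intros z Hz. apply holo_inv_one_plus, one_plus_neq_0. lra.
      + intros z Hz. rewrite Cmod_inv; [|apply one_plus_neq_0; lra].
        assert (Q : (exp T / 2 <= Cmod (1 + z))%R).
        { assert (Q := Cmod_sub_triangle z (- (1))). rewrite Cmod_opp, Cmod_1 in Q.
          replace (z - - (1)) with (1 + z) in Q by ring. lra. }
        rewrite exp_Ropp. replace (2 * / exp T)%R with (/ (exp T / 2))%R by (field; lra).
        apply Rinv_le_contravar; lra.
    - unfold K. replace (- ((1 - Re s) * T))%R with (- T + Re s * T)%R by ring.
      rewrite exp_plus. right. ring. }
  assert (B2 : (Cmod (log_arc (fun z => / (1 + z))%C s (- T)) <= K * exp (- (Re s * T)))%R).
  { eapply Rle_trans.
    - apply (log_arc_bound _ s (- T) 2); [lra| |].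
      + intros z Hz. apply holo_inv_one_plus, one_plus_neq_0. lra.
      + intros z Hz. rewrite Cmod_inv; [|apply one_plus_neq_0; lra].
        assert (Q : (/ 2 <= Cmod (1 + z))%R).
        { assert (Q := Cmod_sub_triangle 1 (- z)). rewrite Cmod_opp, Cmod_1 in Q.
          replace (1 - - z) with (1 + z) in Q by ring. lra. }
        rewrite <- (Rinv_inv 2). apply Rinv_le_contravar; lra.
    - unfold K. replace (- (Re s * T))%R with (Re s * - T)%R by ring. lra. }
  rewrite <- R1.
  set (V1 := log_arc _ s T) in *. set (V2 := log_arc _ s (- T)) in *.
  replace (c * J - (c * X + Ci * (V1 - V2))) with (- (c * (X - J)) - Ci * (V1 - V2)) by ring.
  eapply Rle_trans; [apply Cmod_minus_triangle|]. rewrite Cmod_opp, !Cmod_mult, Cmod_Ci.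
  assert (V3 := Cmod_minus_triangle V1 V2).
  assert (Q := mult_lt_div_succ _ _ _ (Cmod_ge_0 c) (Cmod_ge_0 _) K1).
  lra.
Qed.

Theorem Gamma_integral_reflection s : (0 < Re s < 1)%R ->
  (1 - Cexp (2 * PI * Ci * s)) * (Gamma_integral s * Gamma_integral (1 - s)) =
  - (2 * PI * Ci * Cexp (PI * Ci * s)).
Proof. intros Hs. apply beta_reflection; auto. now apply Gamma_product_beta. Qed.

(** The right-hand side of the reflection formula has no zeros. In [zeta_right] this allows
    cancelling the Gamma factor. *)
Lemma Gamma_integral_neq_0 s : (0 < Re s < 1)%R -> Gamma_integral s <> 0.
Proof.
  intros Hs E. assert (K := Gamma_integral_reflection s Hs).
  rewrite E, Cmult_0_l, Cmult_0_r in K.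
  assert (Hpi := PI_RGT_0).
  apply (Cmult_neq_0 (2 * PI * Ci) (Cexp (PI * Ci * s))).
  - apply Cmult_neq_0; [|apply Ci_nz]. rewrite <- RtoC_mult. apply RtoC_neq_0. lra.
  - apply Cexp_neq_0.
  - replace (2 * PI * Ci * Cexp (PI * Ci * s)) with (- - (2 * PI * Ci * Cexp (PI * Ci * s))) by ring.
    rewrite <- K. ring.
Qed.

(** * The exponential remainder and its zeros *)

(** Indexed by the number of terms, so it is the Taylor polynomial of degree [n - 1];
    differentiation then lowers the index by one, down to [0]. *)
Fixpoint tpoly (n : nat) (z : C) : C :=
  match n with
  | O => 0
  | S m => tpoly m z + z ^ m / RtoC (INR (fact m))
  end.

Definition rem (n : nat) (z : C) : C := Cexp z - tpoly n z.

Lemma exp_taylor_tpoly n z : exp_taylor n z = tpoly (S n) z.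
Proof.
  induction n as [|n IH].
  - unfold exp_taylor. rewrite sum_O. simpl. ring.
  - unfold exp_taylor in *. rewrite sum_Sn, IH. reflexivity.
Qed.

Lemma exp_remainder_rem N z : (1 <= N)%nat -> exp_remainder N z = rem N z.
Proof.
  intros HN. unfold exp_remainder, rem. rewrite exp_taylor_tpoly.
  now replace (S (N - 1)) with N by lia.
Qed.

Lemma fact_pos n : (0 < INR (fact n))%R.
Proof. apply lt_0_INR, lt_O_fact. Qed.

Lemma RtoC_fact_neq_0 n : RtoC (INR (fact n)) <> 0.
Proof. apply RtoC_neq_0, Rgt_not_eq, fact_pos. Qed.

Lemma der_pow n z : der cid (fun z => z ^ S n) z (RtoC (INR (S n)) * z ^ n).
Proof.
  induction n as [|n IH].
  - apply der_ext with (fun z => z); [intros y; simpl; ring|].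
    eapply der_eq; [apply (der_iota cid)|]. simpl. ring.
  - eapply der_eq.
    + apply (der_mult cid (fun z => z) (fun z => z ^ S n)); [apply (der_iota cid)|apply IH].
    + rewrite (S_INR (S n)), RtoC_plus, !Cpow_S. ring.
Qed.

Lemma der_tpoly n z : der cid (tpoly (S n)) z (tpoly n z).
Proof.
  induction n as [|n IH].
  - apply der_ext with (fun _ => RtoC 1); [|apply der_const].
    intros y. simpl. field.
  - eapply der_eq.
    + apply (der_plus cid (tpoly (S n)) (fun z => z ^ S n / RtoC (INR (fact (S n))))); [exact IH|].
      apply (der_mult cid (fun z => z ^ S n)); [apply der_pow|apply der_const].
    + cbv beta. change (tpoly (S n) z) with (tpoly n z + z ^ n / RtoC (INR (fact n))).
      rewrite fact_simpl, mult_INR, RtoC_mult.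
      field. split; [apply RtoC_fact_neq_0|].
      apply RtoC_neq_0, not_0_INR. lia.
Qed.

Lemma der_rem n z : der cid (rem (S n)) z (rem n z).
Proof. apply der_minus; [apply der_Cexp|apply der_tpoly]. Qed.

Lemma holo_rem n z : holo (rem n) z.
Proof.
  destruct n; [|eexists; apply der_rem].
  apply (holo_ext Cexp); [|apply holo_Cexp]. intros w. unfold rem. simpl. ring.
Qed.

Lemma rem_succ n z : rem n z = z ^ n / RtoC (INR (fact n)) + rem (S n) z.
Proof. unfold rem. simpl tpoly. ring. Qed.

Lemma tpoly_0 n : tpoly (S n) 0 = 1.
Proof.
  induction n as [|n IH]; [simpl; field|].
  change (tpoly (S n) 0 + 0 ^ S n / RtoC (INR (fact (S n))) = 1).
  rewrite IH, Cpow_S, Cmult_0_l. unfold Cdiv. ring.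
Qed.

Lemma rem_0 n : rem (S n) 0 = 0.
Proof. unfold rem. rewrite tpoly_0, Cexp_0. ring. Qed.

Lemma der_segment (F : C -> C) F' a b t : der cid F (a + RtoC t * (b - a)) F' ->
  der RtoC (fun t => F (a + RtoC t * (b - a))) t ((b - a) * F').
Proof.
  intros H. eapply der_eq.
  - apply (der_comp RtoC F (fun t => a + RtoC t * (b - a))); [|exact H].
    apply der_plus; [apply der_const|]. apply der_mult; [apply der_iota|apply der_const].
  - cbv beta. ring.
Qed.

Lemma mean_value_inequality F F' a b M :
  (forall t, (0 <= t <= 1)%R -> der cid F (a + RtoC t * (b - a)) (F' (a + RtoC t * (b - a)))) ->
  (forall t, (0 <= t <= 1)%R -> cont cid F' (a + RtoC t * (b - a))) ->
  (forall t, (0 <= t <= 1)%R -> (Cmod (F' (a + RtoC t * (b - a))%C) <= M)%R) ->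
  (Cmod (F b - F a) <= M * Cmod (b - a))%R.
Proof.
  intros HF HC HM.
  assert (Hc : cont_on (fun t => (b - a) * F' (a + RtoC t * (b - a))) 0 1).
  { intros t Ht. apply cont_mult; [apply cont_const|].
    apply (cont_comp RtoC F' (fun t => a + RtoC t * (b - a))); auto.
    apply cont_plus; [apply cont_const|]. apply cont_mult; [apply cont_RtoC_id|apply cont_const]. }
  assert (E := CI_FTC (fun t => F (a + RtoC t * (b - a))) _ 0 1 Rle_0_1
    (fun t Ht => der_segment F _ a b t (HF t Ht)) Hc).
  cbv beta in E. rewrite Cmult_0_l, Cmult_1_l, Cplus_0_r in E.
  replace (a + (b - a)) with b in E by ring. rewrite <- E.
  eapply Rle_trans; [apply (CI_bound _ 0 1 (M * Cmod (b - a))); auto; try lra|lra].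
  intros t Ht. rewrite Cmod_mult, Rmult_comm. apply Rmult_le_compat_r; [apply Cmod_ge_0|auto].
Qed.

(** Induction: [rem (S n) z] is the integral of its derivative [rem n] along the segment from [0] to
    [z], and integrating [t ^ n] supplies the new factor of the factorial. *)
Lemma rem_bound n z : (Cmod (rem n z) <= Cmod z ^ n / INR (fact n) * exp (Cmod z))%R.
Proof.
  revert z. induction n as [|n IH]; intros z.
  - unfold rem. simpl. replace (Cexp z - 0) with (Cexp z) by ring. rewrite Cmod_Cexp.
    replace (1 / 1 * exp (Cmod z))%R with (exp (Cmod z)) by field.
    apply exp_le_exp, Re_le_Cmod.
  - assert (Hc : cont_on (fun t => (z - 0) * rem n (0 + RtoC t * (z - 0))) 0 1).
    { intros t Ht. apply cont_mult; [apply cont_const|].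
      apply (cont_comp RtoC (rem n) (fun t => 0 + RtoC t * (z - 0))); [|apply holo_cont, holo_rem].
      apply cont_plus; [apply cont_const|]. apply cont_mult; [apply cont_RtoC_id|apply cont_const]. }
    assert (E := CI_FTC (fun t => rem (S n) (0 + RtoC t * (z - 0))) _ 0 1 Rle_0_1
      (fun t Ht => der_segment (rem (S n)) _ 0 z t (der_rem n _)) Hc).
    cbv beta in E. replace (0 + 1 * (z - 0)) with z in E by ring.
    replace (0 + 0 * (z - 0)) with (RtoC 0) in E by ring. rewrite rem_0 in E.
    replace (rem (S n) z - 0) with (rem (S n) z) in E by ring. rewrite <- E.
    set (K := (Cmod z ^ S n / INR (fact (S n)) * exp (Cmod z))%R).
    assert (Hm := Cmod_ge_0 z).
    assert (B := CI_bound_prim _ (fun t => INR (S n) * t ^ n * K)%R (fun t => t ^ S n * K)%R 0 1 Rle_0_1 Hc).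
    assert (EK : (1 ^ S n * K - 0 ^ S n * K = K)%R) by (rewrite pow1, pow_i; [ring|lia]).
    eapply Rle_trans; [apply B|right; exact EK].
    + intros t Ht. replace (0 + RtoC t * (z - 0)) with (RtoC t * z) by ring.
      replace (z - 0) with z by ring. rewrite Cmod_mult.
      eapply Rle_trans; [apply Rmult_le_compat_l; [exact Hm|apply IH]|].
      rewrite Cmod_mult, Cmod_RtoC, Rabs_pos_eq, Rpow_mult_distr; [|lra].
      assert (Pf := fact_pos n).
      assert (PS : (0 < INR (S n))%R) by (apply lt_0_INR; lia).
      unfold K. rewrite fact_simpl, mult_INR.
      replace (INR (S n) * t ^ n * (Cmod z ^ S n / (INR (S n) * INR (fact n)) * exp (Cmod z)))%R
        with (Cmod z * (t ^ n * Cmod z ^ n / INR (fact n) * exp (Cmod z)))%R by (rewrite <- (tech_pow_Rmult (Cmod z)); field; lra).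
      apply Rmult_le_compat_l; auto. apply Rmult_le_compat_l.
      * unfold Rdiv. repeat apply Rmult_le_pos; try (apply pow_le; lra).
        left. now apply Rinv_0_lt_compat.
      * apply exp_le_exp. nra.
    + intros t Ht. auto_derive; auto. replace (Nat.pred (S n)) with n by reflexivity.
      change (match n with O => 1%R | S _ => (INR n + 1)%R end) with (INR (S n)). ring.
    + intros t Ht. apply (ex_derive_continuous (fun t => INR (S n) * t ^ n * K)%R).
      auto_derive; auto.
Qed.

(** The leading term [z^n / n!] dominates: the rest is at most [|z| e^|z| / (n + 1)] times as large,
    and [n + 1 >= 2]. The smallness condition holds for [|z| <= 1/e], which explains the inner
    radius of the keyhole. *)
Lemma rem_lower_small n z : (1 <= n)%nat -> (Cmod z * exp (Cmod z) <= 1)%R ->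
  (Cmod z ^ n / INR (fact n) / 2 <= Cmod (rem n z))%R.
Proof.
  intros Hn Hz. rewrite rem_succ.
  assert (B := rem_bound (S n) z). assert (Pf := fact_pos n). assert (Hm := Cmod_ge_0 z).
  assert (T := Cmod_sub_triangle (z ^ n / RtoC (INR (fact n))) (- rem (S n) z)).
  replace (z ^ n / RtoC (INR (fact n)) - - rem (S n) z) with
    (z ^ n / RtoC (INR (fact n)) + rem (S n) z) in T by ring.
  rewrite Cmod_opp, Cmod_div, Cmod_pow, Cmod_RtoC, Rabs_pos_eq in T;
    [|lra|apply RtoC_fact_neq_0].
  set (a := (Cmod z ^ n / INR (fact n))%R) in *.
  assert (Ha : (0 <= a)%R) by (apply Rdiv_le_0_compat; [apply pow_le|]; lra).
  assert (PS : (2 <= INR (S n))%R) by (apply (le_INR 2); lia).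
  replace (Cmod z ^ S n / INR (fact (S n)) * exp (Cmod z))%R with
    (a * (Cmod z * exp (Cmod z)) / INR (S n))%R in B.
  2:{ unfold a. rewrite fact_simpl, mult_INR. simpl pow. field. lra. }
  assert (a * (Cmod z * exp (Cmod z)) / INR (S n) <= a / 2)%R; [|lra].
  apply Rle_trans with (a / INR (S n))%R.
  - apply Rmult_le_compat_r; [left; apply Rinv_0_lt_compat; lra|].
    rewrite <- (Rmult_1_r a) at 2. now apply Rmult_le_compat_l.
  - apply Rmult_le_compat_l; auto. apply Rinv_le_contravar; lra.
Qed.

Lemma Cconj_RtoC x : Cconj (RtoC x) = RtoC x.
Proof. apply C_ext; simpl; ring. Qed.

Lemma tpoly_conj n z : tpoly n (Cconj z) = Cconj (tpoly n z).
Proof.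
  induction n as [|n IH]; simpl.
  - symmetry. apply Cconj_RtoC.
  - rewrite IH, Cplus_conj, Cdiv_conj, Cpow_conj, Cconj_RtoC; auto. apply RtoC_fact_neq_0.
Qed.

Lemma rem_conj n z : rem n (Cconj z) = Cconj (rem n z).
Proof. unfold rem. now rewrite tpoly_conj, Cexp_conj, Cminus_conj. Qed.

Fixpoint tpolyR (n : nat) (x : R) : R :=
  match n with
  | O => 0
  | S m => tpolyR m x + x ^ m / INR (fact m)
  end.

Lemma tpoly_RtoC n x : tpoly n (RtoC x) = RtoC (tpolyR n x).
Proof.
  induction n as [|n IH]; [reflexivity|].
  simpl. rewrite IH, RtoC_plus, RtoC_div, RtoC_pow; auto. assert (P := fact_pos n). lra.
Qed.

Definition remR (n : nat) (x : R) : R := (exp x - tpolyR n x)%R.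

Lemma rem_RtoC n x : rem n (RtoC x) = RtoC (remR n x).
Proof. unfold rem, remR. now rewrite tpoly_RtoC, Cexp_RtoC, RtoC_minus. Qed.

Lemma is_derive_remR n x : is_derive (remR (S n)) x (remR n x).
Proof.
  assert (K : is_derive (tpolyR (S n)) x (tpolyR n x)).
  { induction n as [|n IH].
    - simpl. apply is_derive_ext with (fun _ => 1%R); [intros; simpl; field|].
      apply (is_derive_const (1%R : R_NormedModule)).
    - assert (P := fact_pos n). assert (PS : (0 < INR (S n))%R) by (apply lt_0_INR; lia).
      assert (Ec : INR (fact (S n)) = (INR (S n) * INR (fact n))%R)
        by now rewrite fact_simpl, mult_INR.
      change (is_derive (fun x => tpolyR (S n) x + x ^ S n / INR (fact (S n)))%R x
        (tpolyR n x + x ^ n / INR (fact n))%R).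
      rewrite Ec. generalize dependent (INR (fact n)). intros c Pc _.
      apply (is_derive_plus (K := R_AbsRing) (V := R_NormedModule) (tpolyR (S n))
        (fun x => x ^ S n / (INR (S n) * c))%R); [exact IH|].
      apply is_derive_ext with (fun x => / (INR (S n) * c) * x ^ S n)%R; [intros y; apply Rmult_comm|].
      replace (x ^ n / c)%R with (/ (INR (S n) * c) * (INR (S n) * x ^ n))%R by (field; lra).
      apply is_derive_Reals, (derivable_pt_lim_scal (fun x => x ^ S n)%R).
      apply derivable_pt_lim_pow. }
  apply (is_derive_minus (K := R_AbsRing) (V := R_NormedModule)); [apply is_derive_exp|exact K].
Qed.

Lemma tpolyR_0 n : tpolyR (S n) 0 = 1%R.
Proof.
  induction n as [|n IH]; [simpl; field|].
  change (tpolyR (S n) 0 + 0 ^ S n / INR (fact (S n)) = 1)%R.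
  rewrite IH, pow_ne_zero; [|lia]. unfold Rdiv. ring.
Qed.

Lemma remR_MVT n x : exists c, (x <= c <= 0 \/ 0 <= c <= x)%R /\
  remR (S n) x = (remR n c * x)%R.
Proof.
  destruct (MVT_gen (remR (S n)) 0 x (remR n)) as [c [Hc E]].
  - intros y _. apply is_derive_remR.
  - intros y _. apply continuity_pt_filterlim.
    apply (ex_derive_continuous (remR (S n))). eexists. apply is_derive_remR.
  - exists c. split.
    + unfold Rmin, Rmax in Hc. destruct (Rle_dec 0 x); lra.
    + assert (Z : remR (S n) 0 = 0%R).
      { unfold remR. rewrite tpolyR_0, exp_0. ring. }
      rewrite Z in E. lra.
Qed.

Lemma remR_pos n x : (0 <= x)%R -> (0 <= remR n x)%R.
Proof.
  revert x. induction n as [|n IH]; intros x Hx.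
  - unfold remR. simpl. assert (P := exp_pos x). lra.
  - destruct (remR_MVT n x) as [c [Hc ->]]. apply Rmult_le_pos; auto. apply IH. lra.
Qed.

(** On the positive axis a single term of the remaining series is a lower bound. A term of high
    degree makes [zkernel] decay faster than any given power. *)
Lemma remR_lower n d x : (0 <= x)%R -> (x ^ (d + n) / INR (fact (d + n)) <= remR n x)%R.
Proof.
  revert n. induction d as [|d IH]; intros n Hx.
  - assert (P := remR_pos (S n) x Hx). unfold remR in *. simpl in *. lra.
  - assert (P := IH (S n) Hx). replace (d + S n)%nat with (S d + n)%nat in P by lia.
    assert (Q : (0 <= x ^ n / INR (fact n))%R).
    { apply Rdiv_le_0_compat; [now apply pow_le|apply fact_pos]. }
    unfold remR in *. simpl tpolyR in P. lra.
Qed.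

(** By the mean value theorem [remR (S n) x] is [x] times a value of [remR n] between [x] and [0],
    so each step flips the sign. *)
Lemma remR_sign_neg n x : (x < 0)%R -> (0 < (-1) ^ n * remR n x)%R.
Proof.
  revert x. induction n as [|n IH]; intros x Hx.
  - unfold remR. simpl. assert (P := exp_pos x). lra.
  - destruct (MVT_cor2 (remR (S n)) (remR n) x 0 Hx) as [c [E Hc]].
    { intros y _. apply is_derive_Reals, is_derive_remR. }
    assert (Z : remR (S n) 0 = 0%R).
    { unfold remR. rewrite tpolyR_0, exp_0. ring. }
    rewrite Z in E. assert (K := IH c ltac:(lra)).
    replace (remR (S n) x) with (remR n c * x)%R by lra.
    simpl. replace (-1 * (-1) ^ n * (remR n c * x))%R with (((-1) ^ n * remR n c) * - x)%R by ring.
    apply Rmult_lt_0_compat; lra.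
Qed.

(** Keeps the slit of the keyhole free of poles; the nonzero zeros form conjugate pairs off the real
    axis. *)
Lemma rem_real_neq_0 n z : Im z = 0%R -> z <> 0 -> rem n z <> 0.
Proof.
  intros Hi Hz. destruct z as [x y]. simpl in Hi. subst y.
  change (x, 0%R) with (RtoC x) in *. rewrite rem_RtoC. intros E. apply RtoC_inj in E.
  destruct (Rtotal_order x 0) as [H|[H|H]].
  - assert (K := remR_sign_neg n x H). rewrite E in K. lra.
  - subst. now apply Hz.
  - assert (K := remR_lower n 0 x ltac:(lra)). rewrite E in K. simpl in K.
    assert (0 < x ^ n / INR (fact n))%R by (apply Rdiv_lt_0_compat; [now apply pow_lt|apply fact_pos]).
    lra.
Qed.

Lemma rem_small_neq_0 n (z : C) : (1 <= n)%nat -> z <> 0 -> (Cmod z * exp (Cmod z) <= 1)%R -> rem n z <> 0.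
Proof.
  intros Hn Hz Hs E. assert (B := rem_lower_small n z Hn Hs). rewrite E, Cmod_0 in B.
  assert (0 < Cmod z ^ n / INR (fact n) / 2)%R; [|lra].
  apply Rdiv_lt_0_compat; [|lra]. apply Rdiv_lt_0_compat; [|apply fact_pos].
  apply pow_lt. now apply Cmod_gt_0.
Qed.

Lemma rem_pred_at_zero n z : rem (S n) z = 0 -> rem n z = z ^ n / RtoC (INR (fact n)).
Proof. intros E. rewrite rem_succ, E. ring. Qed.

(** At a zero [p <> 0] of [rem (S n)] the derivative is [rem n p = p^n / n!], which is not [0]; near
    the origin the leading term dominates. *)
Lemma rem_zero_isolated n p : (1 <= n)%nat -> exists d, (0 < d)%R /\
  forall z, z <> p -> (Cmod (z - p) < d)%R -> rem n z <> 0.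
Proof.
  intros Hn. destruct (Ceq_dec (rem n p) 0) as [E|E].
  - destruct (Ceq_dec p 0) as [->|Hp].
    + exists (/ 4)%R. split; [lra|]. intros z Hz Hzd. replace (z - 0) with z in Hzd by ring.
      apply rem_small_neq_0; auto.
      assert (Q := Cmod_ge_0 z). assert (P := exp_pos (Cmod z)).
      assert (exp (Cmod z) <= 3)%R.
      { eapply Rle_trans; [|apply exp_le_3]. apply exp_le_exp. lra. }
      nra.
    + destruct n as [|n]; [lia|].
      destruct (der_rem n p) as [q [Hq [Eq Cq]]].
      assert (Hl : rem n p <> 0).
      { rewrite rem_pred_at_zero; auto. unfold Cdiv. apply Cmult_neq_0; [now apply Cpow_nz|].
        intros K. apply C1_nz.
        rewrite <- (Cinv_r (RtoC (INR (fact n)))); [|apply RtoC_fact_neq_0].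
        rewrite K. ring. }
      assert (Hm : (0 < Cmod (rem n p))%R) by now apply Cmod_gt_0.
      destruct (Cq _ Hm) as [d [Hd K]]. exists d. split; auto. intros z Hz Hzd.
      rewrite (Hq z), E, Cplus_0_l. apply Cmult_neq_0; [|now apply Cminus_eq_contra].
      intros Z. specialize (K z Hzd). rewrite Z, Eq in K.
      replace (0 - rem n p) with (- rem n p) in K by ring. rewrite Cmod_opp in K. lra.
  - assert (Hm : (0 < Cmod (rem n p))%R) by now apply Cmod_gt_0.
    destruct (holo_cont _ _ (holo_rem n p) _ Hm) as [d [Hd K]].
    exists d. split; auto. intros z _ Hzd Z. specialize (K z Hzd). rewrite Z in K.
    replace (0 - rem n p) with (- rem n p) in K by ring. rewrite Cmod_opp in K. lra.
Qed.

(** * The remainder on large circles *)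

Lemma tpoly_bound n z : (1 <= Cmod z)%R ->
  (Cmod (tpoly n z) * Cmod z <= INR n * Cmod z ^ n)%R.
Proof.
  intros Hz. induction n as [|n IH].
  - simpl. rewrite Cmod_0. lra.
  - change (tpoly (S n) z) with (tpoly n z + z ^ n / RtoC (INR (fact n))).
    assert (Pf := fact_pos n). assert (Pf1 : (1 <= INR (fact n))%R).
    { apply (le_INR 1). apply lt_O_fact. }
    assert (Pz : (0 <= Cmod z ^ n)%R) by (apply pow_le; lra).
    assert (T := Cmod_triangle (tpoly n z) (z ^ n / RtoC (INR (fact n)))).
    rewrite Cmod_div, Cmod_pow, Cmod_RtoC, Rabs_pos_eq in T; [|lra|apply RtoC_fact_neq_0].
    assert (Q : (Cmod z ^ n / INR (fact n) <= Cmod z ^ n)%R).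
    { rewrite <- (Rmult_1_r (Cmod z ^ n)) at 2. apply Rmult_le_compat_l; auto.
      rewrite <- Rinv_1. apply Rinv_le_contravar; lra. }
    rewrite S_INR. simpl pow.
    assert (Pn := pos_INR n).
    assert (K1 : (Cmod (tpoly n z + z ^ n / RtoC (INR (fact n))) * Cmod z <=
      (Cmod (tpoly n z) + Cmod z ^ n) * Cmod z)%R) by (apply Rmult_le_compat_r; lra).
    assert (K2 : (INR n * Cmod z ^ n <= INR n * (Cmod z * Cmod z ^ n))%R).
    { apply Rmult_le_compat_l; auto. rewrite <- (Rmult_1_l (Cmod z ^ n)) at 1.
      apply Rmult_le_compat_r; lra. }
    lra.
Qed.

Lemma ln_le_sub1 x : (0 < x)%R -> (ln x <= x - 1)%R.
Proof. intros Hx. assert (Q := exp_ineq1_le (ln x)). rewrite exp_ln in Q; lra. Qed.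

(** A fourth root, because the square of a multiple of [ln R] is to be compared with [R]. *)
Lemma ln_le_root R : (1 <= R)%R -> (ln R <= 4 * sqrt (sqrt R))%R.
Proof.
  intros HR. set (q := sqrt (sqrt R)).
  assert (S1 : (1 <= sqrt R)%R) by (rewrite <- sqrt_1; apply sqrt_le_1_alt; lra).
  assert (S2 : (1 <= q)%R) by (unfold q; rewrite <- sqrt_1 at 1; apply sqrt_le_1_alt; lra).
  assert (E : R = (q * q * (q * q))%R).
  { unfold q. rewrite !sqrt_sqrt; lra. }
  rewrite E. rewrite !ln_mult; try nra. assert (Q := ln_le_sub1 q ltac:(lra)). lra.
Qed.

(* Bounds [|Re z|] at the points with [|z| = r] where [e^z] and [z^n / n!] have comparable size. *)
Definition log_size (n : nat) (r : R) : R := (Rabs (ln (r ^ n / INR (fact n))) + 1)%R.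

Lemma log_size_small n eta : (0 < eta)%R -> exists R0, (1 <= R0)%R /\ forall R, (R0 <= R)%R ->
  (log_size n R * log_size n R <= eta * R)%R.
Proof.
  intros He. set (c := (4 * INR n + Rabs (ln (INR (fact n))) + 1)%R).
  assert (Pn := pos_INR n). assert (Pl := Rabs_pos (ln (INR (fact n)))).
  assert (Hc : (1 <= c)%R) by (unfold c; lra).
  set (k := (c * c / eta)%R).
  assert (Hk : (0 < k)%R) by (unfold k; apply Rdiv_lt_0_compat; nra).
  exists (Rmax 1 (k * k)). split; [apply Rmax_l|]. intros R HR.
  assert (R1 : (1 <= R)%R) by (eapply Rle_trans; [apply Rmax_l|exact HR]).
  assert (R2 : (k * k <= R)%R) by (eapply Rle_trans; [apply Rmax_r|exact HR]).
  set (q := sqrt (sqrt R)).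
  assert (S1 : (1 <= sqrt R)%R) by (rewrite <- sqrt_1; apply sqrt_le_1_alt; lra).
  assert (S2 : (1 <= q)%R) by (unfold q; rewrite <- sqrt_1 at 1; apply sqrt_le_1_alt; lra).
  assert (Eq : (q * q = sqrt R)%R) by (unfold q; apply sqrt_sqrt; lra).
  assert (Pf := fact_pos n).
  assert (B : (log_size n R <= c * q)%R).
  { unfold log_size. rewrite ln_div; [|apply pow_lt; lra|exact Pf].
    rewrite ln_pow; [|lra].
    assert (T := Rabs_triang (INR n * ln R) (- ln (INR (fact n)))). rewrite Rabs_Ropp in T.
    assert (L := ln_le_root R R1). fold q in L.
    assert (L0 : (0 <= ln R)%R) by (rewrite <- ln_1; destruct R1 as [R1| <-]; [left; apply ln_increasing|]; lra).
    rewrite (Rabs_pos_eq (INR n * ln R)) in T; [|now apply Rmult_le_pos].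
    assert (INR n * ln R <= INR n * (4 * q))%R by (apply Rmult_le_compat_l; lra).
    unfold c. unfold Rminus. nra. }
  assert (B0 : (0 <= log_size n R)%R).
  { unfold log_size. assert (Q := Rabs_pos (ln (R ^ n / INR (fact n)))). lra. }
  assert (K : (k <= sqrt R)%R).
  { rewrite <- (sqrt_square k); [|lra]. apply sqrt_le_1_alt. exact R2. }
  assert (E : (sqrt R * sqrt R = R)%R) by (apply sqrt_sqrt; lra).
  apply Rle_trans with (c * c * sqrt R)%R.
  - rewrite <- Eq. replace (c * c * (q * q))%R with (c * q * (c * q))%R by ring.
    apply Rmult_le_compat; auto.
  - replace (c * c)%R with (eta * k)%R by (unfold k; field; lra).
    rewrite <- E at 2. rewrite Rmult_assoc. apply Rmult_le_compat_l; [lra|].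
    apply Rmult_le_compat_r; lra.
Qed.

Lemma log_size_ge_1 n R : (1 <= log_size n R)%R.
Proof. unfold log_size. assert (Q := Rabs_pos (ln (R ^ n / INR (fact n)))). lra. Qed.

Lemma exp_le_inv x y : (exp x <= exp y)%R -> (x <= y)%R.
Proof. intros H. apply Rnot_lt_le. intros K. apply exp_increasing in K. lra. Qed.

Lemma exp_1_ge_2 : (2 <= exp 1)%R.
Proof. assert (Q := exp_ineq1_le 1). lra. Qed.

Lemma tpoly_relative n z e : (0 < e)%R -> (1 <= Cmod z)%R ->
  (INR n * INR (fact n) / e <= Cmod z)%R ->
  (Cmod (tpoly n z) <= e * (Cmod z ^ n / INR (fact n)))%R.
Proof.
  intros He H1 Hz. assert (B := tpoly_bound n z H1). assert (Pf := fact_pos n).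
  assert (Pz : (0 < Cmod z ^ n)%R) by (apply pow_lt; lra).
  apply Rmult_le_reg_r with (Cmod z); [lra|].
  eapply Rle_trans; [exact B|].
  replace (INR n * Cmod z ^ n)%R with
    (e * (Cmod z ^ n / INR (fact n)) * (INR n * INR (fact n) / e))%R by (field; lra).
  apply Rmult_le_compat_l; auto. apply Rmult_le_pos; [lra|].
  left. apply Rdiv_lt_0_compat; auto.
Qed.

Lemma rem_S_split n z : rem (S n) z = Cexp z - (z ^ n / RtoC (INR (fact n)) + tpoly n z).
Proof. unfold rem. simpl. ring. Qed.

Lemma Cmod_monomial n z : Cmod (z ^ n / RtoC (INR (fact n))) = (Cmod z ^ n / INR (fact n))%R.
Proof.
  rewrite Cmod_div, Cmod_pow, Cmod_RtoC, Rabs_pos_eq; auto.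
  - left. apply fact_pos.
  - apply RtoC_fact_neq_0.
Qed.

Lemma monomial_pos n R : (1 <= R)%R -> (0 < R ^ n / INR (fact n))%R.
Proof. intros H. apply Rdiv_lt_0_compat; [apply pow_lt; lra|apply fact_pos]. Qed.

(** With [a = |z|^n / n!], the lower terms contribute at most [a / 8] and the remainder at most
    [a / 4], so [|e^z|] lies between [a / 2] and [2 a] and [Re z] is within [1] of [ln a]. *)
Lemma near_zero_Re n z : (1 <= Cmod z)%R ->
  (INR n * INR (fact n) / (1 / 8) <= Cmod z)%R ->
  (Cmod (rem (S n) z) <= Cmod z ^ n / INR (fact n) / 4)%R ->
  (Rabs (Re z) <= log_size n (Cmod z))%R.
Proof.
  intros H1 H2 H3. set (a := (Cmod z ^ n / INR (fact n))%R) in *.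
  assert (Ha : (0 < a)%R) by now apply monomial_pos.
  assert (B := tpoly_relative n z (1 / 8) ltac:(lra) H1 H2). fold a in B.
  assert (Em := Cmod_monomial n z). fold a in Em.
  set (T := z ^ n / RtoC (INR (fact n))) in *.
  rewrite rem_S_split in H3. fold T in H3.
  assert (T1 := Cmod_triangle T (tpoly n z)).
  assert (T2 := Cmod_sub_triangle T (- tpoly n z)).
  replace (T - - tpoly n z) with (T + tpoly n z) in T2 by ring. rewrite Cmod_opp in T2.
  assert (T3 := Cmod_sub_triangle (Cexp z) (T + tpoly n z)).
  assert (T4 := Cmod_sub_triangle (T + tpoly n z) (Cexp z)). rewrite Cmod_minus_sym in T4.
  rewrite Cmod_Cexp in *. rewrite Em in *.
  assert (E2 := exp_1_ge_2).
  unfold log_size. fold a.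
  assert (U : (Re z <= ln a + 1)%R).
  { apply exp_le_inv. rewrite exp_plus, exp_ln; auto. nra. }
  assert (L : (ln a - 1 <= Re z)%R).
  { apply exp_le_inv. unfold Rminus. rewrite exp_plus, exp_ln, exp_Ropp; auto.
    assert (/ exp 1 <= / 2)%R by (apply Rinv_le_contravar; lra). nra. }
  assert (Q1 := Rle_abs (ln a)). assert (Q2 := Rle_abs (- ln a)). rewrite Rabs_Ropp in Q2.
  apply Rabs_le. lra.
Qed.

(* On the circle of this radius, [e^z] and [z^n / n!] have nearly opposite arguments wherever
   their sizes are comparable, so their difference does not get small. *)
Definition circle_radius (n m : nat) : R := (2 * PI * INR m + INR n * (PI / 2) + PI)%R.

Lemma Cexp_circle_radius n m : Cexp (Ci * RtoC (circle_radius n m)) = - (Ci ^ n).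
Proof.
  unfold circle_radius.
  replace (Ci * RtoC (2 * PI * INR m + INR n * (PI / 2) + PI)) with
    (RtoC (INR m) * (Ci * RtoC (2 * PI)) + RtoC (INR n) * (Ci * RtoC (PI / 2)) + Ci * RtoC PI).
  2:{ rewrite !RtoC_plus, !RtoC_mult. ring. }
  rewrite !Cexp_plus, !Cexp_nat_mult, !Cexp_Ci, cos_2PI, sin_2PI, cos_PI2, sin_PI2, cos_PI, sin_PI.
  change (1%R, 0%R) with (RtoC 1). rewrite Cpow_1_l.
  change (0%R, 1%R) with Ci. replace ((-1)%R, 0%R) with (- (1)) by (apply C_ext; simpl; ring). ring.
Qed.

Lemma Rle_sqr_Re R x y : (R * R = x * x + y * y)%R -> (0 < R)%R -> (0 <= y)%R ->
  (y <= R /\ (R - y) * R <= x * x)%R.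
Proof. intros E HR Hy. split; nra. Qed.

(** By contradiction. If the remainder is small, [|x|] is at most [log_size], whose square is small
    against [r]; since [(r - y) * r <= x * x], even the absolute difference [r - y] is small. Hence
    not only [z^n] but also [e^z], whose direction depends on [y] modulo [2 PI], points almost as at
    [z = i r], and the two terms reinforce each other in the difference. *)
Lemma circle_bound_upper n : exists R0, (1 <= R0)%R /\ forall m z, (R0 <= circle_radius n m)%R ->
  Cmod z = circle_radius n m -> (0 <= Im z)%R ->
  (Cmod z ^ n / INR (fact n) / 4 <= Cmod (rem (S n) z))%R.
Proof.
  assert (Cp : cont cid (fun u => u ^ n) 1) by apply holo_cont, holo_pow.
  destruct (Cp (/ 4)%R ltac:(lra)) as [k [Hk Kp]]. rewrite Cpow_1_l in Kp.
  (* [/ 8] keeps [e^(i (y - r))] within [1 / 2] of [1]; [k / 4] keeps [z / (i r)] within [k] of [1],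
     where its [n]-th power is within [1 / 4] of [1]. *)
  set (eta := Rmin (/ 8) (k / 4)).
  assert (He1 : (eta <= / 8)%R) by apply Rmin_l. assert (He2 : (eta <= k / 4)%R) by apply Rmin_r.
  assert (He : (0 < eta)%R) by (apply Rmin_pos; lra). clearbody eta.
  destruct (log_size_small n eta He) as [R1 [HR1 KR1]].
  exists (Rmax R1 (INR n * INR (fact n) / (1 / 8))).
  assert (M1 := Rmax_l R1 (INR n * INR (fact n) / (1 / 8))).
  assert (M2 := Rmax_r R1 (INR n * INR (fact n) / (1 / 8))).
  split; [lra|]. intros m z HR Hz Hy. apply Rnot_lt_le. intros Hlt.
  assert (Hre := near_zero_Re n z ltac:(lra) ltac:(lra) ltac:(lra)).
  assert (HX := KR1 (Cmod z) ltac:(lra)). assert (HX1 := log_size_ge_1 n (Cmod z)).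
  assert (Hs := Cmod_sqr z).
  assert (B := tpoly_relative n z (1 / 8) ltac:(lra) ltac:(lra) ltac:(lra)).
  rewrite rem_S_split in Hlt.
  set (r := circle_radius n m) in *. rewrite Hz in *.
  set (X := log_size n r) in *. set (a := (r ^ n / INR (fact n))%R) in *.
  assert (Ha : (0 < a)%R) by (apply monomial_pos; lra).
  set (x := Re z) in *. set (y := Im z) in *.
  assert (Hr : (1 <= r)%R) by lra.
  assert (Hxx : (x * x <= eta * r)%R).
  { assert (Q : (Rabs x * Rabs x <= X * X)%R) by (apply Rmult_le_compat; try apply Rabs_pos; auto).
    rewrite <- Rabs_mult, Rabs_pos_eq in Q; [lra|apply Rle_0_sqr]. }
  assert (Hxr : (Rabs x <= eta * r)%R) by nra.
  destruct (Rle_sqr_Re r x y) as [Hyr Hyx]; [simpl in Hs; lra|lra|auto|].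
  assert (Hye : (r - y <= eta)%R).
  { apply Rmult_le_reg_r with r; lra. }
  assert (Hrn : Ci * RtoC r <> 0).
  { apply Cmult_neq_0; [apply Ci_nz|]. apply RtoC_neq_0. lra. }
  set (u := z / (Ci * RtoC r)).
  assert (Hu : (Cmod (u - 1) < k)%R).
  { replace (u - 1) with ((RtoC x + Ci * RtoC (y - r)) / (Ci * RtoC r)).
    - rewrite Cmod_div, Cmod_mult, Cmod_Ci, Cmod_RtoC, Rabs_pos_eq; auto; [|lra].
      assert (T := Cmod_triangle (RtoC x) (Ci * RtoC (y - r))).
      rewrite Cmod_mult, Cmod_Ci, !Cmod_RtoC in T.
      assert (Rabs (y - r) <= eta)%R by (apply Rabs_le; lra).
      apply Rmult_lt_reg_r with r; [lra|].
      replace (Cmod (RtoC x + Ci * RtoC (y - r)) / (1 * r) * r)%R with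
        (Cmod (RtoC x + Ci * RtoC (y - r))) by (field; lra). nra.
    - unfold u. replace z with (RtoC x + Ci * RtoC y).
      + rewrite RtoC_minus. field. split; [|apply Ci_nz]. apply RtoC_neq_0. lra.
      + unfold x, y. apply C_ext; simpl; ring. }
  specialize (Kp u Hu).
  set (v := Cexp (Ci * RtoC (y - r))).
  assert (Hv : (Cmod (v - 1) <= / 2)%R).
  { unfold v. eapply Rle_trans; [apply Cexp_minus_1_bound|].
    rewrite Cmod_mult, Cmod_Ci, Cmod_RtoC, Rmult_1_l.
    assert (Q : (Rabs (y - r) <= / 8)%R) by (apply Rabs_le; lra).
    assert (Q0 := Rabs_pos (y - r)).
    assert (exp (Rabs (y - r)) <= 3)%R.
    { eapply Rle_trans; [|apply exp_le_3]. apply exp_le_exp. lra. }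
    assert (P := exp_pos (Rabs (y - r))). nra. }
  assert (Ez : Cexp z = - (Ci ^ n) * (RtoC (exp x) * v)).
  { replace z with (RtoC x + (Ci * RtoC r + Ci * RtoC (y - r))).
    - rewrite !Cexp_plus, Cexp_RtoC. unfold r at 1. rewrite Cexp_circle_radius. unfold v. ring.
    - unfold x, y. rewrite RtoC_minus. apply C_ext; simpl; ring. }
  assert (Et : z ^ n / RtoC (INR (fact n)) = Ci ^ n * (RtoC a * u ^ n)).
  { unfold a. rewrite RtoC_div; [|assert (P := fact_pos n); lra]. rewrite RtoC_pow.
    replace (z ^ n) with ((Ci * RtoC r * u) ^ n).
    - rewrite !Cpow_mult_l. field. apply RtoC_fact_neq_0.
    - f_equal. unfold u. field. split; [|apply Ci_nz]. apply RtoC_neq_0. lra. }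
  rewrite Ez, Et in Hlt.
  set (p := tpoly n z) in *.
  assert (HCi : Cmod (Ci ^ n) = 1%R) by (rewrite Cmod_pow, Cmod_Ci, pow1; reflexivity).
  assert (Ex := exp_pos x).
  (* The main term has modulus [exp x + a]; the three errors are at most [exp x / 2], [a / 4] and
     [a / 8]. *)
  replace (- Ci ^ n * (RtoC (exp x) * v) - (Ci ^ n * (RtoC a * u ^ n) + p)) with
    (- (Ci ^ n * RtoC (exp x + a) + (Ci ^ n * (RtoC (exp x) * (v - 1)) + (Ci ^ n * (RtoC a * (u ^ n - 1)) + p)))) in Hlt.
  2:{ rewrite RtoC_plus. ring. }
  rewrite Cmod_opp in Hlt.
  assert (T1 := Cmod_sub_triangle (Ci ^ n * RtoC (exp x + a))
    (- (Ci ^ n * (RtoC (exp x) * (v - 1)) + (Ci ^ n * (RtoC a * (u ^ n - 1)) + p)))).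
  match type of T1 with (_ <= Cmod (?P - - ?Q))%R => replace (P - - Q) with (P + Q) in T1 by ring end.
  rewrite Cmod_opp in T1.
  assert (T2 := Cmod_triangle (Ci ^ n * (RtoC (exp x) * (v - 1))) (Ci ^ n * (RtoC a * (u ^ n - 1)) + p)).
  assert (T3 := Cmod_triangle (Ci ^ n * (RtoC a * (u ^ n - 1))) p).
  repeat rewrite Cmod_mult in T1. repeat rewrite Cmod_mult in T2. repeat rewrite Cmod_mult in T3.
  rewrite HCi, Cmod_RtoC in T1. rewrite HCi, Cmod_RtoC in T2. rewrite HCi, Cmod_RtoC in T3.
  rewrite (Rabs_pos_eq (exp x + a)) in T1; [|lra].
  rewrite (Rabs_pos_eq (exp x)) in T2; [|lra].
  rewrite (Rabs_pos_eq a) in T3; [|lra].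
  assert (Cmod (u ^ n - 1) <= / 4)%R by (unfold cid in Kp; lra).
  nra.
Qed.

Lemma circle_bound n : exists R0, (1 <= R0)%R /\ forall m z, (R0 <= circle_radius n m)%R ->
  Cmod z = circle_radius n m ->
  (Cmod z ^ n / INR (fact n) / 4 <= Cmod (rem (S n) z))%R.
Proof.
  destruct (circle_bound_upper n) as [R0 [H0 H]]. exists R0. split; auto.
  intros m z Hm Hz. destruct (Rle_dec 0 (Im z)) as [Hi|Hi].
  - now apply (H m).
  - rewrite <- (Cmod_conj z), <- (Cmod_conj (rem _ _)), <- rem_conj. apply (H m); auto.
    + now rewrite Cmod_conj.
    + rewrite im_conj. lra.
Qed.

(** * Separation and growth of the zeros *)

Lemma sin_lower q : (0 <= q <= 1)%R -> (q / 2 <= sin q)%R.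
Proof.
  intros Hq. assert (P3 := PI2_3_2). unfold PI2 in P3.
  destruct (Req_dec q 0) as [->|H0]; [rewrite sin_0; lra|].
  destruct (MVT_cor2 sin cos 0 q) as [c [E Hc]]; [lra|intros; apply derivable_pt_lim_sin|].
  rewrite sin_0 in E.
  assert (C1 : (1 / 2 <= cos c)%R).
  { rewrite <- cos_PI3. apply cos_decr_1; try lra. }
  nra.
Qed.

(** A quantitative form of the fact that [Cexp h = 1] only at multiples of [2 PI i], of which
    [|Im h| <= 1] leaves only [0]. *)
Lemma Cexp_minus_1_lower h P : (0 <= P)%R -> (Rabs (Re h) <= P)%R -> (Rabs (Im h) <= 1)%R ->
  (Cmod h <= 3 * exp P * Cmod (Cexp h - 1))%R.
Proof.
  intros HP Hr Hi. destruct h as [p q]. simpl in Hr, Hi.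
  assert (EP := exp_pos P). assert (Ep := exp_pos p).
  assert (HX := Cmod_ge_0 (Cexp (p, q) - 1)).
  assert (EP1 : (1 <= exp P)%R) by (assert (Q := exp_ineq1_le P); lra).
  assert (A1 : (Rabs p <= exp P * Cmod (Cexp (p, q) - 1))%R).
  { assert (T1 := Cmod_sub_triangle (Cexp (p, q)) 1).
    assert (T2 := Cmod_sub_triangle 1 (Cexp (p, q))). rewrite Cmod_minus_sym in T2.
    rewrite Cmod_1, Cmod_Cexp_pair in T1, T2.
    destruct (Rle_dec 0 p) as [H|H].
    - rewrite (Rabs_pos_eq p) in *; auto. assert (Q := exp_ineq1_le p). nra.
    - assert (Hp : (p < 0)%R) by lra. rewrite (Rabs_left p) in *; try lra.
      assert (Q := exp_ineq1_le (- p)). rewrite exp_Ropp in Q.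
      assert (Q1 : (exp p <= 1)%R) by (rewrite <- exp_0; apply exp_le_exp; clear - Hp; lra).
      assert (Q2 : (/ exp p <= exp P)%R) by (rewrite <- exp_Ropp; apply exp_le_exp; lra).
      assert (Q3 : (/ exp p * (1 - exp p) <= exp P * Cmod (Cexp (p, q) - 1))%R).
      { apply Rmult_le_compat; try lra; try (left; now apply Rinv_0_lt_compat). }
      rewrite Rmult_minus_distr_l, Rinv_l in Q3; lra. }
  assert (A2 : (Rabs q <= 2 * exp P * Cmod (Cexp (p, q) - 1))%R).
  { assert (T := im_le_Cmod (Cexp (p, q) - 1)).
    replace (Im (Cexp (p, q) - 1)) with (exp p * sin q)%R in T by (unfold Cexp; simpl; ring).
    rewrite Rabs_mult, (Rabs_pos_eq (exp p)) in T; [|lra].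
    assert (S : (Rabs q / 2 <= Rabs (sin q))%R).
    { destruct (Rle_dec 0 q) as [H|H].
      - rewrite (Rabs_pos_eq q) in *; auto. eapply Rle_trans; [apply sin_lower; lra|apply Rle_abs].
      - rewrite (Rabs_left q) in *; try lra. rewrite <- Rabs_Ropp, <- sin_neg.
        eapply Rle_trans; [apply sin_lower; lra|apply Rle_abs]. }
    assert (Q2 : (/ exp P <= exp p)%R).
    { rewrite <- exp_Ropp. apply exp_le_exp. assert (Q := Rle_abs (- p)). rewrite Rabs_Ropp in Q. lra. }
    assert (S2 : (/ exp P * (Rabs q / 2) <= Cmod (Cexp (p, q) - 1))%R).
    { eapply Rle_trans; [|exact T]. apply Rmult_le_compat; auto.
      - left. now apply Rinv_0_lt_compat.
      - assert (Q := Rabs_pos q). lra. }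
    apply Rmult_le_compat_l with (r := exp P) in S2; [|lra].
    rewrite <- Rmult_assoc, Rinv_r, Rmult_1_l in S2; lra. }
  eapply Rle_trans; [apply Cmod_le_Re_Im|]. simpl. lra.
Qed.

(* At zeros, [e^(z-w) = T z / T w] with [T] the Taylor polynomial, and the right-hand side is
   [1 + O(|z - w| / |w|)]; for large [w] this forces [z = w] unless [|Im z - Im w| >= 1]. *)
Lemma zero_separation n : exists R0, (1 <= R0)%R /\ forall z w,
  rem (S n) z = 0 -> rem (S n) w = 0 -> (0 < Im z)%R -> (0 < Im w)%R ->
  (R0 <= Cmod z)%R -> (R0 <= Cmod w)%R -> (Rabs (Im z - Im w) < 1)%R -> z = w.
Proof.
  destruct (log_size_small n (/ 8) ltac:(lra)) as [R1 [HR1 KR1]].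
  set (c1 := (INR n * INR (fact n) / (1 / 8))%R).
  (* The moduli of [z] and [w] will differ by a factor of at most [2], so [|e^(z-w)| <= 2 * 2^n] and
     [|Re (z - w)| <= P]. *)
  set (P := (ln (2 * 2 ^ n))%R).
  assert (H2n : (1 <= 2 ^ n)%R) by (apply pow_R1_Rle; lra).
  assert (HP : (0 <= P)%R).
  { unfold P. rewrite <- ln_1. left. apply ln_increasing; lra. }
  set (D := (INR n * INR (fact n) * (2 * 2 ^ n) * 2)%R).
  assert (Pn := pos_INR n). assert (Pf := fact_pos n).
  assert (HD : (0 <= D)%R).
  { unfold D. repeat apply Rmult_le_pos; lra. }
  (* [2 * (P + 1)] keeps the segment from [w] to [z] outside the disc of radius [|w| / 2];
     [3 * exp P * D] makes the final inequality read [|h| <= q |h|] with [q < 1]. *)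
  set (R0 := (R1 + c1 + 2 * (P + 1) + 3 * exp P * D + 8)%R).
  assert (Hc1 : (0 <= c1)%R).
  { unfold c1. apply Rdiv_le_0_compat; [|lra]. apply Rmult_le_pos; lra. }
  assert (EP := exp_pos P).
  assert (H3 : (0 <= 3 * exp P * D)%R) by (repeat apply Rmult_le_pos; lra).
  exists R0. split; [unfold R0; lra|].
  intros z w Ez Ew Iz Iw Hz Hw HI.
  assert (Hz' : (R1 <= Cmod z /\ c1 <= Cmod z /\ 1 <= Cmod z /\ 8 <= Cmod z)%R) by (unfold R0 in *; lra).
  assert (Hw' : (R1 <= Cmod w /\ c1 <= Cmod w /\ 1 <= Cmod w /\ 8 <= Cmod w)%R) by (unfold R0 in *; lra).
  assert (G : forall z, rem (S n) z = 0 -> (R1 <= Cmod z /\ c1 <= Cmod z /\ 1 <= Cmod z /\ 8 <= Cmod z)%R ->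
    (0 < Im z)%R -> (7 / 8 * Cmod z <= Im z <= Cmod z)%R /\
    Cexp z = z ^ n / RtoC (INR (fact n)) + tpoly n z /\
    (7 / 8 * (Cmod z ^ n / INR (fact n)) <= Cmod (Cexp z) <= 9 / 8 * (Cmod z ^ n / INR (fact n)))%R).
  { clear - HR1 KR1 Pf. intros z Ez (H1 & H2 & H3 & H4) Iz.
    assert (Ha := monomial_pos n (Cmod z) H3).
    assert (Hre := near_zero_Re n z H3 H2).
    rewrite Ez, Cmod_0 in Hre. specialize (Hre ltac:(lra)).
    assert (HX := KR1 _ H1). assert (HX1 := log_size_ge_1 n (Cmod z)).
    assert (B := tpoly_relative n z (1 / 8) ltac:(lra) H3 H2).
    rewrite rem_S_split in Ez. apply Ceq_minus in Ez.
    assert (T1 := Cmod_le_Re_Im z). rewrite (Rabs_pos_eq (Im z)) in T1; [|lra].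
    assert (T2 := im_le_Cmod z). rewrite (Rabs_pos_eq (Im z)) in T2; [|lra].
    split; [split; [nra|lra]|]. split; [exact Ez|]. rewrite Ez.
    assert (Em := Cmod_monomial n z).
    assert (T3 := Cmod_triangle (z ^ n / RtoC (INR (fact n))) (tpoly n z)).
    assert (T4 := Cmod_sub_triangle (z ^ n / RtoC (INR (fact n))) (- tpoly n z)).
    rewrite Cmod_opp in T4.
    replace (z ^ n / RtoC (INR (fact n)) - - tpoly n z) with
      (z ^ n / RtoC (INR (fact n)) + tpoly n z) in T4 by ring.
    rewrite Em in T3, T4. lra. }
  destruct (G z Ez Hz' Iz) as (Gz1 & Gz2 & Gz3). destruct (G w Ew Hw' Iw) as (Gw1 & Gw2 & Gw3).
  clear G. apply Rabs_def2 in HI.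
  (* Large zeros are close to the imaginary axis, so nearby imaginary parts force comparable
     moduli. *)
  assert (Rzw : (Cmod z <= 2 * Cmod w)%R) by lra.
  assert (Rwz : (Cmod w <= 2 * Cmod z)%R) by lra.
  set (h := z - w).
  assert (Ratio : forall z w, (1 <= Cmod z)%R -> (1 <= Cmod w)%R -> (Cmod z <= 2 * Cmod w)%R ->
    (Cmod (Cexp z) <= 9 / 8 * (Cmod z ^ n / INR (fact n)))%R ->
    (7 / 8 * (Cmod w ^ n / INR (fact n)) <= Cmod (Cexp w))%R -> (Re z - Re w <= P)%R).
  { clear - Pf H2n. intros z w Hz Hw Hzw B1 B2. apply exp_le_inv. unfold P. rewrite exp_ln; [|lra].
    unfold Rminus. rewrite exp_plus, exp_Ropp, <- !Cmod_Cexp.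
    assert (Hw1 := monomial_pos n _ Hw).
    assert (K : (Cmod z ^ n / INR (fact n) <= 2 ^ n * (Cmod w ^ n / INR (fact n)))%R).
    { unfold Rdiv. rewrite <- Rmult_assoc. apply Rmult_le_compat_r; [left; now apply Rinv_0_lt_compat|].
      rewrite <- Rpow_mult_distr. apply pow_incr. lra. }
    assert (Pw : (0 < Cmod (Cexp w))%R) by lra.
    apply Rmult_le_reg_r with (Cmod (Cexp w)); auto.
    rewrite Rmult_assoc, Rinv_l, Rmult_1_r; [|lra]. nra. }
  assert (Rh : (Rabs (Re h) <= P)%R).
  { replace (Re h) with (Re z - Re w)%R by (unfold h; destruct z, w; reflexivity).
    assert (Q1 := Ratio z w ltac:(lra) ltac:(lra) Rzw ltac:(lra) ltac:(lra)).
    assert (Q2 := Ratio w z ltac:(lra) ltac:(lra) Rwz ltac:(lra) ltac:(lra)).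
    apply Rabs_le. lra. }
  assert (Ih : (Rabs (Im h) <= 1)%R).
  { replace (Im h) with (Im z - Im w)%R by (unfold h; destruct z, w; reflexivity). apply Rabs_le. lra. }
  assert (Hh : (Cmod h <= P + 1)%R) by (eapply Rle_trans; [apply Cmod_le_Re_Im|lra]).
  assert (Bh := Cexp_minus_1_lower h P HP Rh Ih).
  assert (EW : Cexp h - 1 = (tpoly (S n) z - tpoly (S n) w) / Cexp w).
  { replace (Cexp h) with (Cexp z / Cexp w) by (unfold h; now rewrite Cexp_minus).
    replace (tpoly (S n) z) with (Cexp z) by (rewrite Gz2; simpl; ring).
    replace (tpoly (S n) w) with (Cexp w) by (rewrite Gw2; simpl; ring).
    field. apply Cexp_neq_0. }
  assert (MV : (Cmod (tpoly (S n) z - tpoly (S n) w) <=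
      INR n * (2 * Cmod w) ^ n / (Cmod w / 2) * Cmod (z - w))%R).
  { apply (mean_value_inequality (tpoly (S n)) (tpoly n)).
    - intros t _. apply der_tpoly.
    - intros t _. destruct n; [apply cont_const|]. eapply der_cont, der_tpoly.
    - intros t Ht. fold h. set (v := w + RtoC t * h).
      assert (V1 : (Cmod w / 2 <= Cmod v)%R).
      { assert (T := Cmod_sub_triangle w (- (RtoC t * h))).
        replace (w - - (RtoC t * h)) with v in T by (unfold v; ring).
        rewrite Cmod_opp, Cmod_mult, Cmod_RtoC, Rabs_pos_eq in T; [|lra].
        assert (Q := Cmod_ge_0 h).
        assert (P + 1 <= Cmod w / 2)%R by (unfold R0 in Hw; lra). nra. }
      assert (V2 : (Cmod v <= 2 * Cmod w)%R).
      { assert (T := Cmod_triangle w (RtoC t * h)). fold v in T.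
        rewrite Cmod_mult, Cmod_RtoC, Rabs_pos_eq in T; [|lra].
        assert (Q := Cmod_ge_0 h).
        assert (P + 1 <= Cmod w / 2)%R by (unfold R0 in Hw; lra). nra. }
      assert (B := tpoly_bound n v ltac:(lra)).
      apply Rmult_le_reg_r with (Cmod v); [lra|].
      eapply Rle_trans; [exact B|].
      assert (Q : (Cmod v ^ n <= (2 * Cmod w) ^ n)%R).
      { apply pow_incr. split; [apply Cmod_ge_0|exact V2]. }
      assert (Q0 : (0 <= INR n * (2 * Cmod w) ^ n)%R).
      { apply Rmult_le_pos; auto. apply pow_le. lra. }
      apply Rle_trans with (INR n * (2 * Cmod w) ^ n)%R; [now apply Rmult_le_compat_l|].
      replace (INR n * (2 * Cmod w) ^ n)%R with
        (INR n * (2 * Cmod w) ^ n / (Cmod w / 2) * (Cmod w / 2))%R at 1 by (field; lra).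
      apply Rmult_le_compat_l; auto. apply Rdiv_le_0_compat; lra. }
  fold h in MV.
  assert (Hq := Cmod_ge_0 h).
  assert (Pw : (0 < Cmod w ^ n)%R) by (apply pow_lt; lra).
  assert (Fin : (Cmod (Cexp h - 1) <= D / Cmod w * Cmod h)%R).
  { rewrite EW, Cmod_div; [|apply Cexp_neq_0].
    assert (Pe : (Cmod w ^ n / INR (fact n) / 2 <= Cmod (Cexp w))%R).
    { assert (Q := monomial_pos n (Cmod w) ltac:(lra)). lra. }
    assert (Pe0 : (0 < Cmod w ^ n / INR (fact n) / 2)%R).
    { assert (Q := monomial_pos n (Cmod w) ltac:(lra)). lra. }
    apply Rmult_le_reg_r with (Cmod (Cexp w)); [lra|].
    unfold Rdiv at 1. rewrite Rmult_assoc, Rinv_l, Rmult_1_r; [|lra].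
    eapply Rle_trans; [exact MV|].
    apply Rle_trans with (D / Cmod w * Cmod h * (Cmod w ^ n / INR (fact n) / 2))%R.
    - right. unfold D. rewrite Rpow_mult_distr. field. lra.
    - apply Rmult_le_compat_l; auto. apply Rmult_le_pos; auto.
      apply Rdiv_le_0_compat; lra. }
  assert (Z : (Cmod h <= 3 * exp P * D / Cmod w * Cmod h)%R).
  { eapply Rle_trans; [exact Bh|].
    replace (3 * exp P * D / Cmod w * Cmod h)%R with (3 * exp P * (D / Cmod w * Cmod h))%R by (field; lra).
    apply Rmult_le_compat_l; lra. }
  assert (L : (3 * exp P * D / Cmod w < 1)%R).
  { apply Rmult_lt_reg_r with (Cmod w); [lra|].
    unfold Rdiv. rewrite Rmult_assoc, Rinv_l, Rmult_1_r, Rmult_1_l; [|lra].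
    unfold R0 in Hw. lra. }
  assert (Z0 : Cmod h = 0%R).
  { apply Rle_antisym; auto. apply Rnot_lt_le. intros Hpos. nra. }
  apply Cmod_eq_0 in Z0. unfold h in Z0. now apply Ceq_minus.
Qed.

Lemma pigeonhole (f : nat -> nat) (K M : nat) :
  (forall i, (i < K)%nat -> (f i < M)%nat) ->
  (forall i j, (i < K)%nat -> (j < K)%nat -> f i = f j -> i = j) -> (K <= M)%nat.
Proof.
  intros HM HI.
  rewrite <- (length_seq K 0), <- (length_map f (seq 0 K)), <- (length_seq M 0).
  apply NoDup_incl_length.
  - assert (G : forall l, (forall i, In i l -> (i < K)%nat) -> NoDup l -> NoDup (map f l)).
    { induction l as [|a l IH]; intros Hl HN; simpl; [constructor|].
      inversion HN; subst. constructor.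
      - intros Hin. apply in_map_iff in Hin. destruct Hin as [b [Eb Hb]].
        apply HI in Eb; [now subst| |]; apply Hl; [now right|now left].
      - apply IH; auto. intros i Hi. apply Hl. now right. }
    apply G; [|apply seq_NoDup]. intros i Hi. apply in_seq in Hi. lia.
  - intros y Hy. apply in_map_iff in Hy. destruct Hy as [i [<- Hi]].
    apply in_seq in Hi. apply in_seq. split; [lia|]. apply HM. lia.
Qed.

Definition nfloor (x : R) : nat := Z.to_nat (Int_part x).

Lemma nfloor_spec x : (0 <= x)%R -> (INR (nfloor x) <= x < INR (nfloor x) + 1)%R.
Proof.
  intros Hx. destruct (base_Int_part x) as [B1 B2]. unfold nfloor.
  assert (H0 : (0 <= Int_part x)%Z).
  { assert (-1 < Int_part x)%Z; [|lia]. apply lt_IZR. lra. }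
  rewrite INR_IZR_INZ, Z2Nat.id; auto. lra.
Qed.

Lemma nfloor_mono x y : (0 <= x)%R -> (x <= y)%R -> (nfloor x <= nfloor y)%nat.
Proof.
  intros Hx Hxy. assert (A := nfloor_spec x Hx). assert (B := nfloor_spec y ltac:(lra)).
  assert (nfloor x < S (nfloor y))%nat; [|lia]. apply INR_lt. rewrite S_INR. lra.
Qed.

Lemma nfloor_eq_close x y : (0 <= x)%R -> (0 <= y)%R -> nfloor x = nfloor y -> (Rabs (x - y) < 1)%R.
Proof.
  intros Hx Hy E. assert (A := nfloor_spec x Hx). assert (B := nfloor_spec y Hy).
  rewrite E in A. apply Rabs_def1; lra.
Qed.

(** Numbers at mutual distance at least [1] have different integer parts. *)
Lemma count_separated (y : nat -> R) (K : nat) B :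
  (forall i, (i < K)%nat -> (0 <= y i <= B)%R) ->
  (forall i j, (i < K)%nat -> (j < K)%nat -> (Rabs (y i - y j) < 1)%R -> i = j) ->
  (0 <= B)%R -> (INR K <= B + 1)%R.
Proof.
  intros HB HI H0.
  assert (P : (K <= S (nfloor B))%nat).
  { apply (pigeonhole (fun i => nfloor (y i))).
    - intros i Hi. assert (Q := nfloor_mono (y i) B (proj1 (HB i Hi)) (proj2 (HB i Hi))). lia.
    - intros i j Hi Hj E. apply HI; auto. apply nfloor_eq_close; auto; apply HB; auto. }
  apply le_INR in P. rewrite S_INR in P. assert (Q := nfloor_spec B H0). lra.
Qed.

Section Zeros.
Variables (n : nat) (z : nat -> C).
Hypothesis Hzero : forall k, rem (S n) (z k) = 0.
Hypothesis Him : forall k, (0 < Im (z k))%R.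
Hypothesis Hinj : forall j k, z j = z k -> j = k.
Hypothesis Hmono : forall k, (Cmod (z k) <= Cmod (z (S k)))%R.

Lemma Cmod_zeros_mono j k : (j <= k)%nat -> (Cmod (z j) <= Cmod (z k))%R.
Proof. intros H. induction H as [|k H IH]; [lra|]. specialize (Hmono k). lra. Qed.

(** Otherwise infinitely many distinct zeros lie in a bounded square. Isolation and compactness give
    a [d] such that each cell of side [d] contains at most one of them, and [L * L] cells cover the
    square. *)
Lemma zeros_unbounded r0 : exists k, (r0 < Cmod (z k))%R.
Proof.
  apply Classical_Prop.NNPP. intros N.
  assert (HB : forall k, (Cmod (z k) <= r0)%R).
  { intros k. apply Rnot_lt_le. intros H. apply N. now exists k. }
  assert (Hr0 : (0 <= r0)%R) by (eapply Rle_trans; [apply Cmod_ge_0|apply (HB O)]).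
  (* The factor [4] leaves room for two coordinates, each off by less than [2 * d]. *)
  destruct (functional_choice
    (fun (p : C) (d : posreal) => forall w, w <> p -> (Cmod (w - p) < 4 * d)%R -> rem (S n) w <> 0))
    as [delta Hdelta].
  { intros p. destruct (rem_zero_isolated (S n) p ltac:(lia)) as [d [Hd K]].
    assert (Hd4 : (0 < d / 4)%R) by lra. exists (mkposreal _ Hd4). intros w Hw Hwd.
    apply K; auto. simpl in Hwd. lra. }
  destruct (compactness_value_2d (- r0) r0 (- r0) r0 (fun u v => delta (u, v))) as [d Hd].
  assert (Hd0 := cond_pos d).
  assert (Hre : forall k, (- r0 <= Re (z k) <= r0)%R).
  { intros k. assert (Q := re_le_Cmod (z k)). specialize (HB k).
    apply Rabs_le_between. lra. }
  assert (Him' : forall k, (- r0 <= Im (z k) <= r0)%R).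
  { intros k. assert (Q := im_le_Cmod (z k)). specialize (HB k).
    apply Rabs_le_between. lra. }
  assert (Sep : forall i j, (Rabs (Re (z i) - Re (z j)) < d)%R -> (Rabs (Im (z i) - Im (z j)) < d)%R -> i = j).
  { intros i j H1 H2. apply Classical_Prop.NNPP. intros Nij.
    apply (Hd (Re (z i)) (Im (z i)) (Hre i) (Him' i)).
    intros [u [v (_ & _ & A1 & A2 & A3)]].
    set (p := (u, v) : C) in *.
    assert (Ep : forall k, (Rabs (Re (z k) - u) < 2 * delta p)%R -> (Rabs (Im (z k) - v) < 2 * delta p)%R -> z k = p).
    { intros k B1 B2. apply Classical_Prop.NNPP. intros Nk.
      apply (Hdelta p (z k) Nk); [|apply Hzero].
      eapply Rle_lt_trans; [apply Cmod_le_Re_Im|].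
      replace (Re (z k - p)) with (Re (z k) - u)%R by (unfold p; destruct (z k); reflexivity).
      replace (Im (z k - p)) with (Im (z k) - v)%R by (unfold p; destruct (z k); reflexivity).
      lra. }
    apply Nij, Hinj. assert (P := cond_pos (delta p)).
    assert (A3' : (d <= delta p)%R) by exact A3.
    rewrite (Ep i), (Ep j); auto; try lra.
    - apply Rabs_def2 in A1. apply Rabs_def2 in H1. apply Rabs_def1; unfold p in *; lra.
    - apply Rabs_def2 in A2. apply Rabs_def2 in H2. apply Rabs_def1; unfold p in *; lra. }
  set (L := S (nfloor (2 * r0 / d))).
  assert (Hcell : forall x, (- r0 <= x <= r0)%R -> (0 <= (x + r0) / d <= 2 * r0 / d)%R).
  { intros x Hx. split; [apply Rdiv_le_0_compat; lra|].
    apply Rmult_le_compat_r; [left; now apply Rinv_0_lt_compat|lra]. }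
  assert (Hlt : forall x, (- r0 <= x <= r0)%R -> (nfloor ((x + r0) / d) < L)%nat).
  { intros x Hx. destruct (Hcell x Hx) as [A B]. unfold L.
    assert (Q := nfloor_mono _ _ A B). lia. }
  assert (Hclose : forall x y, (- r0 <= x <= r0)%R -> (- r0 <= y <= r0)%R ->
    nfloor ((x + r0) / d) = nfloor ((y + r0) / d) -> (Rabs (x - y) < d)%R).
  { intros x y Hx Hy E. apply nfloor_eq_close in E; try (apply Hcell; auto).
    replace ((x + r0) / d - (y + r0) / d)%R with ((x - y) / d)%R in E by (field; lra).
    unfold Rdiv in E. rewrite Rabs_mult, (Rabs_pos_eq (/ d)) in E; [|left; now apply Rinv_0_lt_compat].
    apply Rmult_lt_compat_r with (r := d) in E; [|exact Hd0].
    rewrite Rmult_assoc, Rinv_l in E; lra. }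
  assert (P : (S (L * L) <= L * L)%nat); [|lia].
  apply (pigeonhole (fun k => nfloor ((Re (z k) + r0) / d) * L + nfloor ((Im (z k) + r0) / d))%nat).
  - intros i _. assert (A := Hlt _ (Hre i)). assert (B := Hlt _ (Him' i)). nia.
  - intros i j _ _ E.
    assert (A1 := Hlt _ (Him' i)). assert (A2 := Hlt _ (Him' j)).
    assert (E1 : nfloor ((Re (z i) + r0) / d) = nfloor ((Re (z j) + r0) / d)) by nia.
    rewrite E1 in E. apply Sep; apply Hclose; auto. lia.
Qed.

Lemma zeros_eventually_large r0 : exists k0, forall k, (k0 <= k)%nat -> (r0 < Cmod (z k))%R.
Proof.
  destruct (zeros_unbounded r0) as [k0 H]. exists k0. intros k Hk.
  assert (Q := Cmod_zeros_mono k0 k Hk). lra.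
Qed.

(* All but finitely many of the zeros have imaginary parts at distance at least 1 from each other. *)
Lemma zeros_linear_growth : exists c, (0 < c)%R /\ forall k, (c * (INR k + 1) <= Cmod (z k))%R.
Proof.
  destruct (zero_separation n) as [R0 [HR0 Hsep]].
  destruct (zeros_eventually_large R0) as [k0 Hk0].
  (* The zeros with indices from [k0] to [k] have separated imaginary parts in [[0, |z k|]]. *)
  assert (G : forall k, (k0 <= k)%nat -> (INR k - INR k0 <= Cmod (z k))%R).
  { intros k Hk.
    assert (C0 := count_separated (fun i => Im (z (k0 + i)%nat)) (S (k - k0)) (Cmod (z k))).
    rewrite S_INR, minus_INR in C0; auto.
    assert (INR k - INR k0 + 1 <= Cmod (z k) + 1)%R; [|lra].
    apply C0; [| |apply Cmod_ge_0].
    - intros i Hi. split; [left; apply Him|].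
      assert (Q := im_le_Cmod (z (k0 + i)%nat)). assert (Q2 := Rle_abs (Im (z (k0 + i)%nat))).
      assert (Q3 := Cmod_zeros_mono (k0 + i) k ltac:(lia)). lra.
    - intros i j Hi Hj Hd.
      assert (E : z (k0 + i)%nat = z (k0 + j)%nat).
      { apply Hsep; auto; left; apply Hk0; lia. }
      apply Hinj in E. lia. }
  assert (Pk := pos_INR k0).
  assert (H0 : (0 < Cmod (z O))%R).
  { apply Cmod_gt_0. intros E. specialize (Him O). rewrite E in Him. simpl in Him. lra. }
  assert (Hd : (0 < Cmod (z O) / (2 * INR k0 + 4))%R) by (apply Rdiv_lt_0_compat; lra).
  (* From the index [2 * k0 + 3] on, the count gives the slope [/ 4]; before it, the smallest
     modulus [Cmod (z O)] suffices. *)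
  exists (Rmin (/ 4) (Cmod (z O) / (2 * INR k0 + 4))). split; [apply Rmin_pos; lra|].
  intros k. assert (Pk' := pos_INR k).
  destruct (Rle_dec (2 * INR k0 + 3) (INR k)) as [H|H].
  - apply Rle_trans with (/ 4 * (INR k + 1))%R.
    + apply Rmult_le_compat_r; [lra|apply Rmin_l].
    + assert (Q : (k0 <= k)%nat) by (apply INR_le; lra). specialize (G k Q). lra.
  - apply Rle_trans with (Cmod (z O) / (2 * INR k0 + 4) * (2 * INR k0 + 4))%R.
    + apply Rle_trans with (Cmod (z O) / (2 * INR k0 + 4) * (INR k + 1))%R.
      * apply Rmult_le_compat_r; [lra|apply Rmin_r].
      * apply Rmult_le_compat_l; lra.
    + assert (Q := Cmod_zeros_mono 0 k ltac:(lia)).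
      replace (Cmod (z O) / (2 * INR k0 + 4) * (2 * INR k0 + 4))%R with (Cmod (z O)) by (field; lra).
      exact Q.
Qed.

Lemma zeros_count_below r0 : exists K, (forall k, (k < K)%nat -> (Cmod (z k) < r0)%R) /\
  (forall k, (K <= k)%nat -> (r0 <= Cmod (z k))%R).
Proof.
  destruct (zeros_eventually_large r0) as [k0 H0].
  assert (G : forall j, (forall k, (j <= k)%nat -> (r0 <= Cmod (z k))%R) ->
    exists K, (forall k, (k < K)%nat -> (Cmod (z k) < r0)%R) /\
      (forall k, (K <= k)%nat -> (r0 <= Cmod (z k))%R)).
  { induction j as [|j IH]; intros Hj.
    - exists O. split; [intros; lia|exact Hj].
    - destruct (Rle_dec r0 (Cmod (z j))) as [L|L].
      + apply IH. intros k Hk. assert (Q := Cmod_zeros_mono j k Hk). lra.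
      + exists (S j). split; auto. intros k Hk.
        assert (Q := Cmod_zeros_mono k j ltac:(lia)). lra. }
  apply (G k0). intros k Hk. left. now apply H0.
Qed.

End Zeros.

(** * Convergence of the series *)

Lemma ex_series_bounded (a : nat -> R) M : (forall k, (0 <= a k)%R) ->
  (forall k, (sum_n a k <= M)%R) -> ex_series a.
Proof.
  intros Ha HM. destruct (ex_finite_lim_seq_incr (sum_n a) M) as [l Hl]; auto.
  - intros k. rewrite sum_Sn. specialize (Ha (S k)). unfold plus; simpl. lra.
  - now exists l.
Qed.

(** The mean value theorem for [x^(-e)], written as [exp (- e * ln x)]; it dominates the series of
    [k^(-1-e)] by a telescoping one. *)
Lemma power_telescope e x : (0 < e)%R -> (0 < x)%R ->
  (exp (- (1 + e) * ln (x + 1)) <= (exp (- e * ln x) - exp (- e * ln (x + 1))) / e)%R.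
Proof.
  intros He Hx.
  destruct (MVT_cor2 (fun t => exp (- e * ln t)) (fun t => - e * exp (- e * ln t) / t)%R x (x + 1))
    as [c [E Hc]]; [lra| |].
  - intros t Ht. apply is_derive_Reals. auto_derive; [lra|]. field. lra.
  - replace (x + 1 - x)%R with 1%R in E by ring.
    apply Rmult_le_reg_r with e; auto.
    unfold Rdiv. rewrite Rmult_assoc, Rinv_l, Rmult_1_r; [|lra].
    replace (exp (- e * ln x) - exp (- e * ln (x + 1)))%R with (e * exp (- e * ln c) / c)%R by lra.
    replace (/ 1)%R with 1%R by field. unfold Rdiv.
    replace (e * exp (- e * ln c) * / c)%R with (exp (- (1 + e) * ln c) * e)%R.
    + apply Rmult_le_compat_r; [lra|]. apply exp_le_exp.
      assert (ln c <= ln (x + 1))%R by (left; apply ln_increasing; lra). nra.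
    + replace (- (1 + e) * ln c)%R with (- e * ln c + - ln c)%R by ring.
      rewrite exp_plus, exp_Ropp, exp_ln; [ring|lra].
Qed.

Lemma ex_series_power e : (0 < e)%R -> ex_series (fun k => exp (- (1 + e) * ln (INR k + 1)))%R.
Proof.
  intros He. apply ex_series_bounded with (1 + 1 / e)%R.
  - intros k. left. apply exp_pos.
  - assert (G : forall k, (sum_n (fun k => exp (- (1 + e) * ln (INR k + 1))) k <=
      1 + (1 - exp (- e * ln (INR k + 1))) / e)%R).
    { induction k as [|k IH].
      - rewrite sum_O. simpl. replace (0 + 1)%R with 1%R by ring. rewrite ln_1, !Rmult_0_r, exp_0.
        right. field. lra.
      - rewrite sum_Sn. unfold plus; simpl AbelianMonoid.class.
        change (sum_n (fun k => exp (- (1 + e) * ln (INR k + 1))) k +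
          exp (- (1 + e) * ln (INR (S k) + 1)) <= 1 + (1 - exp (- e * ln (INR (S k) + 1))) / e)%R.
        assert (Pk := pos_INR k).
        assert (T := power_telescope e (INR k + 1) He ltac:(lra)).
        rewrite S_INR. unfold Rdiv in *. lra. }
    intros k. eapply Rle_trans; [apply G|].
    assert (P := exp_pos (- e * ln (INR k + 1))).
    apply Rplus_le_compat_l. apply Rmult_le_compat_r; [left; now apply Rinv_0_lt_compat|]. lra.
Qed.

Lemma Cmod_Ccos_le w : (Cmod (Ccos w) <= exp (Rabs (Im w)))%R.
Proof.
  unfold Ccos. rewrite Cmod_div, Cmod_RtoC, Rabs_pos_eq; try lra; [|apply RtoC_neq_0; lra].
  assert (T := Cmod_triangle (Cexp (Ci * w)) (Cexp (- (Ci * w)))).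
  rewrite !Cmod_Cexp, re_opp in T.
  replace (Re (Ci * w)) with (- Im w)%R in T by (destruct w; simpl; ring).
  assert (A1 : (exp (- Im w) <= exp (Rabs (Im w)))%R).
  { apply exp_le_exp. rewrite <- Rabs_Ropp. apply Rle_abs. }
  assert (A2 : (exp (- - Im w) <= exp (Rabs (Im w)))%R).
  { apply exp_le_exp. rewrite Ropp_involutive. apply Rle_abs. }
  lra.
Qed.

Lemma is_series_C_eps (a : nat -> C) L :
  is_series (K := C_AbsRing) (V := C_NormedModule) a L ->
  forall eps, (0 < eps)%R -> exists K, forall k, (K <= k)%nat ->
    (Cmod (sum_n (G := C_AbelianMonoid) a k - L) < eps)%R.
Proof.
  intros H eps He. assert (He2 : (0 < eps / 2)%R) by lra.
  destruct (proj1 (filterlim_locally _ _) H (mkposreal _ He2)) as [K HK].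
  exists K. intros k Hk. assert (Q := Cmod_ball_C _ _ _ (HK k Hk)). simpl in Q.
  eapply Rlt_le_trans; [exact Q|]. lra.
Qed.

(** Since [Re (s - 1) < -1] and [r k] grows linearly, the powers are summable; the cosines are
    bounded because [PI - theta k] is. *)
Lemma series_converges (r theta : nat -> R) (s : C) c : (0 < c)%R -> (Re s < 0)%R ->
  (forall k, (c * (INR k + 1) <= r k)%R) -> (forall k, (0 < theta k < PI)%R) ->
  exists L, is_series (K := C_AbsRing) (V := C_NormedModule)
    (fun k => Rpow_C (r k) (s - RtoC 1) * Ccos ((s - RtoC 1) * RtoC (PI - theta k))) L.
Proof.
  intros Hc Hs Hr Ht. assert (Hpi := PI_RGT_0).
  set (e := (- Re s)%R). assert (He : (0 < e)%R) by (unfold e; lra).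
  set (M := (exp (- (1 + e) * ln c) * exp (Rabs (Im s) * PI))%R).
  apply (ex_series_le (K := C_AbsRing) (V := C_CompleteNormedModule) _
    (fun k => M * exp (- (1 + e) * ln (INR k + 1)))%R).
  - intros k. change (Cmod (Rpow_C (r k) (s - RtoC 1) * Ccos ((s - RtoC 1) * RtoC (PI - theta k))) <=
      M * exp (- (1 + e) * ln (INR k + 1)))%R.
    assert (Pk := pos_INR k). assert (Pc : (0 < c * (INR k + 1))%R) by (apply Rmult_lt_0_compat; lra).
    specialize (Hr k). specialize (Ht k).
    rewrite Cmod_mult. unfold Rpow_C. rewrite Cmod_Cexp, re_scal_r.
    replace (Re (s - RtoC 1)) with (- (1 + e))%R by (unfold e; destruct s; simpl; ring).
    replace (M * exp (- (1 + e) * ln (INR k + 1)))%R with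
      (exp (- (1 + e) * ln (c * (INR k + 1))) * exp (Rabs (Im s) * PI))%R.
    2:{ rewrite ln_mult, Rmult_plus_distr_l, exp_plus; try lra. unfold M. ring. }
    apply Rmult_le_compat; try apply Cmod_ge_0; [left; apply exp_pos| |].
    + apply exp_le_exp.
      assert (ln (c * (INR k + 1)) <= ln (r k))%R.
      { destruct Hr as [Hr|Hr]; [left; now apply ln_increasing|rewrite Hr; lra]. }
      nra.
    + eapply Rle_trans; [apply Cmod_Ccos_le|]. apply exp_le_exp.
      rewrite im_scal_r, Rabs_mult.
      replace (Im (s - RtoC 1)) with (Im s) by (destruct s; simpl; ring).
      apply Rmult_le_compat_l; [apply Rabs_pos|]. apply Rabs_le. lra.
  - apply (ex_series_scal (K := R_AbsRing) (V := R_NormedModule)). now apply ex_series_power.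
Qed.

(** * The keyhole integral *)

(* As [f - f' = - z^n / n!] for [f = rem (S n)], this is [f' / f - 1], so its residues
   at the nonzero zeros of [f] are all 1. *)
Definition zkernel (n : nat) (z : C) : C := z ^ n / (RtoC (INR (fact n)) * rem (S n) z).

Lemma holo_zkernel n z : rem (S n) z <> 0 -> holo (zkernel n) z.
Proof.
  intros H. apply (holo_div (fun z => z ^ n) (fun z => RtoC (INR (fact n)) * rem (S n) z)).
  - apply Cmult_neq_0; auto. apply RtoC_fact_neq_0.
  - apply holo_pow.
  - apply holo_mult; [apply holo_const|apply holo_rem].
Qed.

Lemma Cmod_zkernel n z : rem (S n) z <> 0 ->
  Cmod (zkernel n z) = (Cmod z ^ n / (INR (fact n) * Cmod (rem (S n) z)))%R.
Proof.
  intros H. unfold zkernel. rewrite Cmod_div, Cmod_mult, Cmod_pow, Cmod_RtoC, Rabs_pos_eq; auto.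
  - left. apply fact_pos.
  - apply Cmult_neq_0; auto. apply RtoC_fact_neq_0.
Qed.

Lemma zkernel_bound n z b : (0 < b)%R -> (b * Cmod z ^ n <= INR (fact n) * Cmod (rem (S n) z))%R ->
  rem (S n) z <> 0 -> (Cmod (zkernel n z) <= / b)%R.
Proof.
  intros Hb H H0. rewrite Cmod_zkernel; auto. assert (Pf := fact_pos n).
  assert (Pr : (0 < Cmod (rem (S n) z))%R) by now apply Cmod_gt_0.
  assert (Pp : (0 < INR (fact n) * Cmod (rem (S n) z))%R) by now apply Rmult_lt_0_compat.
  apply Rmult_le_reg_r with (INR (fact n) * Cmod (rem (S n) z))%R; auto.
  unfold Rdiv. rewrite Rmult_assoc, Rinv_l, Rmult_1_r; [|lra].
  apply Rmult_le_reg_l with b; auto. rewrite <- Rmult_assoc, Rinv_r, Rmult_1_l; lra.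
Qed.

Lemma exp_m1_small r : (0 <= r)%R -> (r <= exp (-1))%R -> (r * exp r <= 1)%R.
Proof.
  intros H0 H.
  assert (E : (exp (-1) <= 1)%R) by (rewrite <- exp_0; apply exp_le_exp; lra).
  apply Rle_trans with (exp (-1) * exp 1)%R.
  - apply Rmult_le_compat; auto; [left; apply exp_pos|apply exp_le_exp; lra].
  - rewrite <- exp_plus. replace (-1 + 1)%R with 0%R by ring. rewrite exp_0. lra.
Qed.

Lemma rem_near_0_neq_0 n (z : C) : z <> 0 -> (Cmod z <= exp (-1))%R -> rem (S n) z <> 0.
Proof.
  intros Hz H. apply rem_small_neq_0; [lia|exact Hz|]. apply exp_m1_small; [apply Cmod_ge_0|exact H].
Qed.

(** [zkernel] has a simple pole at the origin, where [rem (S n)] vanishes to order [n + 1]; hence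
    the condition [Re s > 1] for the integral from [0]. *)
Lemma zkernel_near_0 n (z : C) : z <> 0 -> (Cmod z <= exp (-1))%R ->
  (Cmod (zkernel n z) <= 2 * INR (S n) / Cmod z)%R.
Proof.
  intros Hz H. assert (Hm : (0 < Cmod z)%R) by now apply Cmod_gt_0.
  assert (PS : (0 < INR (S n))%R) by (apply lt_0_INR; lia).
  replace (2 * INR (S n) / Cmod z)%R with (/ (Cmod z / (2 * INR (S n))))%R by (field; lra).
  apply zkernel_bound.
  - apply Rdiv_lt_0_compat; lra.
  - assert (B := rem_lower_small (S n) z ltac:(lia) (exp_m1_small _ (Cmod_ge_0 z) H)).
    assert (Pf := fact_pos n).
    rewrite fact_simpl, mult_INR in B.
    apply Rmult_le_compat_l with (r := INR (fact n)) in B; [|lra].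
    eapply Rle_trans; [|exact B]. right. rewrite <- (tech_pow_Rmult (Cmod z)). field. lra.
  - now apply rem_near_0_neq_0.
Qed.

Lemma rem_pos_neq_0 n x : (0 < x)%R -> rem n (RtoC x) <> 0.
Proof. intros H. apply rem_real_neq_0; [reflexivity|]. apply RtoC_neq_0. lra. Qed.

Lemma zkernel_real_decay n d x : (0 < x)%R ->
  (Cmod (zkernel n (RtoC x)) <= INR (fact (d + S n)) / INR (fact n) * / x ^ S d)%R.
Proof.
  intros Hx. assert (Pf := fact_pos n). assert (Pd := fact_pos (d + S n)).
  assert (Px : (0 < x ^ S d)%R) by now apply pow_lt.
  replace (INR (fact (d + S n)) / INR (fact n) * / x ^ S d)%R with
    (/ (INR (fact n) * x ^ S d / INR (fact (d + S n))))%R by (field; lra).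
  apply zkernel_bound.
  - apply Rdiv_lt_0_compat; auto. now apply Rmult_lt_0_compat.
  - rewrite rem_RtoC, !Cmod_RtoC, (Rabs_pos_eq x), (Rabs_pos_eq (remR _ _)); try lra.
    2:{ apply remR_pos. lra. }
    assert (B := remR_lower (S n) d x ltac:(lra)).
    apply Rmult_le_compat_l with (r := INR (fact n)) in B; [|lra].
    eapply Rle_trans; [|exact B]. right.
    replace (d + S n)%nat with (S d + n)%nat by lia. rewrite pow_add. field.
    apply Rgt_not_eq, fact_pos.
  - now apply rem_pos_neq_0.
Qed.

(** The kernel along the ray [x >= 1/e] with [x = exp (t - 1)], the shift making [t] start at
    [0]. *)
Definition zline (n : nat) (t : R) : C := zkernel n (RtoC (exp (t - 1))).

Lemma holo_zkernel_exp n t : holo (zkernel n) (RtoC (exp t)).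
Proof. apply holo_zkernel, rem_pos_neq_0, exp_pos. Qed.

Lemma cont_zline n t : cont RtoC (zline n) t.
Proof.
  apply (cont_comp RtoC (zkernel n) (fun t => RtoC (exp (t - 1)))).
  - eapply der_cont. apply (der_RtoC_fun (fun t => exp (t - 1))). auto_derive; auto.
  - apply holo_cont, holo_zkernel_exp.
Qed.

(** An arbitrary rate [b] makes the part of the integral beyond radius [1/e] entire in [s]. *)
Lemma zline_decay n b : exists C, (0 <= C)%R /\ forall t, (0 <= t)%R ->
  (Cmod (zline n t) <= C * exp (- (b * t)))%R.
Proof.
  destruct (INR_unbounded b) as [d Hd]. assert (Pn := pos_INR d).
  exists (INR (fact (d + S n)) / INR (fact n) * exp (INR (S d)))%R. split.
  - apply Rmult_le_pos; [|left; apply exp_pos]. left. apply Rdiv_lt_0_compat; apply fact_pos.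
  - intros t Ht. eapply Rle_trans; [apply (zkernel_real_decay n d), exp_pos|].
    rewrite Rmult_assoc. apply Rmult_le_compat_l.
    { left. apply Rdiv_lt_0_compat; apply fact_pos. }
    rewrite <- exp_plus.
    assert (E : (exp (t - 1) ^ S d = exp (INR (S d) * (t - 1)))%R).
    { clear. induction (S d) as [|k IH]; [simpl; rewrite Rmult_0_l, exp_0; reflexivity|].
      simpl pow. rewrite IH, S_INR, <- exp_plus. f_equal. ring. }
    rewrite E, <- exp_Ropp. apply exp_le_exp. rewrite S_INR. nra.
Qed.

Lemma zline_rint n s : exists l, is_rint (fun t => Cexp (s * RtoC t) * zline n t) l.
Proof.
  destruct (zline_decay n (Re s + 1)) as [C [HC H]].
  apply (laplace_ex (zline n) C (Re s + 1)); auto; [lra|]. intros; apply cont_zline.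
Qed.

Lemma CI_zkernel_from_m1 n s T : (0 <= T)%R ->
  CI (fun t => log_integrand (zkernel n) s (RtoC t)) (- 1) (T - 1) =
  Cexp (- s) * CI (fun t => Cexp (s * RtoC t) * zline n t) 0 T.
Proof.
  intros HT. rewrite <- CI_scal; auto.
  2:{ intros t _. apply cont_mult; [apply cont_Cexp_line|apply cont_zline]. }
  assert (K := CI_shift (fun t => log_integrand (zkernel n) s (RtoC t)) 0 T (- 1) HT).
  replace (0 + - 1)%R with (- 1)%R in K by ring. change (T + - 1)%R with (T - 1)%R in K.
  rewrite <- K.
  - apply CI_ext; auto. intros t _. unfold log_integrand, zline.
    rewrite Cexp_RtoC, RtoC_plus. replace (t + - 1)%R with (t - 1)%R by ring.
    replace (s * (RtoC t + RtoC (- 1))) with (- s + s * RtoC t).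
    + rewrite Cexp_plus. ring.
    + apply C_ext; destruct s; simpl; ring.
  - intros t _. apply holo_log_line, holo_zkernel_exp.
Qed.

Lemma zkernel_tail_fun n : exists I0 : C -> C, forall s,
  is_rint (fun t => Cexp (s * RtoC t) * zline n t) (I0 s).
Proof. destruct (functional_choice _ (zline_rint n)) as [I0 H]. now exists I0. Qed.

(* The keyhole integral with the circle of radius [1/e]; it is entire in [s]. *)
Definition keyhole (n : nat) (I0 : C -> C) (s : C) : C :=
  (1 - Cexp (2 * PI * Ci * s)) * (Cexp (- s) * I0 s) - Ci * log_arc (zkernel n) s (- 1).

Section Keyhole.
Variables (n : nat) (I0 : C -> C).
Hypothesis HI0 : forall s, is_rint (fun t => Cexp (s * RtoC t) * zline n t) (I0 s).

Lemma holo_Cexp_lin a s : holo (fun s => Cexp (a * s)) s.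
Proof.
  apply (holo_comp Cexp (fun s => a * s)); [|apply holo_Cexp].
  apply (holo_mult (fun _ => a) (fun s => s)); [apply holo_const|apply holo_id].
Qed.

Lemma holo_Cexp_opp s : holo (fun s => Cexp (- s)) s.
Proof.
  apply (holo_ext (fun s => Cexp (- (1) * s))); [|apply holo_Cexp_lin].
  intros w. f_equal. ring.
Qed.

Lemma arc_m1_neq_0 z : Cmod z = exp (- 1) -> rem (S n) z <> 0.
Proof.
  intros H. apply rem_near_0_neq_0; [|right; exact H].
  apply Cmod_gt_0. rewrite H. apply exp_pos.
Qed.

Lemma holo_keyhole s : holo (keyhole n I0) s.
Proof.
  assert (Hpi := PI_RGT_0).
  apply (holo_minus (fun s => (1 - Cexp (2 * PI * Ci * s)) * (Cexp (- s) * I0 s))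
    (fun s => Ci * log_arc (zkernel n) s (- 1))).
  - apply holo_mult.
    + apply holo_minus; [apply holo_const|apply holo_Cexp_lin].
    + apply holo_mult; [apply holo_Cexp_opp|].
      destruct (zline_decay n (Re s + 1)) as [C [HC H]].
      apply (laplace_holo (zline n) C (Re s + 1)); auto; [lra|]. intros; apply cont_zline.
  - apply holo_mult; [apply holo_const|].
    set (k := fun y => zkernel n (Cexp ((- 1)%R, y))).
    assert (Hk : cont_on k 0 (2 * PI)).
    { intros t _. apply (cont_vertical (fun w => zkernel n (Cexp w))). apply holo_cont.
      apply (holo_comp (zkernel n) Cexp); [apply holo_Cexp|]. apply holo_zkernel, arc_m1_neq_0.
      apply Cmod_Cexp_pair. }
    (* At [w = -1 + i y] the factor [e^(s w)] is [e^(-s) e^((i s) y)], so the arc is a Laplace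
       transform over a bounded interval in the variable [Ci * s]. *)
    apply (holo_ext (fun s => Cexp (- s) * (fun u => CI (fun y => Cexp (u * RtoC y) * k y) 0 (2 * PI)) (Ci * s))).
    + intros u. cbv beta. unfold log_arc. rewrite <- CI_scal; [|lra|].
      * apply CI_ext; [lra|]. intros y _. unfold log_integrand. fold (k y).
        rewrite Cmult_assoc, <- Cexp_plus. f_equal. f_equal.
        apply C_ext; destruct u; simpl; ring.
      * intros t Ht. apply cont_mult; [apply cont_Cexp_line|now apply Hk].
    + apply holo_mult; [apply holo_Cexp_opp|].
      apply (holo_comp (fun u => CI (fun y => Cexp (u * RtoC y) * k y) 0 (2 * PI)) (fun s => Ci * s)).
      * apply (holo_mult (fun _ => Ci) (fun s => s)); [apply holo_const|apply holo_id].
      * apply laplace_fin_holo; auto. lra.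
Qed.

Lemma log_integrand_zkernel_bound s : (1 < Re s)%R -> exists C, (0 <= C)%R /\ forall t,
  (Cmod (log_integrand (zkernel n) s (RtoC t)) <= C * exp (- ((Re s - 1) * Rabs t)))%R.
Proof.
  intros Hs. set (b := (Re s - 1)%R). assert (Hb : (0 < b)%R) by (unfold b; lra).
  (* The rate [2 * Re s] beats the growth [exp (Re s * t)] of the power and leaves more than
     [Re s - 1]. *)
  destruct (zline_decay n (2 * Re s)) as [C [HC H]].
  assert (PS : (0 < INR (S n))%R) by (apply lt_0_INR; lia).
  exists (C * exp b + 2 * INR (S n))%R.
  assert (HC' : (0 <= C * exp b)%R) by (apply Rmult_le_pos; auto; left; apply exp_pos).
  split; [lra|]. intros t.
  assert (P := exp_pos (- (b * Rabs t))).
  unfold log_integrand. rewrite Cmod_mult, Cmod_Cexp, re_scal_r, Cexp_RtoC.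
  destruct (Rle_dec (-1) t) as [Ht|Ht].
  - apply Rle_trans with (C * exp b * exp (- (b * Rabs t)))%R; [|apply Rmult_le_compat_r; lra].
    specialize (H (t + 1)%R ltac:(lra)). unfold zline in H.
    replace (t + 1 - 1)%R with t in H by ring.
    apply Rle_trans with (exp (Re s * t) * (C * exp (- (2 * Re s * (t + 1)))))%R.
    + apply Rmult_le_compat_l; [left; apply exp_pos|exact H].
    + replace (exp (Re s * t) * (C * exp (- (2 * Re s * (t + 1)))))%R with
        (C * (exp (Re s * t) * exp (- (2 * Re s * (t + 1)))))%R by ring.
      rewrite (Rmult_assoc C). apply Rmult_le_compat_l; auto.
      rewrite <- !exp_plus. apply exp_le_exp. unfold b in *.
      destruct (Rle_dec 0 t) as [H0|H0].
      * rewrite Rabs_pos_eq; auto. nra.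
      * rewrite Rabs_left; [|lra]. nra.
  - apply Rle_trans with (2 * INR (S n) * exp (- (b * Rabs t)))%R; [|apply Rmult_le_compat_r; lra].
    assert (Hx : RtoC (exp t) <> 0).
    { apply RtoC_neq_0, Rgt_not_eq, exp_pos. }
    assert (Em : Cmod (RtoC (exp t)) = exp t).
    { rewrite Cmod_RtoC, Rabs_pos_eq; auto. left. apply exp_pos. }
    assert (B := zkernel_near_0 n (RtoC (exp t)) Hx). rewrite Em in B.
    specialize (B ltac:(apply exp_le_exp; lra)).
    apply Rle_trans with (exp (Re s * t) * (2 * INR (S n) / exp t))%R.
    + apply Rmult_le_compat_l; [left; apply exp_pos|exact B].
    + unfold Rdiv. rewrite <- exp_Ropp.
      replace (exp (Re s * t) * (2 * INR (S n) * exp (- t)))%R with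
        (2 * INR (S n) * (exp (Re s * t) * exp (- t)))%R by ring.
      apply Rmult_le_compat_l; [lra|]. rewrite <- exp_plus. apply exp_le_exp.
      rewrite Rabs_left; [|lra]. unfold b. lra.
Qed.

(** No pole satisfies [exp (- T) <= |z| <= 1/e], so by Goursat's theorem the inner circle can be
    shrunk to the origin; its contribution is of order [exp (- ((Re s - 1) * T))]. *)
Lemma keyhole_right s : (1 < Re s)%R -> exists J,
  is_lint (fun t => log_integrand (zkernel n) s (RtoC t)) J /\
  (1 - Cexp (2 * PI * Ci * s)) * J = keyhole n I0 s.
Proof.
  intros Hs. assert (Hpi := PI_RGT_0).
  set (F := fun t => log_integrand (zkernel n) s (RtoC t)).
  assert (HF : forall t, cont RtoC F t).
  { intros t. apply holo_log_line, holo_zkernel_exp. }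
  destruct (log_integrand_zkernel_bound s Hs) as [C [HC HB]].
  destruct (lint_ex F C (Re s - 1) ltac:(lra) HC HF HB) as [J [HJ _]].
  exists J. split; [exact HJ|].
  set (c := 1 - Cexp (2 * PI * Ci * s)).
  set (K := (2 * PI * exp (2 * PI * Rabs (Im s)) * (2 * INR (S n)))%R).
  assert (PS : (0 < INR (S n))%R) by (apply lt_0_INR; lia).
  assert (HK : (0 <= K)%R).
  { unfold K. assert (P := exp_pos (2 * PI * Rabs (Im s))).
    apply Rmult_le_pos; [|lra]. apply Rmult_le_pos; lra. }
  assert (Hc0 := Cmod_ge_0 c).
  apply C_eq_of_small. intros eps He.
  assert (Q2 : (0 <= Cmod c * Cmod (Cexp (- s)))%R) by (apply Rmult_le_pos; apply Cmod_ge_0).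
  destruct (is_lint_approx F J HF HJ (eps / 3 / (Cmod c + 1))) as [T1 [HT1 K1]];
    [apply div_succ_pos; lra|].
  destruct (HI0 s (eps / 3 / (Cmod c * Cmod (Cexp (- s)) + 1))%R) as [T2 [HT2 K2]];
    [apply div_succ_pos; lra|].
  destruct (exp_decay_small K (Re s - 1) (eps / 3)) as [T3 [HT3 K3]]; [lra|lra|lra|].
  destruct (upper_bound4 T1 1 T2 T3) as (T & A1 & A2 & A3 & A4).
  specialize (K1 T T ltac:(lra) ltac:(lra)). specialize (K2 (T + 1)%R ltac:(lra)).
  specialize (K3 T ltac:(lra)).
  assert (G : rect (log_integrand (zkernel n) s) (- T) (- 1) 0 (2 * PI) = 0).
  { apply goursat; try lra. intros w [[_ Hw] _]. apply holo_log_integrand, holo_zkernel.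
    apply rem_near_0_neq_0; [apply Cexp_neq_0|]. rewrite Cmod_Cexp. now apply exp_le_exp. }
  rewrite rect_log_integrand in G; [|lra|intros; apply holo_zkernel_exp].
  fold c in G. fold F in G.
  assert (B : (Cmod (log_arc (zkernel n) s (- T)) <= K * exp (- ((Re s - 1) * T)))%R).
  { eapply Rle_trans.
    - apply (log_arc_bound (zkernel n) s (- T) (2 * INR (S n) * exp T)).
      + assert (P := exp_pos T). apply Rmult_le_pos; lra.
      + intros z Hz. apply holo_zkernel, rem_near_0_neq_0.
        * apply Cmod_gt_0. rewrite Hz. apply exp_pos.
        * rewrite Hz. apply exp_le_exp. lra.
      + intros z Hz. replace (2 * INR (S n) * exp T)%R with (2 * INR (S n) / Cmod z)%R.
        * apply zkernel_near_0.
          -- apply Cmod_gt_0. rewrite Hz. apply exp_pos.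
          -- rewrite Hz. apply exp_le_exp. lra.
        * rewrite Hz, exp_Ropp. field. apply Rgt_not_eq, exp_pos.
    - unfold K. replace (- ((Re s - 1) * T))%R with (T + Re s * - T)%R by ring.
      rewrite exp_plus. right. ring. }
  rewrite (CI_Chasles F (- T) (- 1) T) in K1; try lra; [|intros t _; apply HF].
  assert (E := CI_zkernel_from_m1 n s (T + 1) ltac:(lra)).
  replace (T + 1 - 1)%R with T in E by ring. fold F in E. rewrite E in K1.
  unfold keyhole. fold c.
  set (X := CI F (- T) (- 1)) in *. set (Y := CI (fun t => Cexp (s * RtoC t) * zline n t) 0 (T + 1)) in *.
  set (V1 := log_arc (zkernel n) s (- 1)) in *. set (V2 := log_arc (zkernel n) s (- T)) in *.
  replace (c * J - (c * (Cexp (- s) * I0 s) - Ci * V1)) with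
    (- (c * (X + Cexp (- s) * Y - J)) + ((c * Cexp (- s)) * (Y - I0 s) + ((c * X + Ci * (V1 - V2)) + Ci * V2))) by ring.
  rewrite G, Cplus_0_l.
  eapply Rle_trans; [apply Cmod_triangle|].
  eapply Rle_trans; [apply Rplus_le_compat_l, Cmod_triangle|].
  rewrite Cmod_opp. rewrite (Cmod_mult c (X + _ - _)), (Cmod_mult Ci), Cmod_Ci, (Cmod_mult (c * _)), (Cmod_mult c (Cexp _)).
  assert (B1 := mult_lt_div_succ _ _ _ Hc0 (Cmod_ge_0 _) K1).
  assert (B2 := mult_lt_div_succ _ _ _ Q2 (Cmod_ge_0 _) K2).
  lra.
Qed.

End Keyhole.

(** * Residues inside a large circle *)

Lemma angle_unique a b : (0 <= a <= 2 * PI)%R -> (0 < b < 2 * PI)%R ->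
  cos a = cos b -> sin a = sin b -> a = b.
Proof.
  intros Ha Hb Hc Hs. set (x := ((a - b) / 2)%R).
  assert (C1 : cos (2 * x) = 1%R).
  { unfold x. replace (2 * ((a - b) / 2))%R with (a - b)%R by field.
    rewrite cos_minus, Hc, Hs. assert (Q := sin2_cos2 b). unfold Rsqr in Q. lra. }
  rewrite cos_2a_sin in C1.
  assert (S0 : sin x = 0%R).
  { apply Rsqr_0_uniq. unfold Rsqr. lra. }
  assert (Hx : (- PI < x < PI)%R) by (unfold x; lra).
  assert (x = 0%R).
  { destruct (Rtotal_order x 0) as [H|[H|H]]; auto.
    - assert (Q := sin_gt_0 (- x) ltac:(lra) ltac:(lra)). rewrite sin_neg in Q. lra.
    - assert (Q := sin_gt_0 x H ltac:(lra)). lra. }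
  unfold x in *. lra.
Qed.

Lemma Cexp_ln_pair r a : (0 < r)%R -> Cexp (ln r, a) = RtoC r * Cexp (Ci * RtoC a).
Proof. intros H. rewrite Cexp_pair, exp_ln, Cexp_Ci; auto. Qed.

Lemma Cmod_polar r a : (0 < r)%R -> Cmod (RtoC r * Cexp (Ci * RtoC a)) = r.
Proof.
  intros H. rewrite Cmod_mult, Cmod_RtoC, Rabs_pos_eq; [|lra].
  rewrite Cexp_Ci, Cmod_cos_sin. ring.
Qed.

Lemma Cexp_pair_eq w r a : (0 < r)%R -> (0 <= Im w <= 2 * PI)%R -> (0 < a < 2 * PI)%R ->
  Cexp w = RtoC r * Cexp (Ci * RtoC a) -> w = (ln r, a).
Proof.
  intros Hr Hw Ha E.
  assert (Em := f_equal Cmod E). rewrite Cmod_Cexp, Cmod_polar in Em; auto.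
  assert (Ere : Re w = ln r) by (rewrite <- Em, ln_exp; reflexivity).
  rewrite Cexp_Ci in E. unfold Cexp in E. rewrite Em in E.
  assert (E1 := f_equal Re E). assert (E2 := f_equal Im E). simpl in E1, E2.
  assert (K1 : cos (Im w) = cos a) by (apply Rmult_eq_reg_l with r; lra).
  assert (K2 : sin (Im w) = sin a) by (apply Rmult_eq_reg_l with r; lra).
  apply C_ext; [exact Ere|]. simpl. now apply angle_unique.
Qed.

Lemma fold_sum_app {A} (f : A -> C) l1 l2 :
  fold_right (fun p a => f p + a) 0 (l1 ++ l2) =
  fold_right (fun p a => f p + a) 0 l1 + fold_right (fun p a => f p + a) 0 l2.
Proof. induction l1 as [|x l1 IH]; simpl; [ring|]. rewrite IH. ring. Qed.

Lemma fold_sum_map {A B} (f : B -> C) (g : A -> B) l :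
  fold_right (fun p a => f p + a) 0 (map g l) = fold_right (fun p a => f (g p) + a) 0 l.
Proof. induction l as [|x l IH]; simpl; [reflexivity|]. now rewrite IH. Qed.

Lemma fold_sum_seq (f : nat -> C) K :
  fold_right (fun p a => f p + a) 0 (seq 0 (S K)) = sum_n (G := C_AbelianMonoid) f K.
Proof.
  induction K as [|K IH].
  - simpl. rewrite sum_O. ring.
  - rewrite sum_Sn, <- IH, seq_S, fold_sum_app. simpl. unfold plus; simpl. ring.
Qed.

Lemma fold_sum_plus {A} (f g : A -> C) l :
  fold_right (fun p a => f p + a) 0 l + fold_right (fun p a => g p + a) 0 l =
  fold_right (fun p a => (f p + g p) + a) 0 l.
Proof. induction l as [|x l IH]; simpl; [ring|]. rewrite <- IH. ring. Qed.

Lemma fold_sum_scal {A} (f g : A -> C) c l : (forall x, f x = c * g x) ->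
  fold_right (fun p a => f p + a) 0 l = c * fold_right (fun p a => g p + a) 0 l.
Proof. intros H. induction l as [|x l IH]; simpl; [ring|]. rewrite IH, H. ring. Qed.

Lemma NoDup_map_inj {A B} (f : A -> B) l : (forall x y, f x = f y -> x = y) -> NoDup l -> NoDup (map f l).
Proof. intros Hf HN. apply FinFun.Injective_map_NoDup; auto. Qed.

(** At a zero [z = Cexp p] of [rem (S n)] its derivative [rem n z] equals [z^n / n!], which cancels
    the numerator; what remains is [Cexp (s * p)] divided by [dz/dw = Cexp p]. *)
Lemma zkernel_residue n s p : rem (S n) (Cexp p) = 0 ->
  residue_limit (log_integrand (zkernel n) s) p (Cexp ((s - 1) * p)).
Proof.
  intros H0.
  set (f := fun w => Cexp (s * w) * (Cexp w ^ n / RtoC (INR (fact n)))).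
  set (l := rem n (Cexp p) * Cexp p).
  assert (Hl : rem n (Cexp p) = Cexp p ^ n / RtoC (INR (fact n))) by now apply rem_pred_at_zero.
  assert (Hpn : Cexp p ^ n <> 0) by apply Cpow_nz, Cexp_neq_0.
  assert (Hf := RtoC_fact_neq_0 n).
  assert (Hp := Cexp_neq_0 p).
  assert (Hrn : rem n (Cexp p) <> 0).
  { rewrite Hl. intros E. apply Hpn.
    replace (Cexp p ^ n) with (Cexp p ^ n / RtoC (INR (fact n)) * RtoC (INR (fact n))) by (field; auto).
    rewrite E. ring. }
  assert (K : residue_limit (fun w => f w / rem (S n) (Cexp w)) p (f p / l)).
  { apply (residue_limit_quotient f (fun w => rem (S n) (Cexp w))).
    - apply cont_mult.
      + apply cont_Cexp. apply cont_mult; [apply cont_const|apply (cont_iota cid)].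
      + unfold Cdiv. apply cont_mult; [|apply cont_const]. apply cont_pow.
        apply holo_cont, holo_Cexp.
    - eapply der_eq; [apply (der_comp cid (rem (S n)) Cexp); [apply der_Cexp|apply der_rem]|].
      reflexivity.
    - exact H0.
    - unfold l. now apply Cmult_neq_0. }
  replace (Cexp ((s - 1) * p)) with (f p / l).
  - intros eps He. destruct (K eps He) as [d [Hd Kd]]. exists d. split; auto.
    intros z Hz Hzd. specialize (Kd z Hz Hzd).
    replace (log_integrand (zkernel n) s z) with (f z / rem (S n) (Cexp z)); auto.
    unfold log_integrand, zkernel, f. unfold Cdiv at 1.
    (* At another zero of the denominator both quotients have the default value [0], because
       [/ 0 = 0]. *)
    destruct (Ceq_dec (rem (S n) (Cexp z)) 0) as [E|E]; [|field; auto].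
    rewrite E. unfold Cdiv. rewrite Cmult_0_r.
    replace (/ 0) with (RtoC 0); [ring|]. apply C_ext; simpl; unfold Rdiv; ring.
  - unfold f, l. rewrite Hl.
    replace ((s - 1) * p) with (s * p - p) by ring. rewrite Cexp_minus. field. auto.
Qed.

Section Left.
Variables (n : nat) (I0 : C -> C) (r theta : nat -> R).
Hypothesis HI0 : forall s, is_rint (fun t => Cexp (s * RtoC t) * zline n t) (I0 s).
Hypothesis Hr : forall k, (0 < r k)%R.
Hypothesis Htheta : forall k, (0 < theta k < PI)%R.
Let z (k : nat) : C := RtoC (r k) * Cexp (Ci * RtoC (theta k)).
Hypothesis Hzero : forall k, rem (S n) (z k) = 0.
Hypothesis Hall : forall w, rem (S n) w = 0 -> (0 < Im w)%R -> exists k, z k = w.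
Hypothesis Hinj : forall j k, z j = z k -> j = k.
Hypothesis Hmono : forall k, (Cmod (z k) <= Cmod (z (S k)))%R.

Lemma Cmod_zero_seq k : Cmod (z k) = r k.
Proof. apply Cmod_polar, Hr. Qed.

(** Logarithms with [0 < Im w < 2 PI]: [pole] for [z k] and [pole'] for its conjugate, whose
    argument in this range is [2 PI - theta k]. *)
Let pole (k : nat) : C := (ln (r k), theta k).
Let pole' (k : nat) : C := (ln (r k), (2 * PI - theta k)%R).

Lemma Cexp_pole k : Cexp (pole k) = z k.
Proof. apply Cexp_ln_pair, Hr. Qed.

Lemma Cexp_pole' k : Cexp (pole' k) = Cconj (z k).
Proof.
  unfold pole'. rewrite Cexp_ln_pair; auto. unfold z.
  rewrite Cmult_conj, Cconj_RtoC, !Cexp_Ci. f_equal.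
  replace (2 * PI - theta k)%R with (- theta k + 2 * PI)%R by ring.
  rewrite cos_plus, sin_plus, cos_2PI, sin_2PI, cos_neg, sin_neg.
  apply C_ext; simpl; ring.
Qed.

(** The arguments [theta k] and [2 PI - theta k] are symmetric about [PI]. Taking out
    [e^(PI i (s - 1)) = - e^(PI i s)] leaves exponentials with opposite exponents, whose sum is
    twice the cosine. *)
Lemma pole_sum s k : Cexp ((s - 1) * pole k) + Cexp ((s - 1) * pole' k) =
  - (2 * Cexp (PI * Ci * s)) *
  (Rpow_C (r k) (s - RtoC 1) * Ccos ((s - RtoC 1) * RtoC (PI - theta k))).
Proof.
  set (u := s - 1). set (a := (PI - theta k)%R).
  assert (E1 : u * pole k = u * RtoC (ln (r k)) + (u * (PI * Ci) + - (Ci * (u * RtoC a)))).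
  { unfold pole, a. apply C_ext; destruct u; simpl; ring. }
  assert (E2 : u * pole' k = u * RtoC (ln (r k)) + (u * (PI * Ci) + Ci * (u * RtoC a))).
  { unfold pole', a. apply C_ext; destruct u; simpl; ring. }
  assert (E3 : Cexp (u * (PI * Ci)) = - Cexp (PI * Ci * s)).
  { unfold u. replace ((s - 1) * (PI * Ci)) with (PI * Ci * s + - (Ci * RtoC PI)) by ring.
    rewrite Cexp_plus, Cexp_opp, Cexp_Ci, cos_PI, sin_PI.
    replace ((-1)%R, 0%R) with (- (1)) by (apply C_ext; simpl; ring). field. }
  rewrite E1, E2, !Cexp_plus, E3. unfold Rpow_C, Ccos. field.
Qed.

Lemma zkernel_poles_listed K (rho : R) w : (1 <= rho)%R ->
  (forall z, Cmod z = rho -> rem (S n) z <> 0) ->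
  (forall k, (K <= k)%nat -> (rho <= r k)%R) ->
  in_box (- 1) (ln rho) 0 (2 * PI) w -> rem (S n) (Cexp w) = 0 ->
  In w (map pole (seq 0 K) ++ map pole' (seq 0 K)).
Proof.
  intros Hrho Hcirc HK [[Hw1 Hw2] Hw3] H0. assert (Hpi := PI_RGT_0).
  assert (Hm : (Cmod (Cexp w) <= rho)%R).
  { rewrite Cmod_Cexp, <- (exp_ln rho); [|lra]. now apply exp_le_exp. }
  assert (Hidx : forall k, r k = Cmod (Cexp w) -> (k < K)%nat).
  { intros k Ek. apply Nat.nle_gt. intros HKk. specialize (HK k HKk).
    apply (Hcirc (Cexp w)); auto. lra. }
  destruct (Rtotal_order (Im (Cexp w)) 0) as [Hi|[Hi|Hi]].
  - destruct (Hall (Cconj (Cexp w))) as [k Ek].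
    { rewrite rem_conj, H0. apply Cconj_RtoC. }
    { rewrite im_conj. lra. }
    apply in_or_app. right. apply in_map_iff. exists k.
    assert (Er : r k = Cmod (Cexp w)) by (rewrite <- Cmod_zero_seq, Ek; apply Cmod_conj).
    split; [|apply in_seq; specialize (Hidx k Er); lia].
    symmetry. apply Cexp_pair_eq; auto; [specialize (Htheta k); lra|].
    rewrite <- Cexp_ln_pair; auto. change (Cexp w = Cexp (pole' k)).
    rewrite Cexp_pole', Ek. now rewrite Cconj_conj.
  - exfalso. apply (rem_real_neq_0 (S n) (Cexp w)); auto. apply Cexp_neq_0.
  - destruct (Hall (Cexp w) H0 Hi) as [k Ek].
    apply in_or_app. left. apply in_map_iff. exists k.
    assert (Er : r k = Cmod (Cexp w)) by (rewrite <- Cmod_zero_seq, Ek; reflexivity).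
    split; [|apply in_seq; specialize (Hidx k Er); lia].
    symmetry. apply Cexp_pair_eq; auto. specialize (Htheta k). lra.
Qed.

Lemma keyhole_rect s m K : (1 <= circle_radius n m)%R ->
  (forall z, Cmod z = circle_radius n m -> rem (S n) z <> 0) ->
  (forall k, (k < S K)%nat -> (r k < circle_radius n m)%R) ->
  (forall k, (S K <= k)%nat -> (circle_radius n m <= r k)%R) ->
  rect (log_integrand (zkernel n) s) (- 1) (ln (circle_radius n m)) 0 (2 * PI) =
  - (4 * PI * Ci * Cexp (PI * Ci * s)) *
  sum_n (G := C_AbelianMonoid) (fun k => Rpow_C (r k) (s - RtoC 1) *
    Ccos ((s - RtoC 1) * RtoC (PI - theta k))) K.
Proof.
  intros Hrho Hcirc HK1 HK2. assert (Hpi := PI_RGT_0).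
  set (rho := circle_radius n m) in *.
  assert (Hln : (0 <= ln rho)%R).
  { rewrite <- ln_1. destruct Hrho as [H|H]; [left; apply ln_increasing; lra|rewrite H; lra]. }
  set (S0 := map pole (seq 0 (S K)) ++ map pole' (seq 0 (S K))).
  (* Every zero has modulus greater than [1/e], so all poles lie strictly to the right of the inner
     side. *)
  assert (Hre : forall k, (- 1 < ln (r k))%R).
  { intros k. apply Rnot_le_lt. intros H.
    apply (rem_near_0_neq_0 n (z k)); [| |apply Hzero].
    - apply Cmod_gt_0. now rewrite Cmod_zero_seq.
    - rewrite Cmod_zero_seq. rewrite <- (exp_ln (r k)); auto. now apply exp_le_exp. }
  assert (HS : forall p, In p S0 -> exists k, (k < S K)%nat /\ (p = pole k \/ p = pole' k)).
  { intros p Hp. apply in_app_or in Hp.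
    destruct Hp as [Hp|Hp]; apply in_map_iff in Hp; destruct Hp as [k [<- Hk]];
      apply in_seq in Hk; exists k; (split; [lia|tauto]). }
  rewrite (residue_rect (fun p => Cexp ((s - 1) * p)) (- 1) (ln rho) 0 (2 * PI) S0); try lra.
  - unfold S0. rewrite fold_sum_app, !fold_sum_map, fold_sum_plus.
    rewrite (fold_sum_scal _ _ _ _ (pole_sum s)), fold_sum_seq. ring.
  - unfold S0. apply NoDup_app.
    + apply NoDup_map_inj; [|apply seq_NoDup]. intros j k E. apply Hinj. now rewrite <- !Cexp_pole, E.
    + apply NoDup_map_inj; [|apply seq_NoDup]. intros j k E. apply Hinj.
      rewrite <- (Cconj_conj (z j)), <- (Cconj_conj (z k)), <- !Cexp_pole', E. reflexivity.
    + intros p Hp Hp'. apply in_map_iff in Hp. apply in_map_iff in Hp'.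
      destruct Hp as [j [Ej _]]. destruct Hp' as [k [Ek _]].
      rewrite <- Ej in Ek. apply (f_equal Im) in Ek. unfold pole, pole' in Ek. simpl in Ek.
      assert (A := Htheta j). assert (B := Htheta k). lra.
  - intros p Hp. destruct (HS p Hp) as [k [Hk Ep]]. specialize (Hre k). assert (A := Htheta k).
    assert (B : (ln (r k) < ln rho)%R) by (apply ln_increasing; auto).
    destruct Ep as [->| ->]; unfold strictly_in, pole, pole'; simpl; lra.
  - intros w Hw HwS. apply holo_log_integrand, holo_zkernel. intros E. apply HwS.
    apply (zkernel_poles_listed (S K) rho); auto.
  - intros p Hp. apply zkernel_residue. destruct (HS p Hp) as [k [Hk [->| ->]]].
    + rewrite Cexp_pole. apply Hzero.
    + rewrite Cexp_pole', rem_conj, Hzero. apply Cconj_RtoC.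
Qed.

(** On the circles of [circle_bound] the kernel is at most [4], so the outer arc is of order
    [rho^(Re s)] and vanishes in the limit. Only these radii are available, which gives some of the
    partial sums; the convergence of the whole series is therefore a hypothesis. *)
Lemma keyhole_left s L : (Re s < 0)%R ->
  is_series (K := C_AbsRing) (V := C_NormedModule)
    (fun k => Rpow_C (r k) (s - RtoC 1) * Ccos ((s - RtoC 1) * RtoC (PI - theta k))) L ->
  keyhole n I0 s = - (4 * PI * Ci * Cexp (PI * Ci * s)) * L.
Proof.
  intros Hs HL. assert (Hpi := PI_RGT_0).
  set (a := fun k => Rpow_C (r k) (s - RtoC 1) * Ccos ((s - RtoC 1) * RtoC (PI - theta k))) in *.
  set (c := 1 - Cexp (2 * PI * Ci * s)). set (q := 4 * PI * Ci * Cexp (PI * Ci * s)).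
  destruct (circle_bound n) as [R0 [HR0 Hcirc]].
  set (M := (2 * PI * exp (2 * PI * Rabs (Im s)) * 4)%R).
  assert (HM : (0 <= M)%R).
  { unfold M. assert (P := exp_pos (2 * PI * Rabs (Im s))). apply Rmult_le_pos; [|lra].
    apply Rmult_le_pos; lra. }
  assert (Hc0 := Cmod_ge_0 c). assert (Hq0 := Cmod_ge_0 q).
  assert (Hcs : (0 <= Cmod c * Cmod (Cexp (- s)))%R) by (apply Rmult_le_pos; apply Cmod_ge_0).
  apply C_eq_of_small. intros eps He.
  destruct (HI0 s (eps / 3 / (Cmod c * Cmod (Cexp (- s)) + 1))%R) as [T1 [HT1 K1]];
    [apply div_succ_pos; lra|].
  destruct (is_series_C_eps a L HL (eps / 3 / (Cmod q + 1))%R) as [N1 HN1]; [apply div_succ_pos; lra|].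
  destruct (exp_decay_small M (- Re s) (eps / 3)) as [T2 [HT2 K2]]; [lra|lra|lra|].
  (* One summand for each requirement; [r N1] puts the zero of index [N1] inside the circle, so that
     the partial sum is beyond [N1]. *)
  set (rho0 := (R0 + exp T1 + exp T2 + r N1 + 1)%R).
  assert (E1 := exp_pos T1). assert (E2 := exp_pos T2). assert (Hr1 := Hr N1).
  destruct (INR_unbounded rho0) as [m Hm].
  set (rho := circle_radius n m).
  assert (Hrho : (rho0 < rho)%R).
  { unfold rho, circle_radius. assert (Q := pos_INR m). assert (Q2 := pos_INR n).
    assert (P3 := PI2_3_2). unfold PI2 in P3.
    assert (0 <= INR n * (PI / 2))%R by (apply Rmult_le_pos; lra).
    assert (INR m <= 2 * PI * INR m)%R by nra. lra. }
  assert (Hrho1 : (1 <= rho)%R) by (unfold rho0 in Hrho; lra).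
  assert (Hc : forall z, Cmod z = rho -> (Cmod z ^ n / INR (fact n) / 4 <= Cmod (rem (S n) z))%R).
  { intros w Hw. apply (Hcirc m); auto. unfold rho0 in Hrho. fold rho. lra. }
  assert (Hne : forall z, Cmod z = rho -> rem (S n) z <> 0).
  { intros w Hw E. specialize (Hc w Hw). rewrite E, Cmod_0, Hw in Hc.
    assert (Q := monomial_pos n rho Hrho1). lra. }
  destruct (zeros_count_below n z Hzero Hinj Hmono rho) as [K' [HK1 HK2]].
  assert (HKN : (N1 < K')%nat).
  { apply Nat.nle_gt. intros H. specialize (HK2 N1 H). rewrite Cmod_zero_seq in HK2.
    unfold rho0 in Hrho. lra. }
  (* [sum_n] includes its upper index, so [K + 1] enclosed zeros correspond to the partial sum at
     [K]. *)
  destruct K' as [|K]; [lia|].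
  assert (R := keyhole_rect s m K Hrho1 Hne
    (fun k Hk => eq_ind _ (fun t => (t < rho)%R) (HK1 k Hk) _ (Cmod_zero_seq k))
    (fun k Hk => eq_ind _ (fun t => (rho <= t)%R) (HK2 k Hk) _ (Cmod_zero_seq k))).
  fold a rho q in R.
  assert (Hln : (0 <= ln rho)%R).
  { rewrite <- ln_1. destruct Hrho1 as [H|H]; [left; apply ln_increasing; lra|rewrite H; lra]. }
  assert (HlnT : forall T, (exp T < rho)%R -> (T <= ln rho)%R).
  { intros T HT. left. rewrite <- (ln_exp T). apply ln_increasing; auto. apply exp_pos. }
  assert (L1 := HlnT T1 ltac:(unfold rho0 in Hrho; lra)).
  assert (L2 := HlnT T2 ltac:(unfold rho0 in Hrho; lra)).
  rewrite rect_log_integrand in R; [|lra|intros; apply holo_zkernel_exp].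
  assert (E := CI_zkernel_from_m1 n s (ln rho + 1) ltac:(lra)).
  replace (ln rho + 1 - 1)%R with (ln rho) in E by ring. rewrite E in R. fold c in R.
  specialize (K1 (ln rho + 1)%R ltac:(lra)). specialize (K2 (ln rho) L2).
  specialize (HN1 K ltac:(lia)).
  assert (B : (Cmod (log_arc (zkernel n) s (ln rho)) <= M * exp (- (- Re s * ln rho)))%R).
  { eapply Rle_trans.
    - apply (log_arc_bound (zkernel n) s (ln rho) 4); [lra| |]; intros w Hw;
        rewrite exp_ln in Hw; try lra.
      + now apply holo_zkernel, Hne.
      + rewrite <- (Rinv_inv 4). apply zkernel_bound; [lra| |now apply Hne].
        specialize (Hc w Hw). assert (Pf := fact_pos n).
        apply Rmult_le_compat_l with (r := INR (fact n)) in Hc; [|lra].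
        eapply Rle_trans; [|exact Hc]. right. field. lra.
    - unfold M. replace (- (- Re s * ln rho))%R with (Re s * ln rho)%R by ring. lra. }
  unfold keyhole. fold c.
  set (Y := CI (fun t => Cexp (s * RtoC t) * zline n t) 0 (ln rho + 1)) in *.
  set (V1 := log_arc (zkernel n) s (- 1)) in *. set (V2 := log_arc (zkernel n) s (ln rho)) in *.
  set (A := sum_n (G := C_AbelianMonoid) a K) in *.
  replace (c * (Cexp (- s) * I0 s) - Ci * V1 - - q * L) with
    (- ((c * Cexp (- s)) * (Y - I0 s)) + ((c * (Cexp (- s) * Y) + Ci * (V2 - V1)) + (q * L - Ci * V2))) by ring.
  rewrite R.
  replace (- q * A + (q * L - Ci * V2)) with (- (q * (A - L)) - Ci * V2) by ring.
  eapply Rle_trans; [apply Cmod_triangle|].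
  eapply Rle_trans; [apply Rplus_le_compat_l, Cmod_minus_triangle|].
  rewrite !Cmod_opp. rewrite (Cmod_mult (c * _)), (Cmod_mult c), (Cmod_mult q), (Cmod_mult Ci), Cmod_Ci.
  assert (B1 := mult_lt_div_succ _ _ _ Hq0 (Cmod_ge_0 _) HN1).
  assert (B2 := mult_lt_div_succ _ _ _ Hcs (Cmod_ge_0 _) K1).
  lra.
Qed.

End Left.

(** * Analytic continuation *)

Lemma rising_add z k m : rising z (k + m) = rising z k * rising (z + RtoC (INR k)) m.
Proof.
  induction m as [|m IH].
  - rewrite Nat.add_0_r. simpl. ring.
  - rewrite Nat.add_succ_r. simpl. rewrite IH, plus_INR, RtoC_plus. ring.
Qed.

Lemma rising_neq_0 z m : (forall j, (j < m)%nat -> z + RtoC (INR j) <> 0) -> rising z m <> 0.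
Proof.
  induction m as [|m IH]; intros H; simpl; [apply C1_nz|].
  apply Cmult_neq_0; [apply IH; intros; apply H; lia|apply H; lia].
Qed.

Lemma rising_pos_neq_0 z m : (0 < Re z)%R -> rising z m <> 0.
Proof.
  intros Hz. apply rising_neq_0. intros j _ E. apply (f_equal Re) in E.
  rewrite re_plus in E. simpl in E. assert (Q := pos_INR j). lra.
Qed.

(** The factors are those of [rising s n], negated and in reverse order. This is the origin of the
    sign [(-1)^(N-1)] in the theorem. *)
Lemma rising_reflect s n : rising (1 - s - RtoC (INR n)) n = (- (1)) ^ n * rising s n.
Proof.
  induction n as [|n IH]; [simpl; ring|].
  rewrite rising_S_l. replace (1 - s - RtoC (INR (S n)) + 1) with (1 - s - RtoC (INR n)).
  - rewrite IH, S_INR, RtoC_plus. simpl. ring.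
  - rewrite S_INR, RtoC_plus. ring.
Qed.

Lemma holo_rising n s : holo (fun s => rising s n) s.
Proof.
  induction n as [|n IH]; [exact (holo_const 1 s)|].
  apply (holo_mult (fun s => rising s n) (fun s => s + RtoC (INR n))); auto.
  apply holo_plus; [apply holo_id|apply holo_const].
Qed.

Lemma up_to_nat_spec x : (x < INR (Z.to_nat (up x)))%R /\
  forall n, (x < INR n)%R -> (Z.to_nat (up x) <= S n)%nat.
Proof.
  destruct (archimed x) as [A B]. split.
  - destruct (Z_le_gt_dec 0 (up x)) as [H|H].
    + rewrite INR_IZR_INZ, Z2Nat.id; auto.
    + assert (Q : (IZR (up x) <= 0)%R) by (apply IZR_le; lia).
      assert (P := pos_INR (Z.to_nat (up x))). lra.
  - intros n Hn. assert (up x < Z.of_nat n + 1 + 1)%Z; [|lia].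
    apply lt_IZR. rewrite !plus_IZR, <- INR_IZR_INZ. lra.
Qed.

(** [CGamma] stops at its own shift [k] into the right half-plane; the remaining [n - k] shifts take
    place there, by the functional equation of the integral. *)
Lemma CGamma_rising w n : (1 < Re w + INR n)%R ->
  (forall m, w <> - RtoC (INR m)) -> CGamma w * rising w n = Gamma_integral (w + RtoC (INR n)).
Proof.
  intros Hw Hm. unfold CGamma.
  destruct (up_to_nat_spec (- Re w)) as [A B].
  set (k := Z.to_nat (up (- Re w))) in *.
  assert (Hne : forall j, w + RtoC (INR j) <> 0).
  { intros j E. apply (Hm j). replace w with ((w + RtoC (INR j)) - RtoC (INR j)) by ring.
    rewrite E. ring. }
  assert (Hk : (k <= n)%nat).
  { destruct n as [|n].
    - simpl in Hw. unfold k. assert (U := proj2 (archimed (- Re w))).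
      assert (up (- Re w) < 1)%Z; [|lia]. apply lt_IZR. lra.
    - apply B. rewrite S_INR in Hw. lra. }
  replace n with (k + (n - k))%nat at 1 by lia.
  rewrite rising_add.
  replace (w + RtoC (INR n)) with (w + RtoC (INR k) + RtoC (INR (n - k))).
  - rewrite (Gamma_integral_rising (w + RtoC (INR k))).
    + field. now apply rising_neq_0.
    + rewrite re_plus. simpl. lra.
  - rewrite minus_INR, RtoC_minus; auto. ring.
Qed.

Lemma CGamma_pos w : (0 < Re w)%R -> CGamma w = Gamma_integral w.
Proof.
  intros Hw. unfold CGamma.
  assert (E : Z.to_nat (up (- Re w)) = 0%nat).
  { assert (U := proj2 (archimed (- Re w))).
    assert (up (- Re w) < 1)%Z; [|lia]. apply lt_IZR. lra. }
  rewrite E. simpl. replace (w + 0) with w by ring. field.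
Qed.

Lemma hzeta_integrand_log n s t :
  RtoC (exp t) * (Rpow_C (exp t) (s + RtoC (INR (S n)) - RtoC 2) / exp_remainder (S n) (RtoC (exp t))) =
  RtoC (INR (fact n)) * log_integrand (zkernel n) s (RtoC t).
Proof.
  rewrite exp_remainder_rem, Rpow_C_exp; [|lia].
  unfold log_integrand, zkernel. rewrite Cexp_RtoC.
  assert (H1 := rem_pos_neq_0 (S n) (exp t) (exp_pos t)).
  assert (H2 : RtoC (exp t) <> 0).
  { apply RtoC_neq_0, Rgt_not_eq, exp_pos. }
  replace ((s + RtoC (INR (S n)) - RtoC 2) * RtoC t) with
    (s * RtoC t + (RtoC (INR n) * RtoC t - RtoC t)).
  2:{ rewrite S_INR, RtoC_plus. ring. }
  rewrite Cexp_plus, Cexp_minus, Cexp_nat_mult, Cexp_RtoC. field.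
  repeat split; auto. apply RtoC_fact_neq_0.
Qed.

Lemma is_rint_scal c F l : (forall t, (0 <= t)%R -> cont RtoC F t) -> is_rint F l ->
  is_rint (fun t => c * F t) (c * l).
Proof.
  intros Hc H eps He. assert (Q := Cmod_ge_0 c).
  destruct (H (eps / 2 / (Cmod c + 1))%R) as [T0 [HT0 K]]; [apply div_succ_pos; lra|].
  exists T0. split; [exact HT0|]. intros T HT. specialize (K T HT).
  rewrite CI_scal; [|lra|intros t Ht; apply Hc; lra].
  replace (c * CI F 0 T - c * l) with (c * (CI F 0 T - l)) by ring. rewrite Cmod_mult.
  assert (B := mult_lt_div_succ _ _ _ Q (Cmod_ge_0 _) K). lra.
Qed.

Lemma is_rint_ext F G l : (forall t, F t = G t) -> is_rint F l -> is_rint G l.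
Proof.
  intros E H eps He. destruct (H eps He) as [T0 [HT0 K]]. exists T0. split; [exact HT0|].
  intros T HT. rewrite <- (CI_ext F G 0 T); [auto|lra|auto].
Qed.

Lemma hzeta_integral_Cint n s J :
  is_lint (fun t => log_integrand (zkernel n) s (RtoC t)) J ->
  Cint_0_infty (fun x => Rpow_C x (s + RtoC (INR (S n)) - RtoC 2) / exp_remainder (S n) (RtoC x))
  = RtoC (INR (fact n)) * J.
Proof.
  intros [l1 [l2 [H1 [H2 ->]]]].
  assert (HF : forall t, cont RtoC (fun t => log_integrand (zkernel n) s (RtoC t)) t).
  { intros t. apply holo_log_line, holo_zkernel_exp. }
  apply Cint_0_infty_log.
  - intros t. apply cont_ext with (fun t => RtoC (INR (fact n)) * log_integrand (zkernel n) s (RtoC t)).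
    + intros y. symmetry. apply hzeta_integrand_log.
    + apply cont_mult; [apply cont_const|apply HF].
  - exists (RtoC (INR (fact n)) * l1), (RtoC (INR (fact n)) * l2). split; [|split; [|ring]].
    + eapply is_rint_ext; [intros t; symmetry; apply hzeta_integrand_log|].
      apply is_rint_scal; auto.
    + eapply is_rint_ext; [intros t; symmetry; apply hzeta_integrand_log|].
      apply (is_rint_scal _ (fun t => log_integrand (zkernel n) s (RtoC (- t)))); auto.
      intros t _. apply (cont_reflect (fun t => log_integrand (zkernel n) s (RtoC t))), HF.
Qed.

Section Continuation.
Variables (n : nat) (zeta : C -> C) (I0 : C -> C).
Hypothesis HI0 : forall s, is_rint (fun t => Cexp (s * RtoC t) * zline n t) (I0 s).
Hypothesis Hzeta : is_hzeta (S n) zeta.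

(** The bound [2] puts [s - 1] into the strip where the Gamma integral is known not to vanish, and
    the recurrence transfers this to [s + n]. An open strip is enough to start the continuation. *)
Lemma zeta_right s : (1 < Re s < 2)%R ->
  zeta s * (1 - Cexp (2 * PI * Ci * s)) * Gamma_integral (s + RtoC (INR n)) =
  RtoC (INR (fact n)) * keyhole n I0 s.
Proof.
  intros Hs. destruct (keyhole_right n I0 HI0 s (proj1 Hs)) as [J [HJ EJ]].
  rewrite (proj1 Hzeta s (proj1 Hs)). unfold hzeta_integral.
  rewrite (hzeta_integral_Cint n s J HJ).
  replace (s + RtoC (INR (S n)) - RtoC 1) with (s + RtoC (INR n)).
  2:{ rewrite S_INR, RtoC_plus. ring. }
  assert (Pn := pos_INR n).
  rewrite CGamma_pos; [|rewrite re_plus; simpl; lra].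
  assert (HG : Gamma_integral (s + RtoC (INR n)) <> 0).
  { replace (s + RtoC (INR n)) with ((s - 1) + RtoC (INR (S n))).
    2:{ rewrite S_INR, RtoC_plus. ring. }
    assert (Hs1 : (0 < Re (s - 1) < 1)%R).
    { replace (Re (s - 1)) with (Re s - 1)%R by (destruct s; reflexivity). lra. }
    rewrite Gamma_integral_rising; [|lra].
    apply Cmult_neq_0; [apply rising_pos_neq_0; lra|now apply Gamma_integral_neq_0]. }
  rewrite <- EJ. field. exact HG.
Qed.

Definition regular (s : C) : Prop :=
  forall k : Z, (2 - Z.of_nat (S n) <= k <= 1)%Z -> s <> RtoC (IZR k).

Lemma nonreal_regular s : Im s <> 0%R -> regular s.
Proof. intros H k _ E. apply H. now rewrite E. Qed.

Lemma zeta_holo_near s : regular s -> holo_near zeta s.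
Proof. intros H. apply holomorphic_at_holo, (proj1 (proj2 Hzeta)), H. Qed.

Lemma Re_near w z d : (Cmod (w - z) < d)%R -> (Re z - d < Re w < Re z + d)%R.
Proof.
  intros H. assert (Q := re_le_Cmod (w - z)).
  replace (Re (w - z)) with (Re w - Re z)%R in Q by (destruct w, z; reflexivity).
  assert (K := Rabs_def2 _ _ (Rle_lt_trans _ _ _ Q H)). lra.
Qed.

Lemma holo_near_shrink F s (P : C -> Prop) d : (0 < d)%R -> holo_near F s ->
  (forall w, (Cmod (w - s) < d)%R -> holo F w -> P w) ->
  exists d, (0 < d)%R /\ forall w, (Cmod (w - s) < d)%R -> P w.
Proof.
  intros Hd [e [He H]] HP. exists (Rmin d e). split; [now apply Rmin_pos|].
  intros w Hw. apply HP.
  - eapply Rlt_le_trans; [exact Hw|apply Rmin_l].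
  - apply H. eapply Rlt_le_trans; [exact Hw|apply Rmin_r].
Qed.

(* [F1 = 0] is the keyhole formula, valid for [Re s > 1] and continued to [Re s > 0]; the
   reflection formula turns it into [F2 = 0] on the strip, which continues to [Re s < 1]. *)
Let F1 (s : C) : C := zeta s * (1 - Cexp (2 * PI * Ci * s)) * Gamma_integral (s + RtoC (INR n)) -
  RtoC (INR (fact n)) * keyhole n I0 s.

Let F2 (s : C) : C := zeta s * - (2 * PI * Ci * Cexp (PI * Ci * s)) * rising s n -
  RtoC (INR (fact n)) * keyhole n I0 s * Gamma_integral (1 - s).

(** A horizontal segment at height [e] passes by the pole at [1]. *)
Lemma zeta_strip_zero e : e <> 0%R -> zero_near F1 ((1 / 2)%R, e).
Proof.
  intros He. apply identity_segment with ((3 / 2)%R, e).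
  - intros t Ht.
    set (p := ((3 / 2)%R, e) + RtoC t * (((1 / 2)%R, e) - ((3 / 2)%R, e))).
    assert (Hp1 : Re p = (3 / 2 - t)%R) by (unfold p; simpl; field).
    assert (Hp2 : Im p = e) by (unfold p; simpl; field).
    apply (holo_near_shrink zeta p (holo F1) (1 / 4)); [lra| |].
    + apply zeta_holo_near, nonreal_regular. now rewrite Hp2.
    + intros w Hw Hz. apply Re_near in Hw. assert (Pn := pos_INR n).
      apply holo_minus; [apply holo_mult; [apply holo_mult; [exact Hz|]|]|].
      * apply holo_minus; [apply holo_const|apply holo_Cexp_lin].
      * apply (holo_comp Gamma_integral (fun s => s + RtoC (INR n))).
        -- apply holo_plus; [apply holo_id|apply holo_const].
        -- apply holo_Gamma_integral. rewrite re_plus. simpl. lra.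
      * apply holo_mult; [apply holo_const|now apply holo_keyhole].
  - exists (1 / 4)%R. split; [lra|]. intros w Hw. apply Re_near in Hw. simpl in Hw.
    unfold F1. rewrite zeta_right; [ring|lra].
Qed.

(** The path starts at height [1] or [-1], on the side of [s], and so meets the real axis at most at
    its end [s], which is regular by hypothesis. *)
Lemma zeta_left_half s : (Re s < 1)%R -> regular s ->
  zeta s * - (2 * PI * Ci * Cexp (PI * Ci * s)) * rising s n =
  RtoC (INR (fact n)) * keyhole n I0 s * Gamma_integral (1 - s).
Proof.
  intros Hs Hreg.
  set (e := if Rle_dec 0 (Im s) then 1%R else (-1)%R).
  assert (He : (e = 1 /\ 0 <= Im s \/ e = -1 /\ Im s < 0)%R).
  { unfold e. destruct (Rle_dec 0 (Im s)); lra. }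
  clearbody e.
  destruct (zeta_strip_zero e ltac:(lra)) as [d [Hd H1]].
  assert (Z : zero_near F2 s).
  { apply identity_segment with ((1 / 2)%R, e).
    - intros t Ht.
      set (p := ((1 / 2)%R, e) + RtoC t * (s - ((1 / 2)%R, e))).
      assert (Hp1 : Re p = ((1 - t) * (1 / 2) + t * Re s)%R) by (unfold p; destruct s; simpl; field).
      assert (Hp2 : Im p = ((1 - t) * e + t * Im s)%R) by (unfold p; destruct s; simpl; ring).
      assert (Hp : (Re p < 1)%R).
      { rewrite Hp1. destruct (Req_dec t 0) as [->|Ht0]; [lra|].
        assert (0 < t * (1 - Re s))%R by (apply Rmult_lt_0_compat; lra). lra. }
      assert (Rp : regular p).
      { destruct (Req_dec t 1) as [Et|Nt].
        - replace p with s; [exact Hreg|]. unfold p. rewrite Et. ring.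
        - apply nonreal_regular. rewrite Hp2.
          destruct He as [[-> H0]|[-> H0]].
          + assert (0 <= t * Im s)%R by (apply Rmult_le_pos; lra). lra.
          + assert (0 <= t * - Im s)%R by (apply Rmult_le_pos; lra). lra. }
      apply (holo_near_shrink zeta p (holo F2) (1 - Re p)); [lra|now apply zeta_holo_near|].
      intros w Hw Hz. apply Re_near in Hw.
      apply holo_minus; [apply holo_mult; [apply holo_mult; [exact Hz|]|]|].
      + apply (holo_ext (fun s => - (2 * PI * Ci) * Cexp (PI * Ci * s))); [intros; ring|].
        apply holo_mult; [apply holo_const|apply holo_Cexp_lin].
      + apply holo_rising.
      + apply holo_mult; [apply holo_mult; [apply holo_const|now apply holo_keyhole]|].
        apply (holo_comp Gamma_integral (fun s => 1 - s)).
        * apply holo_minus; [apply holo_const|apply holo_id].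
        * apply holo_Gamma_integral.
          replace (Re (1 - w)) with (1 - Re w)%R by (destruct w; reflexivity). lra.
    - exists (Rmin d (1 / 4)). split; [apply Rmin_pos; lra|]. intros w Hw.
      assert (Hw1 := H1 w (Rlt_le_trans _ _ _ Hw (Rmin_l _ _))).
      assert (Hw2 := Re_near _ _ _ (Rlt_le_trans _ _ _ Hw (Rmin_r _ _))). simpl in Hw2.
      (* On the strip, reflection and the recurrence give [F2 w = F1 w * Gamma_integral (1 - w)]. *)
      unfold F2. rewrite <- Gamma_integral_reflection; [|lra].
      unfold F1 in Hw1. rewrite Gamma_integral_rising in Hw1; [|lra].
      match goal with |- ?L = _ => transitivity
        ((zeta w * (1 - Cexp (2 * PI * Ci * w)) * (rising w n * Gamma_integral w) -
         RtoC (INR (fact n)) * keyhole n I0 w) * Gamma_integral (1 - w)); [ring|] end.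
      rewrite Hw1. ring. }
  destruct Z as [d' [Hd' Z]].
  assert (E : F2 s = 0).
  { apply Z. replace (s - s) with (RtoC 0) by ring. now rewrite Cmod_0. }
  unfold F2 in E. now apply Ceq_minus in E.
Qed.

End Continuation.

(* The sequences are indexed from 0.  The second conjunct excludes the points at
   which the Gamma factor has a pole. *)
Theorem theorem4p1 (N : nat) (hN : (1 <= N)%nat)
  (zeta : C -> C) (hzeta : is_hzeta N zeta)
  (r theta : nat -> R)
  (hr : forall k, (0 < r k)%R)
  (htheta : forall k, (0 < theta k < PI)%R)
  (hz : lists_upper_zeros N (fun k => RtoC (r k) * Cexp (Ci * RtoC (theta k))))
  (s : C) (hs : (Re s < 0)%R) :
  exists L : C,
    is_series (K := C_AbsRing) (V := C_NormedModule)
      (fun k => Rpow_C (r k) (s - RtoC 1) *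
                Ccos ((s - RtoC 1) * RtoC (PI - theta k))) L /\
    ((forall m : nat,
        RtoC 1 - (s + RtoC (INR N) - RtoC 1) <> - RtoC (INR m)) ->
     zeta s = RtoC 2 * (- RtoC 1) ^ (N - 1) * RtoC (INR (fact (N - 1))) *
              CGamma (RtoC 1 - (s + RtoC (INR N) - RtoC 1)) * L).
Proof.
  destruct N as [|n]; [lia|]. replace (S n - 1)%nat with n by lia.
  destruct hz as (Hz1 & Hz2 & Hinj & Hmono).
  assert (Hzero : forall k, rem (S n) (RtoC (r k) * Cexp (Ci * RtoC (theta k))) = 0).
  { intros k. rewrite <- exp_remainder_rem; [apply Hz1|lia]. }
  assert (Hall : forall w, rem (S n) w = 0 -> (0 < Im w)%R ->
    exists k, RtoC (r k) * Cexp (Ci * RtoC (theta k)) = w).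
  { intros w Hw. apply Hz2. rewrite exp_remainder_rem; [exact Hw|lia]. }
  destruct (zeros_linear_growth n (fun k => RtoC (r k) * Cexp (Ci * RtoC (theta k)))
    Hzero (fun k => proj2 (Hz1 k)) Hinj Hmono) as [c [Hc Hgrow]].
  destruct (series_converges r theta s c Hc hs) as [L HL]; auto.
  { intros k. specialize (Hgrow k). rewrite Cmod_polar in Hgrow; auto. }
  exists L. split; [exact HL|]. intros Hm.
  destruct (zkernel_tail_fun n) as [I0 HI0].
  assert (HK := keyhole_left n I0 r theta HI0 hr htheta Hzero Hall Hinj Hmono s L hs HL).
  replace (RtoC 1 - (s + RtoC (INR (S n)) - RtoC 1)) with (1 - s - RtoC (INR n)) in *.
  2:{ rewrite S_INR, RtoC_plus. ring. }
  (* [1 - (s + N - 1) = - m] means [s = 2 - N + m], so avoiding the poles of the Gamma factor also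
     avoids the possible poles of [zeta]. *)
  assert (Hreg : regular n s).
  { intros k Hk E.
    apply (Hm (Z.to_nat (k - (2 - Z.of_nat (S n))))).
    rewrite E, !INR_IZR_INZ, Z2Nat.id; [|lia].
    rewrite <- RtoC_opp, <- !RtoC_minus. f_equal.
    rewrite Nat2Z.inj_succ, !minus_IZR, succ_IZR. ring. }
  assert (E := zeta_left_half n zeta I0 HI0 hzeta s ltac:(lra) Hreg).
  rewrite HK in E.
  set (w := 1 - s - RtoC (INR n)) in *.
  assert (Hw : w + RtoC (INR n) = 1 - s) by (unfold w; ring).
  (* Shifting the argument from [1 - s] to [w] produces [rising w n], which cancels [rising s n] up
     to the sign. *)
  assert (HG : CGamma w * rising w n = Gamma_integral (1 - s)).
  { rewrite <- Hw. apply CGamma_rising; auto.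
    replace (Re w + INR n)%R with (1 - Re s)%R; [lra|].
    unfold w. destruct s; simpl. ring. }
  assert (HRw : rising w n <> 0).
  { apply rising_neq_0. intros j _ Ej. apply (Hm j).
    replace w with ((w + RtoC (INR j)) - RtoC (INR j)) by ring. rewrite Ej. ring. }
  assert (HR : rising w n = (- (1)) ^ n * rising s n) by apply rising_reflect.
  assert (HRs : rising s n <> 0).
  { intros E0. apply HRw. rewrite HR, E0. ring. }
  rewrite <- HG, HR in E.
  assert (Hq : 2 * PI * Ci * Cexp (PI * Ci * s) <> 0).
  { assert (Hpi := PI_RGT_0). apply Cmult_neq_0; [apply Cmult_neq_0; [|apply Ci_nz]|apply Cexp_neq_0].
    rewrite <- RtoC_mult. apply RtoC_neq_0. lra. }
  set (q := 2 * PI * Ci * Cexp (PI * Ci * s)) in *.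
  replace (4 * PI * Ci * Cexp (PI * Ci * s)) with (2 * q) in E by (unfold q; ring).
  transitivity (zeta s * - q * rising s n / (- q * rising s n)).
  - field. auto.
  - rewrite E. field. auto.
Qed.
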